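(* Let $L\subseteq[0,\infty)^r$ be an additive semigroup with $0\in L$, $f$ a holomorphic function on a region $G\subseteq\mathbb C$, and $w$ an admissible weight function on $L$. If $a\in\mathscr A_w(L)$ satisfies $\overline{\widetilde a(\mathbb H^r)}\subseteq G$, then there exists $c\in\mathscr A_w(L)$ with $f\circ\widetilde a=\widetilde c$.
   Context: $\mathbb H=\{\operatorname{Re}s>0\}$. A weight function is $w\colon L\to(0,\infty)$ with $w(0)=1$, $w(\lambda+\lambda')\le w(\lambda)w(\lambda')$; admissible: $w\ge1$ and $\lim_{k\to\infty}w(k\lambda)^{1/k}=1$ for all $\lambda\in L$. $\mathscr A_w(L)$: functions $a\colon L\to\mathbb C$ with $\sum_{\lambda\in L}|a(\lambda)|w(\lambda)<\infty$ and convolution $(a*b)(\lambda)=\sum_{\lambda'+\lambda''=\lambda}a(\lambda')b(\lambda'')$. $\widetilde a(s)=\sum_{\lambda\in L}a(\lambda)e^{-\lambda\cdot s}$ for $s\in\overline{\mathbb H}^r$, with $\lambda\cdot s=\sum_\varrho\lambda_\varrho s_\varrho$. *)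

(* Defs.v *)
From Stdlib Require Import Reals List ClassicalEpsilon.
Open Scope R_scope.

Definition Cplx : Type := (R * R)%type.
Definition Cre (z : Cplx) : R := fst z.
Definition Cim (z : Cplx) : R := snd z.
Definition C0 : Cplx := (0, 0).
Definition Cplus (z w : Cplx) : Cplx := (fst z + fst w, snd z + snd w).
Definition Copp (z : Cplx) : Cplx := (- fst z, - snd z).
Definition Cminus (z w : Cplx) : Cplx := Cplus z (Copp w).
Definition Cmult (z w : Cplx) : Cplx :=
  (fst z * fst w - snd z * snd w, fst z * snd w + snd z * fst w).
Definition Cinv (z : Cplx) : Cplx :=
  (fst z / (fst z ^ 2 + snd z ^ 2), - snd z / (fst z ^ 2 + snd z ^ 2)).
Definition Cdiv (z w : Cplx) : Cplx := Cmult z (Cinv w).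
Definition Cnorm (z : Cplx) : R := sqrt (fst z ^ 2 + snd z ^ 2).
Definition RCmult (t : R) (z : Cplx) : Cplx := (t * fst z, t * snd z).
Definition Cexp (z : Cplx) : Cplx := (exp (fst z) * cos (snd z), exp (fst z) * sin (snd z)).

Definition C_open (U : Cplx -> Prop) : Prop :=
  forall z, U z -> exists eps, 0 < eps /\ forall y, Cnorm (Cminus y z) < eps -> U y.

Definition C_region (G : Cplx -> Prop) : Prop :=
  (exists z, G z) /\ C_open G /\
  (forall U V : Cplx -> Prop, C_open U -> C_open V ->
     (forall z, G z -> U z \/ V z) ->
     (forall z, G z -> U z -> V z -> False) ->
     (exists z, G z /\ U z) -> (exists z, G z /\ V z) -> False).

Definition C_deriv_at (f : Cplx -> Cplx) (z d : Cplx) : Prop :=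
  forall eps, 0 < eps -> exists delta, 0 < delta /\
    forall h, 0 < Cnorm h < delta ->
      Cnorm (Cminus (Cdiv (Cminus (f (Cplus z h)) (f z)) h) d) < eps.

Definition holomorphic_on (f : Cplx -> Cplx) (G : Cplx -> Prop) : Prop :=
  forall z, G z -> exists d, C_deriv_at f z d.

Definition C_closure (S : Cplx -> Prop) (z : Cplx) : Prop :=
  forall eps, 0 < eps -> exists y, S y /\ Cnorm (Cminus z y) < eps.

(** * Vectors in R^r and Cplx^r, represented as functions on nat (only indices < r matter) *)
Definition vec := nat -> R.
Definition cvec := nat -> Cplx.

Fixpoint sum_lt (n : nat) (g : nat -> R) : R :=
  match n with O => 0 | S m => sum_lt m g + g m end.

Definition vzero : vec := fun _ => 0.
Definition vadd (u v : vec) : vec := fun i => u i + v i.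
Definition vscal (t : R) (u : vec) : vec := fun i => t * u i.

Definition vdot (r : nat) (l : vec) (s : cvec) : Cplx :=
  (sum_lt r (fun i => l i * fst (s i)), sum_lt r (fun i => l i * snd (s i))).

Definition expterm (r : nat) (l : vec) (s : cvec) : Cplx := Cexp (Copp (vdot r l s)).

Definition semigroup_in_orthant (r : nat) (L : vec -> Prop) : Prop :=
  (forall l, L l -> (forall i, (i < r)%nat -> 0 <= l i) /\ (forall i, (r <= i)%nat -> l i = 0)) /\
  L vzero /\
  (forall l l', L l -> L l' -> L (vadd l l')).

Definition admissible_weight (L : vec -> Prop) (w : vec -> R) : Prop :=
  w vzero = 1 /\
  (forall l, L l -> 0 < w l) /\
  (forall l l', L l -> L l' -> w (vadd l l') <= w l * w l') /\
  (forall l, L l -> 1 <= w l) /\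
  (forall l, L l -> Un_cv (fun k => Rpower (w (vscal (INR k) l)) (/ INR k)) 1).

Definition Csum_list (l : list Cplx) : Cplx := fold_right Cplus C0 l.
Definition Rsum_list (l : list R) : R := fold_right Rplus 0 l.

Definition fin_sub {T : Type} (P : T -> Prop) (l : list T) : Prop :=
  NoDup l /\ Forall P l.

Definition has_sum {T : Type} (P : T -> Prop) (f : T -> Cplx) (S : Cplx) : Prop :=
  forall eps, 0 < eps -> exists l0, fin_sub P l0 /\
    forall l, fin_sub P l -> incl l0 l -> Cnorm (Cminus (Csum_list (map f l)) S) < eps.

Definition tsum {T : Type} (P : T -> Prop) (f : T -> Cplx) : Cplx :=
  match excluded_middle_informative (exists S, has_sum P f S) with
  | left H => proj1_sig (constructive_indefinite_description _ H)
  | right _ => C0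
  end.

Definition in_Aw (L : vec -> Prop) (w : vec -> R) (a : vec -> Cplx) : Prop :=
  exists M, forall l, fin_sub L l -> Rsum_list (map (fun x => Cnorm (a x) * w x) l) <= M.

Definition transform (r : nat) (L : vec -> Prop) (a : vec -> Cplx) (s : cvec) : Cplx :=
  tsum L (fun l => Cmult (a l) (expterm r l s)).

Definition Hr (r : nat) (s : cvec) : Prop := forall i, (i < r)%nat -> 0 < fst (s i).
Definition Hr_closed (r : nat) (s : cvec) : Prop := forall i, (i < r)%nat -> 0 <= fst (s i).

(* Main.v *)
(** The function [f] composed with an exponential polynomial is expanded first and [a] is reached by
    perturbation.  Split [a = p + q] with [p] finitely supported and [q] of small norm, move a
    small constant [2 eps] from [p] to [q], and view [q~(s)] as the value of one more exponential
    [4 eps e^(-s_r)] in a new variable [s_r]; this is possible with [Re s_r >= 0] because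
    [Re q~ > 0] and [|q~| < 4 eps].

    For the finite exponential polynomial [P] in [r + 1] variables, [f o P] is bounded and holomorphic
    on [Re s > - eta].  Far to the right, the Taylor series of [f] at the constant term of [P] gives
    an absolutely convergent expansion [sum B(l) e^(-l.s)] with [l] in the semigroup spanned by the
    frequencies.  Averaging over vertical translations bounds each coefficient by the supremum on
    the line (Bohr); applied to the Taylor coefficients in the direction [(1,..,1)], this moves the
    domain of absolute convergence left by a fixed amount, hence eventually beyond [0].  So [B(l)]
    decays exponentially, which beats the subexponential growth of [w] on finitely generated
    subsemigroups.  Substituting [q] for the new exponential gives the element [c].

    The Taylor expansions with Cauchy estimates come from Goursat's bisection, applied in the
    coordinates [(t, th)] of the circles [z + t (z0 + rho e^(i th) - z)] shrinking to [z]. *)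
Require Import Defs.
From Stdlib Require Import Reals List ClassicalEpsilon.
From Stdlib Require Import Factorial FunctionalExtensionality Lra Lia Psatz Permutation.
From Coquelicot Require Import Coquelicot.
Import ListNotations.
Local Open Scope R_scope.

(** * Unconditional sums *)

(** The obstacle is that the transform of [a] need not continue to the left of the closed
    half-space, while decay of coefficients requires room there. A finite sum does continue, and
    finitely many frequencies also allow a uniform bound on [w]: admissibility speaks of the
    multiples of one frequency and passes to finitely generated semigroups by submultiplicativity.
    Hence the infinite tail [q] is never expanded together with the finite part. As the exponential
    of a fresh variable it enters only through its powers, and [(q / (4 eps))^k] has norm at most
    [1] because [q] has norm at most [3 eps]. The constant [2 eps] puts each value of [q~] in the
    right half-plane, where a logarithm is at hand; only its existence at each single point matters.

    Control of [f o P] left of the axis comes from comparison: a shift by [2 eta] to the right lands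
    in the open half-space and changes the finite part by at most [eps], so each value of [P] stays
    within [13 eps] of a value of the transform. Compactness gives a [d]-neighbourhood of those
    values on which [f] is holomorphic and bounded, and [eps = d / 20]. *)

Lemma Rinv_ge0 x : 0 < x -> 0 <= / x.
Proof. intros H; apply Rlt_le, Rinv_0_lt_compat, H. Qed.

Lemma exp_ge0 x : 0 <= exp x.
Proof. apply Rlt_le, exp_pos. Qed.

Lemma Cmod_plus_le x y M : Cmod x + Cmod y <= M -> Cmod (x + y) <= M.
Proof. apply Rle_trans, Cmod_triangle. Qed.

Lemma Cmod_plus_lt x y M : Cmod x + Cmod y < M -> Cmod (x + y) < M.
Proof. apply Rle_lt_trans, Cmod_triangle. Qed.

Lemma Cmod_minus_le x y M : Cmod x + Cmod y <= M -> Cmod (x - y) <= M.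
Proof. rewrite <- (Cmod_opp y); apply Cmod_plus_le. Qed.

Lemma Cmod_minus_lt x y M : Cmod x + Cmod y < M -> Cmod (x - y) < M.
Proof. rewrite <- (Cmod_opp y); apply Cmod_plus_lt. Qed.

Lemma NoDup_single {T : Type} (x : T) : NoDup [x].
Proof. constructor; [simpl; tauto|constructor]. Qed.

(** Subsets are decided classically, so that a sum over a subset becomes a sum over the whole index
    type of a function extended by zero. *)
Definition pb (P : Prop) : bool := if excluded_middle_informative P then true else false.

Lemma pbP (P : Prop) : pb P = true <-> P.
Proof. unfold pb; destruct (excluded_middle_informative P); intuition discriminate. Qed.

Lemma pbT (P : Prop) : P -> pb P = true.
Proof. apply pbP. Qed.

Lemma pbF (P : Prop) : ~ P -> pb P = false.
Proof. unfold pb; destruct (excluded_middle_informative P); tauto. Qed.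

Lemma function_choice {X Y : Type} (Rel : X -> Y -> Prop) :
  (forall x, exists y, Rel x y) -> exists h : X -> Y, forall x, Rel x (h x).
Proof.
intros H; exists (fun x => proj1_sig (constructive_indefinite_description _ (H x))); intros x.
exact (proj2_sig (constructive_indefinite_description _ (H x))).
Qed.

Definition dedup {T : Type} (l : list T) : list T :=
  nodup (fun x y => excluded_middle_informative (x = y)) l.

Lemma dedup_NoDup {T} (l : list T) : NoDup (dedup l).
Proof. apply NoDup_nodup. Qed.

Lemma dedup_In {T} (l : list T) (x : T) : In x (dedup l) <-> In x l.
Proof. apply nodup_In. Qed.

Definition csum {T : Type} (f : T -> C) (l : list T) : C := fold_right Cplus (RtoC 0) (map f l).
Definition rsum {T : Type} (f : T -> R) (l : list T) : R := fold_right Rplus 0 (map f l).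

Section FiniteSums.
Context {T : Type}.
Implicit Types (f g : T -> C) (N : T -> R) (l : list T).

Lemma csum_cons f x l : csum f (x :: l) = (f x + csum f l)%C.
Proof. reflexivity. Qed.

Lemma rsum_cons N x l : rsum N (x :: l) = N x + rsum N l.
Proof. reflexivity. Qed.

Lemma csum_app f l l' : csum f (l ++ l') = (csum f l + csum f l')%C.
Proof.
induction l as [|x l IH]; simpl; [unfold csum; simpl; ring|].
rewrite !csum_cons, IH; ring.
Qed.

Lemma rsum_app N l l' : rsum N (l ++ l') = rsum N l + rsum N l'.
Proof.
induction l as [|x l IH]; simpl; [unfold rsum; simpl; ring|].
rewrite !rsum_cons, IH; ring.
Qed.

Lemma csum_perm f l l' : Permutation l l' -> csum f l = csum f l'.
Proof.
induction 1; rewrite ?csum_cons; try congruence; try ring.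
Qed.

Lemma rsum_perm N l l' : Permutation l l' -> rsum N l = rsum N l'.
Proof.
induction 1; rewrite ?rsum_cons; try congruence; try ring.
Qed.

Lemma csum_same f l l' :
  NoDup l -> NoDup l' -> (forall x, In x l <-> In x l') -> csum f l = csum f l'.
Proof. intros; apply csum_perm, NoDup_Permutation; assumption. Qed.

Lemma csum_ext f g l : (forall x, In x l -> f x = g x) -> csum f l = csum g l.
Proof.
intros H; induction l as [|x l IH]; [reflexivity|].
rewrite !csum_cons, H, IH; simpl; auto.
intros y Hy; apply H; simpl; auto.
Qed.

Lemma rsum_le N N' l : (forall x, In x l -> N x <= N' x) -> rsum N l <= rsum N' l.
Proof.
intros H; induction l as [|x l IH]; [apply Rle_refl|].
rewrite !rsum_cons; apply Rplus_le_compat; [apply H; simpl; auto|].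
apply IH; intros y Hy; apply H; simpl; auto.
Qed.

Lemma rsum_ext N N' l : (forall x, In x l -> N x = N' x) -> rsum N l = rsum N' l.
Proof.
intros H; apply Rle_antisym; apply rsum_le; intros x Hx; rewrite (H x Hx); lra.
Qed.

Lemma rsum_ge0 N l : (forall x, In x l -> 0 <= N x) -> 0 <= rsum N l.
Proof.
intros H; induction l as [|x l IH]; [apply Rle_refl|].
rewrite !rsum_cons; apply Rplus_le_le_0_compat; [apply H; simpl; auto|].
apply IH; intros y Hy; apply H; simpl; auto.
Qed.

Lemma csum_plus f g l : csum (fun x => f x + g x)%C l = (csum f l + csum g l)%C.
Proof.
induction l as [|x l IH]; [unfold csum; simpl; ring|].
rewrite !csum_cons, IH; ring.
Qed.

Lemma csum_scal (c : C) f l : csum (fun x => c * f x)%C l = (c * csum f l)%C.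
Proof.
induction l as [|x l IH]; [unfold csum; simpl; ring|].
rewrite !csum_cons, IH; ring.
Qed.

Lemma rsum_plus N N' l : rsum (fun x => N x + N' x) l = rsum N l + rsum N' l.
Proof.
induction l as [|x l IH]; [unfold rsum; simpl; ring|].
rewrite !rsum_cons, IH; ring.
Qed.

Lemma rsum_scal c N l : rsum (fun x => c * N x) l = c * rsum N l.
Proof.
induction l as [|x l IH]; [unfold rsum; simpl; ring|].
rewrite !rsum_cons, IH; ring.
Qed.

Lemma csum_RtoC N l : csum (fun x => RtoC (N x)) l = RtoC (rsum N l).
Proof.
induction l as [|x l IH]; [reflexivity|].
rewrite csum_cons, rsum_cons, IH, RtoC_plus; reflexivity.
Qed.

Lemma csum_le f N l : (forall x, In x l -> Cmod (f x) <= N x) -> Cmod (csum f l) <= rsum N l.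
Proof.
intros H; induction l as [|x l IH].
  unfold csum, rsum; simpl; rewrite Cmod_0; lra.
rewrite csum_cons, rsum_cons; apply Cmod_plus_le.
apply Rplus_le_compat; [apply H; simpl; auto|].
apply IH; intros y Hy; apply H; simpl; auto.
Qed.

Lemma csum_split f (p : T -> bool) l :
  csum f l = (csum f (filter p l) + csum f (filter (fun x => negb (p x)) l))%C.
Proof.
induction l as [|x l IH]; [unfold csum; simpl; ring|].
simpl; destruct (p x); simpl; rewrite !csum_cons, IH; ring.
Qed.

Lemma rsum_split N (p : T -> bool) l :
  rsum N l = rsum N (filter p l) + rsum N (filter (fun x => negb (p x)) l).
Proof.
induction l as [|x l IH]; [unfold rsum; simpl; ring|].
simpl; destruct (p x); simpl; rewrite !rsum_cons, IH; ring.
Qed.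

Lemma csum_0 f l : (forall x, In x l -> f x = 0) -> csum f l = 0.
Proof.
intros H; induction l as [|x l IH]; [reflexivity|].
rewrite csum_cons, H, IH; simpl; auto; [ring|].
intros y Hy; apply H; simpl; auto.
Qed.

Lemma csum_filter f (P : T -> Prop) l :
  csum (fun x => if pb (P x) then f x else 0) l = csum f (filter (fun x => pb (P x)) l).
Proof.
induction l as [|x l IH]; [reflexivity|].
simpl; destruct (pb (P x)) eqn:E; rewrite !csum_cons, IH, E; [reflexivity|ring].
Qed.

Lemma rsum_incl N l l' :
  (forall x, 0 <= N x) -> NoDup l -> incl l l' -> rsum N l <= rsum N l'.
Proof.
intros HN; revert l'; induction l as [|x l IH]; intros l' Hl Hi.
  apply rsum_ge0; auto.
inversion Hl; subst.
destruct (in_split x l') as [l1 [l2 E]]; [apply Hi; simpl; auto|]; subst.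
rewrite rsum_cons, (rsum_perm N (l1 ++ x :: l2) (x :: l1 ++ l2)) by
  (symmetry; apply Permutation_middle).
rewrite rsum_cons; apply Rplus_le_compat_l, IH; auto.
intros y Hy; assert (Hy' := Hi y (or_intror Hy)).
apply in_app_or in Hy'; apply in_or_app; simpl in Hy'.
destruct Hy' as [|[|]]; auto; subst; contradiction.
Qed.

End FiniteSums.

Lemma csum_map {T U} (h : U -> T) (f : T -> C) l : csum f (map h l) = csum (fun u => f (h u)) l.
Proof. unfold csum; rewrite map_map; reflexivity. Qed.

Lemma rsum_map {T U} (h : U -> T) (f : T -> R) l : rsum f (map h l) = rsum (fun u => f (h u)) l.
Proof. unfold rsum; rewrite map_map; reflexivity. Qed.

(** Convergence along the net of finite subsets, as in [has_sum] but over the full type. Absolute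
    summability is expressed by [bounded_sums] of a majorant, which carries a bound for the total
    along with it. *)
Definition sums_to {T : Type} (f : T -> C) (S : C) : Prop :=
  forall eps, 0 < eps -> exists l0, NoDup l0 /\
    forall l, NoDup l -> incl l0 l -> Cmod (csum f l - S) < eps.

Definition bounded_sums {T : Type} (N : T -> R) (M : R) : Prop :=
  forall l, NoDup l -> rsum N l <= M.

Section Sums.
Context {T : Type}.
Implicit Types (f g : T -> C) (N : T -> R) (l : list T).

Lemma bounded_sums_ge0 N M : bounded_sums N M -> 0 <= M.
Proof. intros H; apply (H nil); constructor. Qed.

Lemma bounded_sums_le N N' M :
  (forall x, N x <= N' x) -> bounded_sums N' M -> bounded_sums N M.
Proof. intros H H' l Hl; eapply Rle_trans; [apply rsum_le; auto|apply H', Hl]. Qed.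

Lemma bounded_sums_ub N M M' : M <= M' -> bounded_sums N M -> bounded_sums N M'.
Proof. intros H H' l Hl; eapply Rle_trans; [apply H', Hl|exact H]. Qed.

Lemma bounded_sums_plus N N' M M' :
  bounded_sums N M -> bounded_sums N' M' -> bounded_sums (fun x => N x + N' x) (M + M').
Proof. intros H H' l Hl; rewrite rsum_plus; apply Rplus_le_compat; auto. Qed.

Lemma bounded_sums_scal c N M :
  0 <= c -> bounded_sums N M -> bounded_sums (fun x => c * N x) (c * M).
Proof. intros Hc H l Hl; rewrite rsum_scal; apply Rmult_le_compat_l; auto. Qed.

Lemma bounded_sums_term N M x : bounded_sums N M -> N x <= M.
Proof.
intros H; specialize (H [x]); unfold rsum in H; simpl in H; rewrite Rplus_0_r in H.
apply H; apply NoDup_single.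
Qed.

Lemma sums_to_unique f S S' : sums_to f S -> sums_to f S' -> S = S'.
Proof.
intros H H'.
assert (E : Cmod (S - S') = 0).
  apply Rle_antisym; [|apply Cmod_ge_0].
  apply le_epsilon; intros eps Heps; rewrite Rplus_0_l.
  destruct (H (eps / 2)) as [l0 [_ K]]; [lra|].
  destruct (H' (eps / 2)) as [l1 [_ K']]; [lra|].
  assert (D := dedup_NoDup (l0 ++ l1)).
  specialize (K _ D); specialize (K' _ D).
  replace (S - S')%C with ((csum f (dedup (l0 ++ l1)) - S')
    - (csum f (dedup (l0 ++ l1)) - S))%C by ring.
  apply Cmod_minus_le.
  apply Rlt_le; replace eps with (eps / 2 + eps / 2) by lra.
  apply Rplus_lt_compat; [apply K'|apply K];
  intros x Hx; apply dedup_In, in_or_app; auto.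
apply Cmod_eq_0 in E.
replace S with (S - S' + S')%C by ring; rewrite E; ring.
Qed.

Lemma sums_to_ext f g S : (forall x, f x = g x) -> sums_to f S -> sums_to g S.
Proof. intros H; replace g with f; [auto|apply functional_extensionality, H]. Qed.

Lemma sums_to_plus f g S S' :
  sums_to f S -> sums_to g S' -> sums_to (fun x => f x + g x)%C (S + S').
Proof.
intros H H' eps Heps.
destruct (H (eps / 2)) as [l0 [_ K]]; [lra|].
destruct (H' (eps / 2)) as [l1 [_ K']]; [lra|].
exists (dedup (l0 ++ l1)); split; [apply dedup_NoDup|]; intros l Hl Hi.
rewrite csum_plus.
replace (csum f l + csum g l - (S + S'))%C with ((csum f l - S) + (csum g l - S'))%C by ring.
apply Cmod_plus_lt.
replace eps with (eps / 2 + eps / 2) by lra.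
apply Rplus_lt_compat; [apply K|apply K']; auto;
intros x Hx; apply Hi, dedup_In, in_or_app; auto.
Qed.

Lemma sums_to_scal (c : C) f S : sums_to f S -> sums_to (fun x => c * f x)%C (c * S).
Proof.
intros H eps Heps.
assert (Hc : 0 < Cmod c + 1) by (generalize (Cmod_ge_0 c); lra).
destruct (H (eps / (Cmod c + 1))) as [l0 [Hl0 K]]; [apply Rdiv_lt_0_compat; lra|].
exists l0; split; [auto|]; intros l Hl Hi.
rewrite csum_scal; replace (c * csum f l - c * S)%C with (c * (csum f l - S))%C by ring.
rewrite Cmod_mult; specialize (K l Hl Hi).
apply Rle_lt_trans with ((Cmod c) * (eps / (Cmod c + 1))).
  apply Rmult_le_compat_l; [apply Cmod_ge_0|lra].
apply Rlt_le_trans with ((Cmod c + 1) * (eps / (Cmod c + 1))).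
  apply Rmult_lt_compat_r; [apply Rdiv_lt_0_compat|]; lra.
right; field; lra.
Qed.

Lemma sums_to_finite f (F : list T) :
  NoDup F -> (forall x, ~ In x F -> f x = 0) -> sums_to f (csum f F).
Proof.
intros HF H eps Heps; exists F; split; [auto|]; intros l Hl Hi.
rewrite (csum_split f (fun x => pb (In x F)) l).
rewrite (csum_0 f (filter (fun x => negb _) l)).
  rewrite (csum_same f (filter (fun x => pb (In x F)) l) F); auto.
    replace (csum f F + 0 - csum f F)%C with (RtoC 0) by ring; rewrite Cmod_0; auto.
    apply NoDup_filter; auto.
  intros x; rewrite filter_In, pbP; split; [tauto|]; auto.
intros x; rewrite filter_In; intros [_ Hx]; apply H.
intros Hx'; apply pbP in Hx'; rewrite Hx' in Hx; discriminate.
Qed.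

Lemma sums_to_0 : sums_to (fun _ : T => RtoC 0) 0.
Proof. apply (sums_to_finite (fun _ => RtoC 0) nil); [constructor|auto]. Qed.

Lemma bounded_sums_finite N (F : list T) :
  NoDup F -> (forall x, 0 <= N x) -> (forall x, ~ In x F -> N x = 0) ->
  bounded_sums N (rsum N F).
Proof.
intros HF HN H l Hl.
rewrite (rsum_split N (fun x => pb (In x F)) l).
assert (E : rsum N (filter (fun x => negb (pb (In x F))) l) <= 0).
  apply Rle_trans with (rsum (fun _ : T => 0 * 0) (filter (fun x => negb (pb (In x F))) l)).
  apply rsum_le; intros x; rewrite filter_In; intros [_ Hx].
  rewrite H; [lra|]; intros Hx'; apply pbP in Hx'; rewrite Hx' in Hx; discriminate.
  rewrite rsum_scal; lra.
enough (rsum N (filter (fun x => pb (In x F)) l) <= rsum N F) by lra.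
apply rsum_incl; auto; [apply NoDup_filter; auto|].
intros x; rewrite filter_In, pbP; tauto.
Qed.

(** A finite list whose sum comes within [eps] of the supremum works: a disjoint list of sum at
    least [eps], appended to it, would pass the supremum. *)
Lemma tail_small N M :
  bounded_sums N M -> forall eps, 0 < eps -> exists l0, NoDup l0 /\
    forall l, NoDup l -> (forall x, In x l -> ~ In x l0) -> rsum N l < eps.
Proof.
intros H eps Heps.
destruct (completeness (fun v => exists l, NoDup l /\ v = rsum N l)) as [s [Hs1 Hs2]].
  exists M; intros v [l [Hl Ev]]; rewrite Ev; auto.
  exists 0, nil; split; [constructor|reflexivity].
destruct (classic (exists l, NoDup l /\ s - eps < rsum N l)) as [[l0 [Hl0 K]]|K].
  exists l0; split; [auto|]; intros l Hl Hd.
  assert (rsum N (l0 ++ l) <= s).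
    apply Hs1; exists (l0 ++ l); split; [|reflexivity].
    apply NoDup_app; auto; intros x Hx Hx'; apply (Hd x); auto.
  rewrite rsum_app in H0; lra.
exfalso; assert (s <= s - eps); [|lra].
apply Hs2; intros v [l [Hl Ev]]; subst.
apply Rnot_lt_le; intros Hlt; apply K; exists l; auto.
Qed.

Lemma sums_to_nonneg N M :
  (forall x, 0 <= N x) -> bounded_sums N M -> exists S, sums_to (fun x => RtoC (N x)) (RtoC S).
Proof.
intros HN H.
destruct (completeness (fun v => exists l, NoDup l /\ v = rsum N l)) as [s [Hs1 Hs2]].
  exists M; intros v [l [Hl Ev]]; rewrite Ev; auto.
  exists 0, nil; split; [constructor|reflexivity].
exists s; intros eps Heps.
destruct (classic (exists l, NoDup l /\ s - eps < rsum N l)) as [[l0 [Hl0 K]]|K].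
  exists l0; split; [auto|]; intros l Hl Hi.
  rewrite csum_RtoC, <- RtoC_minus, Cmod_R.
  assert (rsum N l <= s) by (apply Hs1; exists l; auto).
  assert (rsum N l0 <= rsum N l) by (apply rsum_incl; auto).
  rewrite Rabs_left1; lra.
exfalso; assert (s <= s - eps); [|lra].
apply Hs2; intros v [l [Hl Ev]]; subst.
apply Rnot_lt_le; intros Hlt; apply K; exists l; auto.
Qed.

(** Both [h + N] and [N] are nonnegative with bounded sums, and [h] is their difference. *)
Lemma sums_to_real (h : T -> R) N M :
  (forall x, Rabs (h x) <= N x) -> bounded_sums N M -> exists S, sums_to (fun x => RtoC (h x)) S.
Proof.
intros HN H.
assert (P : forall x, 0 <= N x) by (intros x; eapply Rle_trans; [apply Rabs_pos|apply HN]).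
destruct (sums_to_nonneg N M) as [S1 H1]; auto.
destruct (sums_to_nonneg (fun x => h x + N x) (2 * M)) as [S2 H2].
  intros x; specialize (HN x); apply Rabs_le_between in HN; lra.
  apply bounded_sums_le with (fun x => 2 * N x).
    intros x; specialize (HN x); apply Rabs_le_between in HN; lra.
  apply bounded_sums_scal; [lra|auto].
exists (S2 + (-1) * S1)%C.
apply sums_to_ext with (fun x => RtoC (h x + N x) + (-1) * RtoC (N x))%C.
  intros x; rewrite RtoC_plus; ring.
apply sums_to_plus; [|apply sums_to_scal]; auto.
Qed.

Lemma sums_to_exists f N M :
  (forall x, Cmod (f x) <= N x) -> bounded_sums N M -> exists S, sums_to f S.
Proof.
intros HN H.
destruct (sums_to_real (fun x => fst (f x)) N M) as [S1 H1]; auto.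
  intros x; eapply Rle_trans; [|apply HN]; eapply Rle_trans; [apply Rmax_l|apply Rmax_Cmod].
destruct (sums_to_real (fun x => snd (f x)) N M) as [S2 H2]; auto.
  intros x; eapply Rle_trans; [|apply HN]; eapply Rle_trans; [apply Rmax_r|apply Rmax_Cmod].
exists (S1 + Ci * S2)%C.
apply sums_to_ext with (fun x => RtoC (fst (f x)) + Ci * RtoC (snd (f x)))%C.
  intros x; destruct (f x) as [u v]; unfold RtoC, Ci, Cplus, Cmult; simpl; f_equal; ring.
apply sums_to_plus; [|apply sums_to_scal]; auto.
Qed.

Lemma sums_to_le f N M S :
  (forall x, Cmod (f x) <= N x) -> bounded_sums N M -> sums_to f S -> Cmod S <= M.
Proof.
intros HN H HS; apply le_epsilon; intros eps Heps.
destruct (HS eps Heps) as [l0 [Hl0 K]].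
specialize (K l0 Hl0 (incl_refl _)).
replace S with (csum f l0 - (csum f l0 - S))%C by ring.
apply Cmod_minus_le.
assert (Cmod (csum f l0) <= rsum N l0) by (apply csum_le; auto).
specialize (H l0 Hl0); lra.
Qed.

End Sums.

(** * Regrouping a sum along the fibres of a map *)

Section Collapse.
Context {T U : Type}.
Variable phi : T -> U.

Definition on_fiber (u : U) (f : T -> C) (t : T) : C := if pb (phi t = u) then f t else 0.

Lemma fiber_approx (f : T -> C) (u : U) (s : C) (l0 : list T) eps :
  sums_to (on_fiber u f) s -> 0 < eps ->
  exists L, NoDup L /\ (forall t, In t L -> phi t = u) /\
    (forall t, In t l0 -> phi t = u -> In t L) /\ Cmod (csum f L - s) < eps.
Proof.
intros H Heps; destruct (H eps Heps) as [lu [_ K]].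
exists (filter (fun t => pb (phi t = u)) (dedup (lu ++ l0))); split; [|split; [|split]].
- apply NoDup_filter, dedup_NoDup.
- intros t; rewrite filter_In, pbP; tauto.
- intros t Ht E; rewrite filter_In, pbP, dedup_In, in_app_iff; auto.
- unfold on_fiber in K; rewrite <- csum_filter; apply K; [apply dedup_NoDup|].
  intros t Ht; apply dedup_In, in_or_app; auto.
Qed.

(** The clause on [l0] is what later forces the union of the chosen pieces to contain all of [l0],
    so that the convergence of the full sum applies to it. *)
Lemma fibers_approx (f : T -> C) (g : U -> C) (l0 : list T) :
  (forall u, sums_to (on_fiber u f) (g u)) ->
  forall l, NoDup l -> forall eps, 0 < eps ->
  exists L, NoDup L /\ (forall t, In t L -> In (phi t) l) /\
    (forall t, In t l0 -> In (phi t) l -> In t L) /\ Cmod (csum f L - csum g l) < eps.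
Proof.
intros H; induction l as [|u l IH]; intros Hl eps Heps.
  exists nil; split; [constructor|]; split; [|split]; simpl; auto.
  unfold csum; simpl; replace (RtoC 0 - RtoC 0)%C with (RtoC 0) by ring.
  rewrite Cmod_0; auto.
inversion Hl; subst.
destruct (IH H3 (eps / 2)) as [L1 [A1 [B1 [C1 D1]]]]; [lra|].
destruct (fiber_approx f u (g u) l0 (eps / 2) (H u)) as [L2 [A2 [B2 [C2 D2]]]]; [lra|].
exists (L2 ++ L1); split; [|split; [|split]].
- apply NoDup_app; auto; intros t Ht Ht'.
  apply H2; rewrite <- (B2 t Ht); auto.
- intros t Ht; apply in_app_or in Ht; destruct Ht as [Ht|Ht]; simpl; auto.
  left; symmetry; auto.
- intros t Ht [E|E]; apply in_or_app; auto.
- rewrite csum_app, csum_cons.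
  replace (csum f L2 + csum f L1 - (g u + csum g l))%C with
    ((csum f L2 - g u) + (csum f L1 - csum g l))%C by ring.
  apply Cmod_plus_lt; lra.
Qed.

(** Once [l] contains the image of [l0], a union of finite pieces of the fibres over [l] contains
    [l0]. Its sum is then close both to [S] and to the sum of [g] over [l]. *)
Lemma sums_to_collapse (f : T -> C) (g : U -> C) (S : C) :
  sums_to f S -> (forall u, sums_to (on_fiber u f) (g u)) -> sums_to g S.
Proof.
intros HS H eps Heps.
destruct (HS (eps / 2)) as [l0 [Hl0 K]]; [lra|].
exists (dedup (map phi l0)); split; [apply dedup_NoDup|]; intros l Hl Hi.
destruct (fibers_approx f g l0 H l Hl (eps / 2)) as [L [A [B [D E]]]]; [lra|].
assert (K' : Cmod (csum f L - S) < eps / 2).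
  apply K; auto; intros t Ht; apply D; auto.
  apply Hi, dedup_In, in_map, Ht.
replace (csum g l - S)%C with ((csum f L - S) - (csum f L - csum g l))%C by ring.
apply Cmod_minus_lt; lra.
Qed.

(** The triangle inequality in each fibre, on which [W (phi t)] is constant: pushing coefficients
    forward does not increase a weighted norm. This is how the final element is placed in the
    weighted algebra. *)
Lemma bounded_sums_collapse (f : T -> C) (g : U -> C) (W : U -> R) (N : T -> R) (M : R) :
  (forall u, 0 <= W u) -> (forall t, Cmod (f t) * W (phi t) <= N t) -> bounded_sums N M ->
  (forall u, sums_to (on_fiber u f) (g u)) -> bounded_sums (fun u => Cmod (g u) * W u) M.
Proof.
intros HW HN HM H l Hl.
assert (K : forall eps, 0 < eps -> exists L, NoDup L /\ (forall t, In t L -> In (phi t) l) /\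
  rsum (fun u => Cmod (g u) * W u) l <= rsum N L + eps).
  induction l as [|u l IH]; intros eps Heps.
    exists nil; split; [constructor|]; split; simpl; auto; unfold rsum; simpl; lra.
  inversion Hl; subst.
  destruct (IH H3 (eps / 2)) as [L1 [A1 [B1 D1]]]; [lra|].
  (* [W u] may vanish. The added [1] keeps the tolerance meaningful, and multiplied by [W u] the
     tolerance is still at most [eps / 2]. *)
  assert (Hw : 0 < W u + 1) by (specialize (HW u); lra).
  destruct (fiber_approx f u (g u) nil (eps / 2 / (W u + 1)) (H u)) as [L2 [A2 [B2 [_ D2]]]].
    apply Rdiv_lt_0_compat; lra.
  exists (L2 ++ L1); split; [|split].
  - apply NoDup_app; auto; intros t Ht Ht'.
    apply H2; rewrite <- (B2 t Ht); auto.
  - intros t Ht; apply in_app_or in Ht; destruct Ht as [Ht|Ht]; simpl; auto.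
    left; symmetry; auto.
  - rewrite rsum_app, rsum_cons.
    enough (Cmod (g u) * W u <= rsum N L2 + eps / 2) by lra.
    apply Rle_trans with ((Cmod (csum f L2) + eps / 2 / (W u + 1)) * W u).
      apply Rmult_le_compat_r; auto.
      replace (g u) with (csum f L2 - (csum f L2 - g u))%C by ring.
      apply Cmod_minus_le; lra.
    rewrite Rmult_plus_distr_r; apply Rplus_le_compat.
      apply Rle_trans with (rsum (fun t => Cmod (f t)) L2 * W u).
        apply Rmult_le_compat_r; auto; apply csum_le; intros; lra.
      rewrite Rmult_comm, <- rsum_scal; apply rsum_le; intros t Ht.
      rewrite Rmult_comm, <- (B2 t Ht); auto.
    apply Rle_trans with (eps / 2 / (W u + 1) * (W u + 1)).
      apply Rmult_le_compat_l; [|lra].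
      apply Rlt_le, Rdiv_lt_0_compat; lra.
    right; field; lra.
apply le_epsilon; intros eps Heps; destruct (K eps Heps) as [L [A [_ B]]].
specialize (HM L A); lra.
Qed.

Lemma bounded_sums_fibers (N : T -> R) (N1 : U -> R) (M : R) :
  (forall u l, NoDup l -> (forall t, In t l -> phi t = u) -> rsum N l <= N1 u) ->
  bounded_sums N1 M -> bounded_sums N M.
Proof.
intros H HM.
assert (K : forall us, NoDup us -> forall l, NoDup l -> (forall t, In t l -> In (phi t) us) ->
  rsum N l <= rsum N1 us).
  induction us as [|u us IH]; intros Hus l Hl Hi.
    destruct l as [|t l]; [right; reflexivity|]; exfalso; apply (Hi t); simpl; auto.
  inversion Hus; subst.
  rewrite (rsum_split N (fun t => pb (phi t = u)) l), rsum_cons; apply Rplus_le_compat.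
    apply H; [apply NoDup_filter; auto|]; intros t; rewrite filter_In, pbP; tauto.
  apply IH; auto; [apply NoDup_filter; auto|].
  intros t; rewrite filter_In; intros [Ht E].
  destruct (Hi t Ht) as [E'|]; auto.
  rewrite pbT in E; [discriminate|auto].
intros l Hl; apply Rle_trans with (rsum N1 (dedup (map phi l))); [|apply HM, dedup_NoDup].
apply K; auto; [apply dedup_NoDup|]; intros t Ht; apply dedup_In, in_map, Ht.
Qed.

End Collapse.

Section Reindex.
Context {T U : Type}.
Variable iota : U -> T.
Hypothesis iota_inj : forall u v, iota u = iota v -> u = v.

Lemma preimage_list (l : list T) :
  NoDup l -> exists l', NoDup l' /\ map iota l' = filter (fun t => pb (exists u, iota u = t)) l.
Proof.
induction l as [|t l IH]; intros Hl.
  exists nil; split; [constructor|reflexivity].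
inversion Hl; subst; destruct (IH H2) as [l' [A B]].
simpl; destruct (pb (exists u, iota u = t)) eqn:E; [|exists l'; auto].
rewrite pbP in E; destruct E as [u Eu]; exists (u :: l'); split.
  constructor; auto; intros Hu; apply H1; apply (in_map iota) in Hu.
  rewrite B, Eu, filter_In in Hu; tauto.
simpl; rewrite Eu, B; reflexivity.
Qed.

Lemma sums_to_reindex (f : T -> C) (S : C) :
  (forall t, (forall u, iota u <> t) -> f t = 0) ->
  sums_to (fun u => f (iota u)) S -> sums_to f S.
Proof.
intros Hf H eps Heps; destruct (H eps Heps) as [l0 [Hl0 K]].
exists (map iota l0); split.
  apply FinFun.Injective_map_NoDup; auto.
intros l Hl Hi; destruct (preimage_list l Hl) as [l' [A B]].
rewrite (csum_split f (fun t => pb (exists u, iota u = t)) l), <- B, csum_map.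
rewrite (csum_0 f (filter (fun x => negb _) l)).
  rewrite Cplus_0_r; apply K; auto; intros u Hu.
  assert (Hu' : In (iota u) (map iota l')).
    rewrite B, filter_In, pbP; split; [apply Hi, in_map, Hu|exists u; auto].
  apply in_map_iff in Hu'; destruct Hu' as [v [Ev Hv]]; apply iota_inj in Ev; subst; auto.
intros t; rewrite filter_In; intros [_ E]; apply Hf; intros u Eu.
rewrite pbT in E; [discriminate|exists u; auto].
Qed.

Lemma bounded_sums_reindex (N : T -> R) (M : R) :
  (forall t, (forall u, iota u <> t) -> N t = 0) ->
  bounded_sums (fun u => N (iota u)) M -> bounded_sums N M.
Proof.
intros Hf H l Hl; destruct (preimage_list l Hl) as [l' [A B]].
rewrite (rsum_split N (fun t => pb (exists u, iota u = t)) l), <- B, rsum_map.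
rewrite (rsum_ext N (fun t => 0 * 0) (filter (fun x => negb _) l)).
  rewrite rsum_scal, Rmult_0_l, Rplus_0_r; apply H, A.
intros t; rewrite filter_In; intros [_ E]; rewrite Hf; [ring|]; intros u Eu.
rewrite pbT in E; [discriminate|exists u; auto].
Qed.

End Reindex.

(** Regrouping along [fst], whose fibres are copies of [U]. Together with [sums_to_swap] it replaces
    Fubini's theorem throughout. *)
Lemma sums_to_iterated {T U : Type} (f : T * U -> C) (g : T -> C) (S : C) :
  sums_to f S -> (forall t, sums_to (fun u => f (t, u)) (g t)) -> sums_to g S.
Proof.
intros HS H; apply (sums_to_collapse fst f g S HS); intros t.
apply (sums_to_reindex (fun u => (t, u))).
- intros u v E; injection E; auto.
- intros [t' u] Hn; unfold on_fiber; simpl; rewrite pbF; [reflexivity|].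
  intros E; apply (Hn u); congruence.
- apply sums_to_ext with (2 := H t); intros u; unfold on_fiber; rewrite pbT; reflexivity.
Qed.

Lemma bounded_sums_iterated {T U : Type} (N : T * U -> R) (N1 : T -> R) (M : R) :
  (forall t, bounded_sums (fun u => N (t, u)) (N1 t)) -> bounded_sums N1 M -> bounded_sums N M.
Proof.
intros H; apply (bounded_sums_fibers fst); intros t l Hl Hf.
rewrite (rsum_ext N (fun p => N (t, snd p)) l).
  rewrite <- (rsum_map snd (fun u => N (t, u))); apply H.
  clear - Hl Hf; induction l as [|[t' u] l IH]; [constructor|].
  inversion Hl; subst; simpl; constructor.
    rewrite in_map_iff; intros [[t'' v] [E K]]; simpl in E; subst; apply H1.
    assert (t'' = t) by (apply (Hf (t'', u)); simpl; auto).
    assert (t' = t) by (apply (Hf (t', u)); simpl; auto).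
    subst; auto.
  apply IH; auto; intros; apply Hf; simpl; auto.
intros [t' u] Hp; rewrite <- (Hf _ Hp); reflexivity.
Qed.

Lemma sums_to_swap {T U : Type} (f : T * U -> C) (S : C) :
  sums_to f S -> sums_to (fun p : U * T => f (snd p, fst p)) S.
Proof.
intros H; apply (sums_to_reindex (fun p : T * U => (snd p, fst p))).
- intros [a b] [a' b'] E; injection E; simpl; congruence.
- intros [a b] Hn; exfalso; apply (Hn (b, a)); reflexivity.
- apply sums_to_ext with (2 := H); intros [a b]; reflexivity.
Qed.

(** The majorants make the family of products summable over pairs; its sum is then identified row by
    row. *)
Lemma sums_to_mult {T U : Type} (f : T -> C) (g : U -> C) (N : T -> R) (N' : U -> R) M M' S S' :
  (forall t, Cmod (f t) <= N t) -> bounded_sums N M ->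
  (forall u, Cmod (g u) <= N' u) -> bounded_sums N' M' ->
  sums_to f S -> sums_to g S' -> sums_to (fun p => f (fst p) * g (snd p))%C (S * S').
Proof.
intros Hf HN Hg HN' HS HS'.
assert (PN : forall t, 0 <= N t) by (intros; eapply Rle_trans; [apply Cmod_ge_0|apply Hf]).
assert (PM := bounded_sums_ge0 _ _ HN').
destruct (sums_to_exists (fun p => f (fst p) * g (snd p))%C (fun p => N (fst p) * N' (snd p))
  (M' * M)) as [Z HZ].
- intros [t u]; simpl; rewrite Cmod_mult.
  apply Rmult_le_compat; auto; apply Cmod_ge_0.
- apply bounded_sums_iterated with (fun t => M' * N t); simpl.
    intros t; rewrite (Rmult_comm M'); apply bounded_sums_scal; auto.
  apply bounded_sums_scal; auto.
- assert (H := sums_to_iterated _ (fun t => f t * S')%C Z HZ); simpl in H.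
  replace (S * S')%C with Z; [exact HZ|].
  apply sums_to_unique with (fun t => f t * S')%C.
    apply H; intros t; apply sums_to_scal, HS'.
  rewrite Cmult_comm; apply sums_to_ext with (fun t => S' * f t)%C.
    intros t; apply Cmult_comm.
  apply sums_to_scal, HS.
Qed.

(** * Powers of an infinite sum *)

Definition cprod {T : Type} (f : T -> C) (l : list T) : C := fold_right Cmult (RtoC 1) (map f l).
Definition rprod {T : Type} (f : T -> R) (l : list T) : R := fold_right Rmult 1 (map f l).

Lemma cprod_le {T} (f : T -> C) (N : T -> R) l :
  (forall t, Cmod (f t) <= N t) -> Cmod (cprod f l) <= rprod N l.
Proof.
intros H; induction l as [|x l IH]; unfold cprod, rprod; simpl.
  rewrite Cmod_1; lra.
rewrite Cmod_mult; apply Rmult_le_compat; auto using Cmod_ge_0.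
Qed.

Lemma rprod_ge0 {T} (N : T -> R) l : (forall t, 0 <= N t) -> 0 <= rprod N l.
Proof.
intros H; induction l as [|x l IH]; unfold rprod; simpl; [lra|].
apply Rmult_le_pos; auto.
Qed.

Definition cons_pair {T : Type} (p : T * list T) : list T := fst p :: snd p.

Lemma cons_pair_inj {T} (p q : T * list T) : cons_pair p = cons_pair q -> p = q.
Proof. destruct p, q; unfold cons_pair; simpl; congruence. Qed.

Lemma bounded_sums_words {T} (N : T -> R) M k :
  (forall t, 0 <= N t) -> bounded_sums N M ->
  bounded_sums (fun l => if pb (length l = k) then rprod N l else 0) (M ^ k).
Proof.
intros HN H; assert (HM := bounded_sums_ge0 _ _ H); induction k as [|k IH].
  replace (M ^ 0) with
    (rsum (fun l : list T => if pb (length l = 0%nat) then rprod N l else 0) [nil]).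
  apply bounded_sums_finite.
  - apply NoDup_single.
  - intros l; destruct (pb _); [apply rprod_ge0, HN|lra].
  - intros l Hl; rewrite pbF; auto; destruct l; simpl in *; [tauto|discriminate].
  unfold rsum; simpl; rewrite pbT; [unfold rprod; simpl; ring|reflexivity].
apply (bounded_sums_reindex cons_pair).
  intros [|t l] Hn; [rewrite pbF; auto|exfalso; apply (Hn (t, l)); reflexivity].
apply bounded_sums_iterated with (fun t => M ^ k * N t).
  intros t; apply bounded_sums_le with (fun l =>
    N t * (if pb (length l = k) then rprod N l else 0)).
    intros l; unfold cons_pair; simpl; destruct (excluded_middle_informative (length l = k)).
      rewrite !pbT; auto; unfold rprod; simpl; lra.
    rewrite !pbF; auto; lra.
  rewrite Rmult_comm; apply bounded_sums_scal; auto.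
simpl; rewrite Rmult_comm; apply bounded_sums_scal; auto; apply pow_le, HM.
Qed.

(** Distributivity with words as indices, so that no multinomial coefficients arise. Splitting off
    the first letter reduces length [k + 1] to a product of two sums. *)
Lemma sums_to_words {T} (f : T -> C) (N : T -> R) M S k :
  (forall t, Cmod (f t) <= N t) -> bounded_sums N M -> sums_to f S ->
  sums_to (fun l => if pb (length l = k) then cprod f l else 0) (S ^ k)%C.
Proof.
intros HN HM HS.
assert (PN : forall t, 0 <= N t) by (intros; eapply Rle_trans; [apply Cmod_ge_0|apply HN]).
induction k as [|k IH].
  replace (S ^ 0)%C with
    (csum (fun l : list T => if pb (length l = 0%nat) then cprod f l else 0) [nil]).
  apply sums_to_finite.
  - apply NoDup_single.
  - intros l Hl; rewrite pbF; auto; destruct l; simpl in *; [tauto|discriminate].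
  unfold csum; simpl; rewrite pbT; [unfold cprod; simpl; ring|reflexivity].
apply (sums_to_reindex cons_pair cons_pair_inj).
  intros [|t l] Hn; [rewrite pbF; auto|exfalso; apply (Hn (t, l)); reflexivity].
apply sums_to_ext with (fun p : T * list T =>
  f (fst p) * (if pb (length (snd p) = k) then cprod f (snd p) else 0))%C.
  intros [t l]; unfold cons_pair; simpl; destruct (excluded_middle_informative (length l = k)).
    rewrite !pbT; auto.
  rewrite !pbF; auto; ring.
simpl; apply (sums_to_mult f (fun l => if pb (length l = k) then cprod f l else 0) N
  (fun l => if pb (length l = k) then rprod N l else 0) M (M ^ k)); auto.
  intros l; destruct (pb _); [apply cprod_le, HN|rewrite Cmod_0; lra].
apply bounded_sums_words; auto.
Qed.

(** * Complex-valued functions of a real variable *)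

Definition cis (x : R) : C := (cos x, sin x).

Lemma Cmod_cis x : Cmod (cis x) = 1.
Proof.
unfold Cmod, cis; simpl.
replace (cos x * (cos x * 1) + sin x * (sin x * 1)) with 1; [apply sqrt_1|].
generalize (sin2_cos2 x); unfold Rsqr; lra.
Qed.

Lemma cis_plus x y : cis (x + y) = (cis x * cis y)%C.
Proof. unfold cis, Cmult; simpl; rewrite cos_plus, sin_plus; f_equal; ring. Qed.

Lemma cis_0 : cis 0 = 1.
Proof. unfold cis; rewrite cos_0, sin_0; reflexivity. Qed.

Lemma cis_pow x n : (cis x ^ n)%C = cis (INR n * x).
Proof.
induction n as [|n IH].
  simpl; rewrite Rmult_0_l, cis_0; reflexivity.
rewrite S_INR; replace ((INR n + 1) * x) with (x + INR n * x) by ring.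
rewrite cis_plus, <- IH; reflexivity.
Qed.

Lemma Cmod_le_sum (z : C) : Cmod z <= Rabs (fst z) + Rabs (snd z).
Proof.
replace z with (RtoC (fst z) + Ci * RtoC (snd z))%C at 1.
  apply Cmod_plus_le.
  rewrite Cmod_mult, Cmod_Ci, !Cmod_R; lra.
destruct z as [x y]; unfold RtoC, Ci, Cplus, Cmult; simpl; f_equal; ring.
Qed.

Lemma fst_le_Cmod (z : C) : Rabs (fst z) <= Cmod z.
Proof. eapply Rle_trans; [apply Rmax_l|apply Rmax_Cmod]. Qed.

Lemma snd_le_Cmod (z : C) : Rabs (snd z) <= Cmod z.
Proof. eapply Rle_trans; [apply Rmax_r|apply Rmax_Cmod]. Qed.

Lemma Cmod_minus_sym (x y : C) : Cmod (x - y) = Cmod (y - x).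
Proof. rewrite <- Cmod_opp; f_equal; ring. Qed.

(** The difference quotient is multiplied out, which makes [h = 0] harmless and spares the estimates
    a division. *)
Definition cdiff (f : C -> C) (z : C) : Prop :=
  exists d : C, forall eps, 0 < eps -> exists delta, 0 < delta /\
    forall h, Cmod h < delta -> Cmod (f (z + h)%C - f z - d * h) <= eps * Cmod h.

Lemma cdiff_cont f z : cdiff f z ->
  forall eps, 0 < eps -> exists delta, 0 < delta /\
    forall y, Cmod (y - z) < delta -> Cmod (f y - f z) < eps.
Proof.
intros [d H] eps Heps; destruct (H 1 Rlt_0_1) as [delta [Hd K]].
assert (Hc := Cmod_ge_0 d).
exists (Rmin delta (eps / (Cmod d + 2))); split.
  apply Rmin_pos; [auto|apply Rdiv_lt_0_compat; lra].
intros y Hy; assert (Hy1 := Rlt_le_trans _ _ _ Hy (Rmin_l _ _)).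
assert (Hy2 := Rlt_le_trans _ _ _ Hy (Rmin_r _ _)).
specialize (K _ Hy1); replace (z + (y - z))%C with y in K by ring.
replace (f y - f z)%C with ((f y - f z - d * (y - z)) + d * (y - z))%C by ring.
apply Cmod_plus_lt; rewrite Cmod_mult.
apply Rle_lt_trans with ((Cmod d + 1) * Cmod (y - z)); [lra|].
apply Rle_lt_trans with ((Cmod d + 1) * (eps / (Cmod d + 2))).
  apply Rmult_le_compat_l; lra.
apply Rlt_le_trans with ((Cmod d + 2) * (eps / (Cmod d + 2))).
  apply Rmult_lt_compat_r; [apply Rdiv_lt_0_compat|]; lra.
right; field; lra.
Qed.

(** Componentwise, to fit the continuity and integration theory of real functions. *)
Definition ccont (f : R -> C) (t : R) : Prop :=
  continuous (fun x => fst (f x)) t /\ continuous (fun x => snd (f x)) t.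

Lemma continuous_eps (g : R -> R) t :
  (forall eps, 0 < eps -> exists delta, 0 < delta /\
     forall x, Rabs (x - t) < delta -> Rabs (g x - g t) < eps) -> continuous g t.
Proof.
intros H P [eps HP]; destruct (H eps (cond_pos eps)) as [delta [Hd K]].
exists (mkposreal _ Hd); intros y Hy; apply HP, K, Hy.
Qed.

Lemma ccont_eps (f : R -> C) t :
  (forall eps, 0 < eps -> exists delta, 0 < delta /\
     forall x, Rabs (x - t) < delta -> Cmod (f x - f t) < eps) -> ccont f t.
Proof.
intros H; split; apply continuous_eps; intros eps Heps; destruct (H eps Heps) as [d [Hd K]];
exists d; split; auto; intros x Hx; eapply Rle_lt_trans; try apply (K x Hx).
- apply (fst_le_Cmod (f x - f t)).
- apply (snd_le_Cmod (f x - f t)).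
Qed.

Lemma ccont_mod (f : R -> C) t : ccont f t ->
  forall eps, 0 < eps -> exists delta, 0 < delta /\
     forall x, Rabs (x - t) < delta -> Cmod (f x - f t) < eps.
Proof.
intros [H1 H2] eps Heps.
assert (E : 0 < eps / 2) by lra.
destruct (H1 (ball (fst (f t)) (mkposreal _ E))) as [d1 K1]; [exists (mkposreal _ E); auto|].
destruct (H2 (ball (snd (f t)) (mkposreal _ E))) as [d2 K2]; [exists (mkposreal _ E); auto|].
exists (Rmin d1 d2); split; [apply Rmin_pos; apply cond_pos|]; intros x Hx.
specialize (K1 x (Rlt_le_trans _ _ _ Hx (Rmin_l _ _))).
specialize (K2 x (Rlt_le_trans _ _ _ Hx (Rmin_r _ _))).
change (Rabs (fst (f x) - fst (f t)) < eps / 2) in K1.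
change (Rabs (snd (f x) - snd (f t)) < eps / 2) in K2.
eapply Rle_lt_trans; [apply Cmod_le_sum|].
change (Rabs (fst (f x) - fst (f t)) + Rabs (snd (f x) - snd (f t)) < eps); lra.
Qed.

Lemma ccont_const c t : ccont (fun _ => c) t.
Proof. split; apply continuous_const. Qed.

Lemma ccont_plus f g t : ccont f t -> ccont g t -> ccont (fun x => f x + g x)%C t.
Proof.
intros [A B] [A' B']; split; simpl.
- apply (continuous_plus (fun x => fst (f x)) (fun x => fst (g x))); auto.
- apply (continuous_plus (fun x => snd (f x)) (fun x => snd (g x))); auto.
Qed.

Lemma ccont_mult f g t : ccont f t -> ccont g t -> ccont (fun x => f x * g x)%C t.
Proof.
intros [A B] [A' B']; split; simpl.
- apply (continuous_minus (fun x => fst (f x) * fst (g x)) (fun x => snd (f x) * snd (g x)));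
  apply (continuous_mult (K := R_AbsRing)); auto.
- apply (continuous_plus (fun x => fst (f x) * snd (g x)) (fun x => snd (f x) * fst (g x)));
  apply (continuous_mult (K := R_AbsRing)); auto.
Qed.

Lemma ccont_minus f g t : ccont f t -> ccont g t -> ccont (fun x => f x - g x)%C t.
Proof.
intros A B; replace (fun x => f x - g x)%C with (fun x => f x + (-1) * g x)%C.
  apply ccont_plus; auto; apply ccont_mult; auto; apply ccont_const.
apply functional_extensionality; intros x; ring.
Qed.

Lemma ccont_RtoC (g : R -> R) t : continuous g t -> ccont (fun x => RtoC (g x)) t.
Proof. intros H; split; [exact H|apply continuous_const]. Qed.

Lemma ccont_cis (k t : R) : ccont (fun x => cis (k * x)) t.
Proof.
split; unfold cis; simpl; apply (ex_derive_continuous (V := R_NormedModule)); auto_derive; auto.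
Qed.

Lemma ccont_inv f t : ccont f t -> f t <> 0 -> ccont (fun x => / f x)%C t.
Proof.
intros [A B] H0.
assert (D : fst (f t) ^ 2 + snd (f t) ^ 2 <> 0).
  intros E; apply H0; assert (fst (f t) = 0 /\ snd (f t) = 0) as [E1 E2] by nra.
  destruct (f t); simpl in *; subst; reflexivity.
assert (DC : continuous (fun x => / (fst (f x) ^ 2 + snd (f x) ^ 2)) t).
  apply continuous_Rinv_comp; auto; simpl.
  apply (continuous_plus (fun x => fst (f x) * (fst (f x) * 1))
    (fun x => snd (f x) * (snd (f x) * 1)));
  apply (continuous_mult (K := R_AbsRing)); auto;
  apply (continuous_mult (K := R_AbsRing)); auto; apply continuous_const.
split; unfold Cinv; simpl; unfold Rdiv; apply (continuous_mult (K := R_AbsRing)); auto.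
apply (continuous_opp (fun x => snd (f x))); auto.
Qed.

Lemma ccont_comp (f : C -> C) (g : R -> C) t : ccont g t -> cdiff f (g t) ->
  ccont (fun x => f (g x)) t.
Proof.
intros Hg Hf; apply ccont_eps; intros eps Heps.
destruct (cdiff_cont f (g t) Hf eps Heps) as [d [Hd K]].
destruct (ccont_mod g t Hg d Hd) as [d' [Hd' K']].
exists d'; split; auto.
Qed.

(** * Componentwise integration *)

Definition CI (f : R -> C) (a b : R) : C :=
  (RInt (fun x => fst (f x)) a b, RInt (fun x => snd (f x)) a b).

Definition ccont_on (f : R -> C) (a b : R) : Prop := forall x, a <= x <= b -> ccont f x.

Lemma ccont_on_int f a b : a <= b -> ccont_on f a b ->
  ex_RInt (fun x => fst (f x)) a b /\ ex_RInt (fun x => snd (f x)) a b.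
Proof.
intros Hab H; split; apply (ex_RInt_continuous (V := R_CompleteNormedModule)); intros x;
rewrite Rmin_left, Rmax_right by auto; intros Hx; apply H, Hx.
Qed.

Lemma CI_ext f g a b : a <= b -> (forall x, a <= x <= b -> f x = g x) -> CI f a b = CI g a b.
Proof.
intros Hab H; unfold CI; f_equal; apply RInt_ext; intros x;
rewrite Rmin_left, Rmax_right by auto; intros Hx; rewrite H; auto; lra.
Qed.

Lemma CI_plus f g a b : a <= b -> ccont_on f a b -> ccont_on g a b ->
  CI (fun x => f x + g x)%C a b = (CI f a b + CI g a b)%C.
Proof.
intros Hab Hf Hg; destruct (ccont_on_int f a b Hab Hf), (ccont_on_int g a b Hab Hg).
unfold CI, Cplus; simpl; f_equal.
- apply (RInt_plus (fun x => fst (f x)) (fun x => fst (g x))); auto.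
- apply (RInt_plus (fun x => snd (f x)) (fun x => snd (g x))); auto.
Qed.

Lemma CI_scal c f a b : a <= b -> ccont_on f a b ->
  CI (fun x => c * f x)%C a b = (c * CI f a b)%C.
Proof.
intros Hab Hf; destruct (ccont_on_int f a b Hab Hf) as [H1 H2].
assert (S : forall (k : R) g, ex_RInt g a b -> ex_RInt (fun x => k * g x) a b /\
  RInt (fun x => k * g x) a b = k * RInt g a b).
  intros k g Hg; split; [apply (ex_RInt_scal g a b k Hg)|apply (RInt_scal g a b k Hg)].
destruct (S (fst c) _ H1) as [A1 B1]; destruct (S (snd c) _ H2) as [A2 B2].
destruct (S (fst c) _ H2) as [A3 B3]; destruct (S (snd c) _ H1) as [A4 B4].
unfold CI, Cmult; simpl; f_equal.
- rewrite <- B1, <- B2.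
  apply (RInt_minus (fun x => fst c * fst (f x)) (fun x => snd c * snd (f x))); auto.
- rewrite <- B3, <- B4.
  apply (RInt_plus (fun x => fst c * snd (f x)) (fun x => snd c * fst (f x))); auto.
Qed.

Lemma CI_minus f g a b : a <= b -> ccont_on f a b -> ccont_on g a b ->
  CI (fun x => f x - g x)%C a b = (CI f a b - CI g a b)%C.
Proof.
intros Hab Hf Hg; rewrite (CI_ext _ (fun x => f x + (-1) * g x)%C); auto.
  rewrite CI_plus, CI_scal; auto; [ring|].
  intros x Hx; apply ccont_mult; [apply ccont_const|auto].
intros; ring.
Qed.

Lemma CI_Chasles f a b c : a <= b -> b <= c -> ccont_on f a c ->
  CI f a c = (CI f a b + CI f b c)%C.
Proof.
intros Hab Hbc H.
destruct (ccont_on_int f a b) as [A1 A2]; [lra|intros x Hx; apply H; lra|].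
destruct (ccont_on_int f b c) as [B1 B2]; [lra|intros x Hx; apply H; lra|].
unfold CI, Cplus; simpl; f_equal; symmetry.
- apply (RInt_Chasles (fun x => fst (f x)) a b c); auto.
- apply (RInt_Chasles (fun x => snd (f x)) a b c); auto.
Qed.

Lemma CI_const c a b : CI (fun _ => c) a b = (RtoC (b - a) * c)%C.
Proof.
unfold CI; rewrite !RInt_const; unfold RtoC, Cmult, scal; simpl; unfold mult; simpl.
f_equal; ring.
Qed.

(** The factor [2] is the price of estimating the two components separately. It resurfaces in the
    Cauchy estimates [2 * M / rho ^ n], where it does no harm. *)
Lemma CI_bound f a b K : a <= b -> ccont_on f a b ->
  (forall x, a <= x <= b -> Cmod (f x) <= K) -> Cmod (CI f a b) <= 2 * K * (b - a).
Proof.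
intros Hab Hf HK; destruct (ccont_on_int f a b Hab Hf) as [A B].
eapply Rle_trans; [apply Cmod_le_sum|]; unfold CI; simpl.
enough (Rabs (RInt (fun x => fst (f x)) a b) <= (b - a) * K /\
  Rabs (RInt (fun x => snd (f x)) a b) <= (b - a) * K) by lra.
split; apply abs_RInt_le_const; auto; intros t Ht.
- eapply Rle_trans; [apply fst_le_Cmod|auto].
- eapply Rle_trans; [apply snd_le_Cmod|auto].
Qed.

Lemma CI_deriv (f df : R -> C) a b : a <= b ->
  (forall x, is_derive (fun x => fst (f x)) x (fst (df x))) ->
  (forall x, is_derive (fun x => snd (f x)) x (snd (df x))) ->
  ccont_on df a b -> CI df a b = (f b - f a)%C.
Proof.
intros Hab H1 H2 Hc; unfold CI.
assert (Hmm : forall x, Rmin a b <= x <= Rmax a b -> a <= x <= b).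
  intros x; rewrite Rmin_left, Rmax_right; auto.
rewrite (is_RInt_unique (fun x => fst (df x)) a b (fst (f b) - fst (f a))).
  rewrite (is_RInt_unique (fun x => snd (df x)) a b (snd (f b) - snd (f a))).
    reflexivity.
  apply (is_RInt_derive (fun x => snd (f x))); intros x Hx; [apply H2|apply Hc; auto].
apply (is_RInt_derive (fun x => fst (f x))); intros x Hx; [apply H1|apply Hc; auto].
Qed.

(** * Goursat's bisection *)

Lemma nested_intervals (p q : nat -> R) :
  (forall n, p n <= p (S n)) -> (forall n, q (S n) <= q n) -> (forall n, p n <= q n) ->
  exists x, forall n, p n <= x <= q n.
Proof.
intros Hp Hq Hpq.
assert (Mp : forall n k, p n <= p (n + k)%nat).
  intros n k; induction k as [|k IH]; [rewrite Nat.add_0_r; lra|].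
  rewrite Nat.add_succ_r; specialize (Hp (n + k)%nat); lra.
assert (Mq : forall n k, q (n + k)%nat <= q n).
  intros n k; induction k as [|k IH]; [rewrite Nat.add_0_r; lra|].
  rewrite Nat.add_succ_r; specialize (Hq (n + k)%nat); lra.
assert (H : forall n m, p n <= q m).
  intros n m; apply Rle_trans with (p (n + m)%nat); [apply Mp|].
  apply Rle_trans with (q (n + m)%nat); [apply Hpq|]; rewrite Nat.add_comm; apply Mq.
destruct (completeness (fun v => exists n, v = p n)) as [x [H1 H2]].
  exists (q 0%nat); intros v [n ->]; auto.
  exists (p 0%nat), 0%nat; reflexivity.
exists x; intros n; split; [apply H1; exists n; reflexivity|].
apply H2; intros v [m ->]; auto.
Qed.

(** Goursat's argument stripped of the integrand. If [Phi] exceeds [eps] times the squared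
    half-perimeter, additivity passes this on to one of the four quarters, whose half-perimeters are
    halved. The nested bad rectangles shrink to a point, where the local estimate contradicts
    them. *)
Lemma additive_rect_zero (Phi : R -> R -> R -> R -> C) (a b c d : R) :
  a <= b -> c <= d ->
  (forall x1 x x2 y1 y2, a <= x1 -> x1 <= x -> x <= x2 -> x2 <= b -> c <= y1 -> y1 <= y2 ->
     y2 <= d -> Phi x1 x2 y1 y2 = (Phi x1 x y1 y2 + Phi x x2 y1 y2)%C) ->
  (forall x1 x2 y1 y y2, a <= x1 -> x1 <= x2 -> x2 <= b -> c <= y1 -> y1 <= y -> y <= y2 ->
     y2 <= d -> Phi x1 x2 y1 y2 = (Phi x1 x2 y1 y + Phi x1 x2 y y2)%C) ->
  (forall u v eps, a <= u <= b -> c <= v <= d -> 0 < eps -> exists delta, 0 < delta /\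
     forall x1 x2 y1 y2, a <= x1 -> x1 <= u <= x2 -> x2 <= b -> c <= y1 -> y1 <= v <= y2 ->
     y2 <= d -> x2 - x1 < delta -> y2 - y1 < delta ->
     Cmod (Phi x1 x2 y1 y2) <= eps * (x2 - x1 + (y2 - y1)) ^ 2) ->
  Phi a b c d = 0.
Proof.
intros Hab Hcd Hx Hy Hs.
apply Cmod_eq_0, Rle_antisym; [|apply Cmod_ge_0].
set (D := (b - a + (d - c)) ^ 2).
enough (K : forall eps, 0 < eps -> Cmod (Phi a b c d) <= eps * D).
  apply le_epsilon; intros eps Heps; rewrite Rplus_0_l.
  assert (HD : 0 <= D) by apply pow2_ge_0.
  eapply Rle_trans; [apply (K (eps / (D + 1)))|].
    apply Rdiv_lt_0_compat; lra.
  apply Rle_trans with (eps / (D + 1) * (D + 1)).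
    apply Rmult_le_compat_l; [apply Rlt_le, Rdiv_lt_0_compat|]; lra.
  right; field; lra.
intros eps Heps; apply Rnot_lt_le; intros Hbad.
pose (bad := fun q : (R * R) * (R * R) => let '((x1, x2), (y1, y2)) := q in
  (a <= x1 /\ x1 <= x2 /\ x2 <= b) /\ (c <= y1 /\ y1 <= y2 /\ y2 <= d) /\
  eps * (x2 - x1 + (y2 - y1)) ^ 2 < Cmod (Phi x1 x2 y1 y2)).
pose (half := fun q q' : (R * R) * (R * R) =>
  let '((x1, x2), (y1, y2)) := q in let '((x1', x2'), (y1', y2')) := q' in
  x1 <= x1' /\ x2' <= x2 /\ x2' - x1' = (x2 - x1) / 2 /\
  y1 <= y1' /\ y2' <= y2 /\ y2' - y1' = (y2 - y1) / 2).
assert (Hstep : forall q, bad q -> exists q', bad q' /\ half q q').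
  intros [[x1 x2] [y1 y2]] [[A1 [A2 A3]] [[B1 [B2 B3]] E]].
  set (x := (x1 + x2) / 2); set (y := (y1 + y2) / 2).
  assert (Ix : x1 <= x <= x2) by (unfold x; lra).
  assert (Iy : y1 <= y <= y2) by (unfold y; lra).
  rewrite (Hx x1 x x2), (Hy x1 x y1 y y2), (Hy x x2 y1 y y2) in E; try lra.
  assert (Lx1 : x - x1 = (x2 - x1) / 2) by (unfold x; lra).
  assert (Lx2 : x2 - x = (x2 - x1) / 2) by (unfold x; lra).
  assert (Ly1 : y - y1 = (y2 - y1) / 2) by (unfold y; lra).
  assert (Ly2 : y2 - y = (y2 - y1) / 2) by (unfold y; lra).
  assert (L2 : ((x2 - x1) / 2 + (y2 - y1) / 2) ^ 2 = (x2 - x1 + (y2 - y1)) ^ 2 / 4) by field.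
  (* If no quarter were bad, the triangle inequality would bound [Phi] by four times
     [eps * s ^ 2 / 4], with [s] the half-perimeter. *)
  apply NNPP; intros Hn.
  assert (G : forall s1 s2 t1 t2, x1 <= s1 -> s1 <= s2 -> s2 <= x2 -> y1 <= t1 -> t1 <= t2 ->
    t2 <= y2 -> s2 - s1 = (x2 - x1) / 2 -> t2 - t1 = (y2 - y1) / 2 ->
    Cmod (Phi s1 s2 t1 t2) <= eps * ((x2 - x1 + (y2 - y1)) ^ 2 / 4)).
    intros s1 s2 t1 t2 ? ? ? ? ? ? Es Et; apply Rnot_lt_le; intros Hlt; apply Hn.
    exists ((s1, s2), (t1, t2)); unfold bad, half; rewrite Es, Et, L2.
    repeat split; try lra; exact Hlt.
  assert (I1 := G x1 x y1 y); assert (I2 := G x1 x y y2).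
  assert (I3 := G x x2 y1 y); assert (I4 := G x x2 y y2).
  assert (T := Cmod_triangle (Phi x1 x y1 y + Phi x1 x y y2) (Phi x x2 y1 y + Phi x x2 y y2)).
  assert (T1 := Cmod_triangle (Phi x1 x y1 y) (Phi x1 x y y2)).
  assert (T2 := Cmod_triangle (Phi x x2 y1 y) (Phi x x2 y y2)).
  lra.
(* Badness travels with the rectangle in a dependent pair, so that the choice of a bad quarter can
   be iterated. *)
pose (next := fun s : {q | bad q} =>
  let h := constructive_indefinite_description _ (Hstep (proj1_sig s) (proj2_sig s)) in
  exist bad (proj1_sig h) (proj1 (proj2_sig h))).
assert (Hnext : forall s, half (proj1_sig s) (proj1_sig (next s))).
  intros s; unfold next; simpl.
  destruct (constructive_indefinite_description _ _) as [q' [H1 H2]]; exact H2.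
assert (H0 : bad ((a, b), (c, d))) by (unfold bad; repeat split; try lra; exact Hbad).
pose (Q := fun n => Nat.iter n next (exist bad _ H0)).
pose (X1 := fun n => fst (fst (proj1_sig (Q n)))).
pose (X2 := fun n => snd (fst (proj1_sig (Q n)))).
pose (Y1 := fun n => fst (snd (proj1_sig (Q n)))).
pose (Y2 := fun n => snd (snd (proj1_sig (Q n)))).
assert (HB : forall n, (a <= X1 n /\ X1 n <= X2 n /\ X2 n <= b) /\
    (c <= Y1 n /\ Y1 n <= Y2 n /\ Y2 n <= d) /\
    eps * (X2 n - X1 n + (Y2 n - Y1 n)) ^ 2 < Cmod (Phi (X1 n) (X2 n) (Y1 n) (Y2 n))).
  intros n; unfold X1, X2, Y1, Y2; destruct (Q n) as [[[? ?] [? ?]] H]; exact H.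
assert (HH : forall n, X1 n <= X1 (S n) /\ X2 (S n) <= X2 n /\
    X2 (S n) - X1 (S n) = (X2 n - X1 n) / 2 /\
    Y1 n <= Y1 (S n) /\ Y2 (S n) <= Y2 n /\ Y2 (S n) - Y1 (S n) = (Y2 n - Y1 n) / 2).
  intros n; assert (H := Hnext (Q n)); unfold X1, X2, Y1, Y2.
  change (Q (S n)) with (next (Q n)).
  destruct (proj1_sig (Q n)) as [[? ?] [? ?]].
  destruct (proj1_sig (next (Q n))) as [[? ?] [? ?]]; exact H.
destruct (nested_intervals X1 X2) as [u Hu]; try (intros n; apply HH || apply HB).
destruct (nested_intervals Y1 Y2) as [v Hv]; try (intros n; apply HH || apply HB).
assert (Lx : forall n, X2 n - X1 n = (b - a) * (/ 2) ^ n).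
  induction n as [|n IH]; [unfold X1, X2; simpl; ring|].
  destruct (HH n) as [_ [_ [E _]]]; rewrite E, IH; simpl; field.
assert (Ly : forall n, Y2 n - Y1 n = (d - c) * (/ 2) ^ n).
  induction n as [|n IH]; [unfold Y1, Y2; simpl; ring|].
  destruct (HH n) as [_ [_ [_ [_ [_ E]]]]]; rewrite E, IH; simpl; field.
destruct (Hs u v eps) as [delta [Hd K]]; auto.
  destruct (HB 0%nat) as [? _]; specialize (Hu 0%nat); lra.
  destruct (HB 0%nat) as [_ [? _]]; specialize (Hv 0%nat); lra.
set (m := b - a + (d - c) + 1).
destruct (pow_lt_1_zero (/ 2)) with (y := delta / m) as [n Hn].
- rewrite Rabs_pos_eq; lra.
- apply Rdiv_lt_0_compat; unfold m; lra.
- specialize (Hn n (Nat.le_refl n)); rewrite Rabs_pos_eq in Hn by (apply pow_le; lra).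
  assert (Hm : m * (/ 2) ^ n < delta).
    replace delta with (m * (delta / m)) by (field; unfold m; lra).
    apply Rmult_lt_compat_l; [unfold m; lra|auto].
  assert (P : 0 < (/ 2) ^ n) by (apply pow_lt; lra).
  destruct (HB n) as [A [B E]].
  apply (Rlt_not_le _ _ E); apply K; try lra; try apply Hu; try apply Hv.
    rewrite Lx; eapply Rle_lt_trans; [|exact Hm]; apply Rmult_le_compat_r; unfold m; lra.
  rewrite Ly; eapply Rle_lt_trans; [|exact Hm]; apply Rmult_le_compat_r; unfold m; lra.
Qed.

(** * Cauchy's integral formula *)

Lemma ccont_cis1 t : ccont cis t.
Proof.
replace cis with (fun x => cis (1 * x)); [apply ccont_cis|].
apply functional_extensionality; intros x; rewrite Rmult_1_l; reflexivity.
Qed.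

Lemma CI_dcis a b : a <= b -> CI (fun x => Ci * cis x)%C a b = (cis b - cis a)%C.
Proof.
intros Hab; apply CI_deriv; auto.
- intros x; simpl; auto_derive; auto; ring.
- intros x; simpl; auto_derive; auto; ring.
- intros x _; apply ccont_mult; [apply ccont_const|apply ccont_cis1].
Qed.

Lemma cis_lip a b : Cmod (cis b - cis a) <= 2 * Rabs (b - a).
Proof.
assert (H : forall a b, a <= b -> Cmod (cis b - cis a) <= 2 * Rabs (b - a)).
  clear a b; intros a b Hab; rewrite <- CI_dcis; auto.
  rewrite Rabs_pos_eq by lra.
  replace (2 * (b - a)) with (2 * 1 * (b - a)) by ring; apply CI_bound; auto.
    intros x _; apply ccont_mult; [apply ccont_const|apply ccont_cis1].
  intros x _; rewrite Cmod_mult, Cmod_Ci, Cmod_cis; lra.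
destruct (Rle_dec a b); auto.
rewrite Cmod_minus_sym, Rabs_minus_sym; apply H; lra.
Qed.

Section Cauchy.
Variables (f : C -> C) (z0 u : C) (R0 rho : R).
Hypothesis Hrho : 0 < rho < R0.
Hypothesis Hu : Cmod u < rho.
Hypothesis Hf : forall z, Cmod (z - z0) < R0 -> cdiff f z.

(** The circle of radius [rho] about [z0] is contracted to [z0 + u]. For [z = pt t th] one has
    [z - z0 - u = t * w th], hence [dz / (z - z0 - u) = dt / t + v th dth]: the kernel splits and
    [v] is free of [t]. The number [m] bounds the modulus of [w] from below. *)
Let w (th : R) : C := (RtoC rho * cis th - u)%C.
Let v (th : R) : C := (Ci * (RtoC rho * cis th) / w th)%C.
Let pt (t th : R) : C := (z0 + u + RtoC t * w th)%C.
Let m := rho - Cmod u.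

Lemma w_lower th : m <= Cmod (w th).
Proof.
unfold w, m; assert (H := Cmod_triangle (RtoC rho * cis th - u) u).
replace (RtoC rho * cis th - u + u)%C with (RtoC rho * cis th)%C in H by ring.
rewrite (Cmod_mult (RtoC rho) (cis th)), Cmod_cis, Cmod_R, Rabs_pos_eq in H; lra.
Qed.

Lemma w_upper th : Cmod (w th) <= 2 * rho.
Proof.
unfold w; apply Cmod_plus_le.
rewrite Cmod_opp, Cmod_mult, Cmod_cis, Cmod_R, Rabs_pos_eq; lra.
Qed.

Lemma w_neq0 th : w th <> 0.
Proof.
apply Cmod_gt_0; apply Rlt_le_trans with m; [unfold m; lra|apply w_lower].
Qed.

Lemma w_cont th : ccont w th.
Proof.
unfold w; apply ccont_minus; [|apply ccont_const].
apply ccont_mult; [apply ccont_const|apply ccont_cis1].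
Qed.

Lemma v_cont th : ccont v th.
Proof.
unfold v, Cdiv; apply ccont_mult.
  apply ccont_mult; [apply ccont_const|]; apply ccont_mult; [apply ccont_const|apply ccont_cis1].
apply ccont_inv; [apply w_cont|apply w_neq0].
Qed.

Lemma v_bound th : Cmod (v th) <= rho / m.
Proof.
unfold v; rewrite Cmod_div, !Cmod_mult, Cmod_Ci, Cmod_cis, Cmod_R, Rabs_pos_eq by
  (apply w_neq0 || lra).
replace (1 * (rho * 1)) with rho by ring.
assert (Hm : 0 < m) by (unfold m; lra).
apply Rmult_le_compat_l; [lra|]; apply Rinv_le_contravar; [auto|apply w_lower].
Qed.

Lemma pt_disc t th : 0 <= t <= 1 -> Cmod (pt t th - z0) < R0.
Proof.
intros Ht; unfold pt, w.
replace (z0 + u + RtoC t * (RtoC rho * cis th - u) - z0)%C with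
  (RtoC (1 - t) * u + RtoC t * (RtoC rho * cis th))%C by (rewrite RtoC_minus; ring).
apply Cmod_plus_lt.
rewrite !Cmod_mult, Cmod_cis, !Cmod_R, !Rabs_pos_eq by lra.
apply Rle_lt_trans with rho; [|lra].
replace rho with ((1 - t) * rho + t * rho) at 2 by ring.
apply Rplus_le_compat; [apply Rmult_le_compat_l|]; lra.
Qed.

Lemma pt_cont_t t th : ccont (fun t => pt t th) t.
Proof.
unfold pt; apply ccont_plus; [apply ccont_const|].
apply ccont_mult; [apply ccont_RtoC, continuous_id|apply ccont_const].
Qed.

Lemma pt_cont_th t th : ccont (fun th => pt t th) th.
Proof.
unfold pt; apply ccont_plus; [apply ccont_const|].
apply ccont_mult; [apply ccont_const|apply w_cont].
Qed.

Lemma pt_lip t t' th th' : 0 <= t' <= 1 ->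
  Cmod (pt t th - pt t' th') <= 2 * rho * (Rabs (t - t') + Rabs (th - th')).
Proof.
intros Ht; unfold pt.
replace (z0 + u + RtoC t * w th - (z0 + u + RtoC t' * w th'))%C with
  (RtoC (t - t') * w th + RtoC t' * (RtoC rho * (cis th - cis th')))%C by
  (rewrite RtoC_minus; unfold w; ring).
apply Cmod_plus_le.
rewrite !Cmod_mult, !Cmod_R, (Rabs_pos_eq t'), (Rabs_pos_eq rho) by lra.
assert (A := w_upper th); assert (B := cis_lip th' th).
assert (B' := Rabs_pos (t - t')); assert (B'' := Rabs_pos (th - th')).
assert (C1 : Rabs (t - t') * Cmod (w th) <= Rabs (t - t') * (2 * rho)).
  apply Rmult_le_compat_l; auto.
assert (C2 : t' * (rho * Cmod (cis th - cis th')) <= 1 * (rho * (2 * Rabs (th - th')))).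
  apply Rmult_le_compat; try lra.
    apply Rmult_le_pos; [lra|apply Cmod_ge_0].
  apply Rmult_le_compat_l; lra.
lra.
Qed.

(* The integral of [G dz / (z - z0 - u)] around the image under [pt] of a rectangle. *)
Let circ (G : R -> R -> C) (t1 t2 th1 th2 : R) : C :=
  (CI (fun t => (G t th1 - G t th2) * RtoC (/ t)) t1 t2 +
   CI (fun th => (G t2 th - G t1 th) * v th) th1 th2)%C.

Let regular (G : R -> R -> C) : Prop :=
  (forall t th, 0 <= t <= 1 -> ccont (fun t => G t th) t) /\
  (forall t th, 0 <= t <= 1 -> ccont (fun th => G t th) th).

Lemma circ_cont1 G t1 t2 th1 th2 : regular G -> 0 < t1 -> t2 <= 1 ->
  ccont_on (fun t => (G t th1 - G t th2) * RtoC (/ t))%C t1 t2.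
Proof.
intros [H _] H1 H2 t Ht; apply ccont_mult.
  apply ccont_minus; apply H; lra.
apply ccont_RtoC, (continuous_Rinv t); lra.
Qed.

Lemma circ_cont2 G t1 t2 th1 th2 : regular G -> 0 <= t1 <= 1 -> 0 <= t2 <= 1 ->
  ccont_on (fun th => (G t2 th - G t1 th) * v th)%C th1 th2.
Proof.
intros [_ H] H1 H2 th Hth; apply ccont_mult; [|apply v_cont].
apply ccont_minus; apply H; lra.
Qed.

Lemma circ_plus G G' t1 t2 th1 th2 : regular G -> regular G' ->
  0 < t1 -> t1 <= t2 -> t2 <= 1 -> th1 <= th2 ->
  circ (fun t th => G t th + G' t th)%C t1 t2 th1 th2 =
  (circ G t1 t2 th1 th2 + circ G' t1 t2 th1 th2)%C.
Proof.
intros HG HG' H1 H2 H3 H4; unfold circ.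
rewrite (CI_ext _ (fun t => (G t th1 - G t th2) * RtoC (/ t) +
  (G' t th1 - G' t th2) * RtoC (/ t))%C t1 t2) by (auto; intros; ring).
rewrite (CI_ext _ (fun th => (G t2 th - G t1 th) * v th + (G' t2 th - G' t1 th) * v th)%C th1 th2)
  by (auto; intros; ring).
rewrite (CI_plus _ _ t1 t2 H2 (circ_cont1 G t1 t2 th1 th2 HG H1 H3)
  (circ_cont1 G' t1 t2 th1 th2 HG' H1 H3)).
rewrite (CI_plus _ _ th1 th2 H4); [ring| |]; apply circ_cont2; auto; lra.
Qed.

(** On the sides in [t] the factor [/ t] cancels the [t] of [pt]; on the sides in [th] the product
    [w * v] is the derivative of [w]. The two contributions are opposite, so the tangent of [f] at a
    point can be subtracted without changing the integral. *)
Lemma circ_affine (a b : C) t1 t2 th1 th2 : 0 < t1 -> t1 <= t2 -> t2 <= 1 -> th1 <= th2 ->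
  circ (fun t th => a + b * pt t th)%C t1 t2 th1 th2 = 0.
Proof.
intros H1 H2 H3 H4; unfold circ.
rewrite (CI_ext _ (fun t => b * (w th1 - w th2))%C t1 t2); auto.
  rewrite CI_const.
  rewrite (CI_ext _ (fun th => (b * RtoC (t2 - t1) * RtoC rho) * (Ci * cis th))%C th1 th2); auto.
    rewrite CI_scal; auto.
      rewrite CI_dcis; auto; unfold w; ring.
    intros x _; apply ccont_mult; [apply ccont_const|apply ccont_cis1].
  intros th _; unfold pt, v; rewrite RtoC_minus; field; apply w_neq0.
intros t Ht; unfold pt; rewrite RtoC_inv by lra; field.
intros E; apply (f_equal fst) in E; simpl in E; lra.
Qed.

Lemma circ_bound G t1 t2 th1 th2 e : regular G -> 0 < t1 -> t1 <= t2 -> t2 <= 1 -> th1 <= th2 ->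
  (forall t th, t1 <= t <= t2 -> th1 <= th <= th2 -> Cmod (G t th) <= e) ->
  Cmod (circ G t1 t2 th1 th2) <= 4 * e * (/ t1 + rho / m) * (t2 - t1 + (th2 - th1)).
Proof.
intros HG H1 H2 H3 H4 He.
assert (He0 : 0 <= e).
  eapply Rle_trans; [apply Cmod_ge_0|apply (He t1 th1); lra].
assert (Ht1 : 0 < / t1) by (apply Rinv_0_lt_compat; lra).
assert (Hm : 0 < m) by (unfold m; lra).
assert (Hrm : 0 < rho / m) by (apply Rdiv_lt_0_compat; lra).
assert (D : forall x y : C, Cmod x <= e -> Cmod y <= e -> Cmod (x - y) <= 2 * e).
  intros x y Hx Hy; apply Cmod_minus_le; lra.
unfold circ; apply Cmod_plus_le.
assert (A : Cmod (CI (fun t => (G t th1 - G t th2) * RtoC (/ t))%C t1 t2) <=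
  2 * (2 * e * / t1) * (t2 - t1)).
  apply CI_bound; auto; [apply circ_cont1; auto|].
  intros t Ht; rewrite Cmod_mult, Cmod_R, Rabs_pos_eq by
    (apply Rinv_ge0; lra).
  apply Rmult_le_compat; [apply Cmod_ge_0| | |apply Rinv_le_contravar; lra].
    apply Rinv_ge0; lra.
  apply D; apply He; lra.
assert (B : Cmod (CI (fun th => (G t2 th - G t1 th) * v th)%C th1 th2) <=
  2 * (2 * e * (rho / m)) * (th2 - th1)).
  apply CI_bound; auto; [apply circ_cont2; auto; lra|].
  intros th Hth; rewrite Cmod_mult.
  apply Rmult_le_compat; [apply Cmod_ge_0|apply Cmod_ge_0| |apply v_bound].
  apply D; apply He; lra.
eapply Rle_trans; [apply Rplus_le_compat; [exact A|exact B]|].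
assert (0 <= e * / t1 * (th2 - th1)) by (apply Rmult_le_pos; [apply Rmult_le_pos|]; lra).
assert (0 <= e * (rho / m) * (t2 - t1)) by (apply Rmult_le_pos; [apply Rmult_le_pos|]; lra).
lra.
Qed.

Lemma circ_split_t G t1 t t2 th1 th2 : regular G -> 0 < t1 -> t1 <= t -> t <= t2 -> t2 <= 1 ->
  th1 <= th2 -> circ G t1 t2 th1 th2 = (circ G t1 t th1 th2 + circ G t t2 th1 th2)%C.
Proof.
intros HG H1 H2 H3 H4 H5; unfold circ.
rewrite (CI_Chasles _ t1 t t2); auto; [|apply circ_cont1; auto].
rewrite (CI_ext _ (fun th => (G t th - G t1 th) * v th + (G t2 th - G t th) * v th)%C th1 th2) by
  (auto; intros; ring).
rewrite (CI_plus _ _ th1 th2 H5); [ring| |]; apply circ_cont2; auto; lra.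
Qed.

Lemma circ_split_th G t1 t2 th1 th th2 : regular G -> 0 < t1 -> t1 <= t2 -> t2 <= 1 ->
  th1 <= th -> th <= th2 ->
  circ G t1 t2 th1 th2 = (circ G t1 t2 th1 th + circ G t1 t2 th th2)%C.
Proof.
intros HG H1 H2 H3 H4 H5; unfold circ.
rewrite (CI_Chasles _ th1 th th2); auto; [|apply circ_cont2; auto; lra].
rewrite (CI_ext _ (fun t => (G t th1 - G t th) * RtoC (/ t) + (G t th - G t th2) * RtoC (/ t))%C
  t1 t2) by (auto; intros; ring).
rewrite (CI_plus _ _ t1 t2 H2); [ring| |]; apply circ_cont1; auto.
Qed.

Let F (t th : R) : C := f (pt t th).

Lemma F_regular : regular F.
Proof.
split; intros t th Ht; unfold F.
- apply (ccont_comp f (fun t => pt t th)); [apply pt_cont_t|apply Hf, pt_disc, Ht].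
- apply (ccont_comp f (fun th => pt t th)); [apply pt_cont_th|apply Hf, pt_disc, Ht].
Qed.

Lemma affine_regular a b : regular (fun t th => a + b * pt t th)%C.
Proof.
split; intros t th Ht; (apply ccont_plus; [apply ccont_const|]);
(apply ccont_mult; [apply ccont_const|]); [apply pt_cont_t|apply pt_cont_th].
Qed.

(** The bisection runs on [t0 <= t <= 1], away from the pole at [t = 0]. Near a point [F] is
    replaced by its deviation from the tangent, small against the size of the rectangle; integration
    supplies a second factor of that size. *)
Lemma circ_F_zero t0 c d : 0 < t0 <= 1 -> c <= d -> circ F t0 1 c d = 0.
Proof.
intros Ht0 Hcd; assert (RF := F_regular).
apply (additive_rect_zero (circ F)); try lra.
- intros; apply circ_split_t; auto; lra.
- intros; apply circ_split_th; auto; lra.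
intros t' th' eps Ht' Hth' Heps.
destruct (Hf (pt t' th')) as [D HD]; [apply pt_disc; lra|].
assert (Hm : 0 < m) by (unfold m; lra).
assert (Ht0' : 0 < / t0) by (apply Rinv_0_lt_compat; lra).
assert (Hrm : 0 < rho / m) by (apply Rdiv_lt_0_compat; lra).
(* The constant of [circ_bound] for [t1 >= t0], times the Lipschitz constant [2 * rho] of [pt]. *)
set (K := 4 * (/ t0 + rho / m) * (2 * rho)).
assert (HK : 0 < K) by (unfold K; repeat apply Rmult_lt_0_compat; lra).
destruct (HD (eps / K)) as [delta [Hd E]]; [apply Rdiv_lt_0_compat; auto|].
exists (delta / (4 * rho)); split; [apply Rdiv_lt_0_compat; lra|].
intros t1 t2 th1 th2 A1 A2 A3 B1 B2 B3 L1 L2.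
set (a := (f (pt t' th') - D * pt t' th')%C).
pose (G := fun t th => (F t th + (- a + (- D) * pt t th))%C).
assert (RG : regular G).
  assert (RA := affine_regular (- a) (- D)).
  split; intros t th Ht; (apply ccont_plus; [apply RF; auto|apply RA; auto]).
assert (Eq : circ F t1 t2 th1 th2 = circ G t1 t2 th1 th2).
  unfold G; rewrite circ_plus; auto; try lra; [|apply affine_regular].
  rewrite circ_affine; [ring|lra|lra|lra|lra].
rewrite Eq; set (s := t2 - t1 + (th2 - th1)).
assert (Hs : 0 <= s) by (unfold s; lra).
eapply Rle_trans; [apply (circ_bound G t1 t2 th1 th2 (eps / K * (2 * rho * s))); auto; try lra|].
- intros t th Ht Hth.
  assert (P : Cmod (pt t th - pt t' th') <= 2 * rho * s).
    eapply Rle_trans; [apply pt_lip; lra|].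
    apply Rmult_le_compat_l; [lra|].
    unfold s; apply Rplus_le_compat; apply Rabs_le; lra.
  assert (P' : Cmod (pt t th - pt t' th') < delta).
    eapply Rle_lt_trans; [exact P|].
    apply Rlt_le_trans with (2 * rho * (delta / (4 * rho) + delta / (4 * rho))).
      apply Rmult_lt_compat_l; [lra|unfold s; lra].
    right; field; lra.
  replace (G t th) with (f (pt t' th' + (pt t th - pt t' th')) - f (pt t' th') -
    D * (pt t th - pt t' th'))%C.
    eapply Rle_trans; [apply E, P'|].
    apply Rmult_le_compat_l; [|exact P].
    apply Rlt_le, Rdiv_lt_0_compat; auto.
  unfold G, F, a; replace (pt t' th' + (pt t th - pt t' th'))%C with (pt t th) by ring; ring.
- assert (Ht1 : / t1 <= / t0) by (apply Rinv_le_contravar; lra).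
  apply Rle_trans with (4 * (eps / K * (2 * rho * s)) * (/ t0 + rho / m) * s).
    apply Rmult_le_compat_r; auto; apply Rmult_le_compat_l; [|lra].
    repeat apply Rmult_le_pos; try lra; apply Rinv_ge0, HK.
  right; replace (eps * s ^ 2) with (eps / K * K * s ^ 2) by (field; lra).
  unfold K at 3; ring.
Qed.

(** Cauchy's formula with the winding integral left unevaluated. As [t0] tends to [0], the inner
    circle shrinks to [z0 + u] and [F t0] tends to [f (z0 + u)] uniformly. The sides in [t] cancel
    because the angles [0] and [2 * PI] give the same points. *)
Lemma cauchy_v :
  CI (fun th => (f (z0 + RtoC rho * cis th) - f (z0 + u)) * v th)%C 0 (2 * PI) = 0.
Proof.
assert (HPI := PI_RGT_0).
assert (Hm : 0 < m) by (unfold m; lra).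
assert (Hrm : 0 < rho / m) by (apply Rdiv_lt_0_compat; lra).
assert (RF := F_regular).
assert (E1 : forall t0, 0 < t0 <= 1 ->
  CI (fun th => (F 1 th - F t0 th) * v th)%C 0 (2 * PI) = 0).
  intros t0 Ht0; assert (Z := circ_F_zero t0 0 (2 * PI) Ht0); unfold circ in Z.
  rewrite (CI_ext _ (fun _ => 0) t0 1) in Z; [|lra|].
    rewrite CI_const, Cmult_0_r, Cplus_0_l in Z; apply Z; lra.
  intros t _; unfold F, pt, w, cis; rewrite sin_2PI, cos_2PI, sin_0, cos_0; ring.
apply Cmod_eq_0, Rle_antisym; [|apply Cmod_ge_0].
apply le_epsilon; intros eps Heps; rewrite Rplus_0_l.
set (K := 2 * (rho / m) * (2 * PI)).
assert (HK : 0 < K) by (unfold K; apply Rmult_lt_0_compat; [apply Rmult_lt_0_compat|]; lra).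
destruct (cdiff_cont f (z0 + u)) with (eps := eps / K) as [delta [Hd Hc]].
- apply Hf; replace (z0 + u - z0)%C with u by ring; lra.
- apply Rdiv_lt_0_compat; lra.
set (t0 := Rmin 1 (delta / (4 * rho))).
assert (Hdr : 0 < delta / (4 * rho)) by (apply Rdiv_lt_0_compat; lra).
assert (Ht0 : 0 < t0 <= 1).
  split; [apply Rmin_pos; lra|apply Rmin_l].
assert (Ht0' : t0 <= delta / (4 * rho)) by apply Rmin_r.
assert (CF : ccont_on (fun th => (F t0 th - f (z0 + u)%C) * v th)%C 0 (2 * PI)).
  intros th _; apply ccont_mult; [|apply v_cont].
  apply ccont_minus; [apply RF; lra|apply ccont_const].
rewrite (CI_ext _ (fun th => (F 1 th - F t0 th) * v th + (F t0 th - f (z0 + u)%C) * v th)%C);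
  [|lra|].
  rewrite CI_plus; [|lra|apply circ_cont2; auto; lra|exact CF].
  rewrite E1, Cplus_0_l; auto.
  apply Rle_trans with (2 * (eps / K * (rho / m)) * (2 * PI - 0)); [|right; unfold K; field].
    apply CI_bound; [lra|exact CF|].
    intros th _; rewrite Cmod_mult; apply Rmult_le_compat; try apply Cmod_ge_0; [|apply v_bound].
    apply Rlt_le, Hc; unfold pt.
    replace (z0 + u + RtoC t0 * w th - (z0 + u))%C with (RtoC t0 * w th)%C by ring.
    rewrite Cmod_mult, Cmod_R, Rabs_pos_eq by lra.
    apply Rle_lt_trans with (delta / (4 * rho) * (2 * rho)).
      apply Rmult_le_compat; [lra|apply Cmod_ge_0|auto|apply w_upper].
    replace (delta / (4 * rho) * (2 * rho)) with (delta / 2) by (field; lra); lra.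
  repeat split; lra.
intros th _; unfold F; replace (pt 1 th) with (z0 + RtoC rho * cis th)%C; [ring|].
unfold pt, w; ring.
Qed.

End Cauchy.

(** * Power series expansions *)

Lemma list_max_In (l : list nat) n : In n l -> (n <= list_max l)%nat.
Proof.
intros H; assert (K := proj1 (list_max_le l (list_max l)) (Nat.le_refl _)).
rewrite Forall_forall in K; auto.
Qed.

Lemma incl_seq (l : list nat) n : (list_max l < n)%nat -> incl l (seq 0 n).
Proof. intros H k Hk; apply in_seq; apply list_max_In in Hk; lia. Qed.

Lemma bounded_sums_nat (N : nat -> R) M :
  (forall n, 0 <= N n) -> (forall n, rsum N (seq 0 n) <= M) -> bounded_sums N M.
Proof.
intros HN H l Hl; apply Rle_trans with (rsum N (seq 0 (S (list_max l)))); auto.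
apply rsum_incl; auto; apply incl_seq; lia.
Qed.

Lemma sums_to_partial (c : nat -> C) S : sums_to c S ->
  forall eps, 0 < eps -> exists n0, forall n, (n0 <= n)%nat -> Cmod (csum c (seq 0 n) - S) < eps.
Proof.
intros H eps Heps; destruct (H eps Heps) as [l0 [Hl0 K]].
exists (Datatypes.S (list_max l0)); intros n Hn; apply K; [apply seq_NoDup|].
apply incl_seq; lia.
Qed.

Lemma sums_to_nat (c : nat -> C) (N : nat -> R) M S :
  (forall n, Cmod (c n) <= N n) -> bounded_sums N M ->
  (forall eps, 0 < eps -> exists n0, forall n, (n0 <= n)%nat ->
     Cmod (csum c (seq 0 n) - S) < eps) -> sums_to c S.
Proof.
intros HN HM H; destruct (sums_to_exists c N M HN HM) as [S' HS'].
replace S with S'; auto.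
assert (E : Cmod (S' - S) = 0).
  apply Rle_antisym; [|apply Cmod_ge_0].
  apply le_epsilon; intros eps Heps; rewrite Rplus_0_l.
  destruct (H (eps / 2)) as [n0 K]; [lra|].
  destruct (sums_to_partial c S' HS' (eps / 2)) as [n1 K']; [lra|].
  specialize (K (n0 + n1)%nat ltac:(lia)); specialize (K' (n0 + n1)%nat ltac:(lia)).
  replace (S' - S)%C with ((csum c (seq 0 (n0 + n1)) - S) - (csum c (seq 0 (n0 + n1)) - S'))%C
    by ring.
  apply Cmod_minus_le; lra.
apply Cmod_eq_0 in E; replace S' with (S' - S + S)%C by ring; rewrite E; ring.
Qed.

Lemma rsum_seq_S N n : rsum N (seq 0 (S n)) = rsum N (seq 0 n) + N n.
Proof. rewrite seq_S, rsum_app; unfold rsum; simpl; ring. Qed.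

Lemma csum_seq_S c n : csum c (seq 0 (S n)) = (csum c (seq 0 n) + c n)%C.
Proof. rewrite seq_S, csum_app; unfold csum; simpl; ring. Qed.

Lemma bounded_sums_geom q : 0 <= q < 1 -> bounded_sums (fun n => q ^ n) (/ (1 - q)).
Proof.
intros Hq; apply bounded_sums_nat; [intros; apply pow_le; lra|]; intros n.
assert (E : rsum (fun n => q ^ n) (seq 0 n) = (1 - q ^ n) * / (1 - q)).
  induction n as [|n IH]; [unfold rsum; simpl; ring|].
  rewrite rsum_seq_S, IH; simpl; field; lra.
rewrite E; assert (0 <= q ^ n) by (apply pow_le; lra).
assert (0 < / (1 - q)) by (apply Rinv_0_lt_compat; lra).
rewrite <- (Rmult_1_l (/ (1 - q))) at 2; apply Rmult_le_compat_r; lra.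
Qed.

Lemma pow_small q K : 0 <= q < 1 -> 0 <= K -> forall eps, 0 < eps ->
  exists n0, forall n, (n0 <= n)%nat -> K * q ^ n < eps.
Proof.
intros Hq HK eps Heps.
destruct (pow_lt_1_zero q) with (y := eps / (K + 1)) as [n0 H].
- rewrite Rabs_pos_eq; lra.
- apply Rdiv_lt_0_compat; lra.
- exists n0; intros n Hn; specialize (H n Hn).
  rewrite Rabs_pos_eq in H by (apply pow_le; lra).
  apply Rle_lt_trans with ((K + 1) * q ^ n).
    apply Rmult_le_compat_r; [apply pow_le|]; lra.
  replace eps with ((K + 1) * (eps / (K + 1))) by (field; lra).
  apply Rmult_lt_compat_l; lra.
Qed.

Lemma RtoC_neq0 x : x <> 0 -> RtoC x <> 0.
Proof. intros H E; apply H; injection E; auto. Qed.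

Lemma cis_opp x : (cis x * cis (- x))%C = 1.
Proof. rewrite <- cis_plus, Rplus_opp_r, cis_0; reflexivity. Qed.

Lemma Cpow_mult (x y : C) n : ((x * y) ^ n = x ^ n * y ^ n)%C.
Proof. induction n as [|n IH]; simpl; [ring|rewrite IH; ring]. Qed.

Lemma RtoC_pow x n : RtoC (x ^ n) = (RtoC x ^ n)%C.
Proof. induction n as [|n IH]; [reflexivity|]; simpl; rewrite RtoC_mult, IH; reflexivity. Qed.

Lemma CI_cis_period n : (0 < n)%nat -> CI (fun th => cis (- INR n * th)) 0 (2 * PI) = 0.
Proof.
intros Hn; assert (HPI := PI_RGT_0); assert (Hn' := lt_0_INR n Hn).
rewrite (CI_deriv (fun th => (RtoC (/ - INR n) * (- Ci) * cis (- INR n * th))%C)); [|lra| | |].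
- replace (- INR n * (2 * PI)) with (- (0 + 2 * INR n * PI)) by ring.
  rewrite Rmult_0_r; unfold cis; rewrite cos_neg, sin_neg, cos_period, sin_period.
  rewrite cos_0, sin_0, Ropp_0; ring.
- intros x; simpl; auto_derive; auto; field; lra.
- intros x; simpl; auto_derive; auto; field; lra.
- intros x _; apply ccont_cis.
Qed.

Section Kernel.
Variables (u : C) (rho : R).
Hypothesis Hrho : 0 < rho.
Hypothesis Hu : Cmod u < rho.

Let v (th : R) : C := (Ci * (RtoC rho * cis th) / (RtoC rho * cis th - u))%C.
Let k (n : nat) (th : R) : C := (RtoC (/ rho ^ n) * cis (- INR n * th))%C.

Lemma k_cont n th : ccont (k n) th.
Proof. apply ccont_mult; [apply ccont_const|apply ccont_cis]. Qed.

Lemma Cmod_k n th : Cmod (k n th) = / rho ^ n.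
Proof.
unfold k; rewrite Cmod_mult, Cmod_cis, Cmod_R, Rabs_pos_eq; [ring|].
apply Rinv_ge0, pow_lt, Hrho.
Qed.

Lemma k_pow n th : k n th = ((RtoC (/ rho) * cis (- th)) ^ n)%C.
Proof.
unfold k; rewrite Cpow_mult, cis_pow, <- RtoC_pow, pow_inv; f_equal; f_equal; ring.
Qed.

(** One step of a geometric series: with [q = 1 / (rho * e^(i th))] one has [v = Ci / (1 - q * u)]
    and [k n = q ^ n]. *)
Lemma v_step n th : (k n th * v th * u ^ n = Ci * (u ^ n * k n th) +
  k (S n) th * v th * u ^ S n)%C.
Proof.
rewrite !k_pow; set (q := (RtoC (/ rho) * cis (- th))%C).
assert (E : (v th = Ci + q * u * v th)%C); [|simpl; rewrite E at 1; ring].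
assert (Hw : (RtoC rho * cis th - u)%C <> 0) by exact (w_neq0 u (rho + 1) rho ltac:(lra) Hu th).
unfold v, q.
assert (Hr : RtoC rho <> 0) by (apply RtoC_neq0; lra).
rewrite RtoC_inv by lra.
assert (Hc : cis (- th) = (/ cis th)%C).
  assert (Hc : cis th <> 0) by (apply Cmod_gt_0; rewrite Cmod_cis; lra).
  rewrite <- (Cmult_1_r (/ cis th)), <- (cis_opp th); field; auto.
assert (Hct : cis th <> 0) by (apply Cmod_gt_0; rewrite Cmod_cis; lra).
rewrite Hc; field; auto.
Qed.


Lemma kv_cont n h th : ccont h th -> ccont (fun th => h th * (k n th * v th))%C th.
Proof.
intros Hh; apply ccont_mult; auto; apply ccont_mult; [apply k_cont|].
exact (v_cont u (rho + 1) rho ltac:(lra) Hu th).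
Qed.

Variables (h : R -> C) (M : R).
Hypothesis Hh : forall th, ccont h th.
Hypothesis HM : forall th, Cmod (h th) <= M.

Let rest (n : nat) : C := (u ^ n * CI (fun th => h th * (k n th * v th))%C 0 (2 * PI))%C.

Lemma rest_step n :
  rest n = (Ci * (CI (fun th => h th * k n th)%C 0 (2 * PI) * u ^ n) + rest (S n))%C.
Proof.
assert (HPI := PI_RGT_0); unfold rest.
assert (C1 : forall j, ccont_on (fun th => h th * k j th)%C 0 (2 * PI)).
  intros j th _; apply ccont_mult; auto; apply k_cont.
assert (C2 : forall j, ccont_on (fun th => h th * (k j th * v th))%C 0 (2 * PI)).
  intros j th _; apply kv_cont; auto.
assert (C3 : forall j c, ccont_on (fun th => c * (h th * (k j th * v th)))%C 0 (2 * PI)).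
  intros j c th Hth; apply ccont_mult; [apply ccont_const|apply C2; auto].
assert (C4 : forall j c, ccont_on (fun th => c * (h th * k j th))%C 0 (2 * PI)).
  intros j c th Hth; apply ccont_mult; [apply ccont_const|apply C1; auto].
rewrite <- CI_scal; auto; [|lra].
rewrite (CI_ext _ (fun th => (Ci * u ^ n) * (h th * k n th) +
  u ^ S n * (h th * (k (S n) th * v th)))%C); [|lra|].
  rewrite CI_plus, !CI_scal; auto; try lra; ring.
intros th _.
replace (u ^ n * (h th * (k n th * v th)))%C with (h th * (k n th * v th * u ^ n))%C by ring.
rewrite v_step; ring.
Qed.

Lemma rest_small n : Cmod (rest n) <= 4 * PI * M * (rho / (rho - Cmod u)) * (Cmod u / rho) ^ n.
Proof.
assert (HPI := PI_RGT_0); unfold rest; rewrite Cmod_mult, Cmod_pow.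
assert (P : 0 < rho ^ n) by (apply pow_lt, Hrho).
assert (Hm : 0 < rho - Cmod u) by lra.
assert (HM0 : 0 <= M) by (eapply Rle_trans; [apply Cmod_ge_0|apply (HM 0)]).
apply Rle_trans with (Cmod u ^ n * (2 * (M * (/ rho ^ n * (rho / (rho - Cmod u)))) *
  (2 * PI - 0))).
  apply Rmult_le_compat_l; [apply pow_le, Cmod_ge_0|].
  apply CI_bound; [lra|intros th _; apply kv_cont; auto|].
  intros th _; rewrite !Cmod_mult, Cmod_k; apply Rmult_le_compat; auto using Cmod_ge_0.
    apply Rmult_le_pos; [apply Rinv_ge0, P|apply Cmod_ge_0].
  apply Rmult_le_compat_l; [apply Rinv_ge0, P|].
  exact (v_bound u (rho + 1) rho ltac:(lra) Hu th).
right; unfold Rdiv; rewrite (Rpow_mult_distr (Cmod u)), pow_inv; field; lra.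
Qed.

Lemma kernel_expansion n :
  CI (fun th => h th * v th)%C 0 (2 * PI) =
  (Ci * csum (fun j => CI (fun th => h th * k j th) 0 (2 * PI) * u ^ j)%C (seq 0 n) + rest n)%C.
Proof.
induction n as [|n IH].
  unfold csum, rest, k; simpl; rewrite Cmult_1_l, Cmult_0_r, Cplus_0_l.
  f_equal; apply functional_extensionality; intros th.
  rewrite Ropp_0, Rmult_0_l, cis_0, Rinv_1; ring.
rewrite IH, csum_seq_S, rest_step; ring.
Qed.

End Kernel.

(** The expansion with [h = 1]. Only the coefficient of index [0] survives, the others being
    integrals of [cis] over whole periods; this evaluates the winding integral without a
    logarithm. *)
Lemma kernel_total u rho : 0 < rho -> Cmod u < rho ->
  CI (fun th => Ci * (RtoC rho * cis th) / (RtoC rho * cis th - u))%C 0 (2 * PI) =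
  (RtoC (2 * PI) * Ci)%C.
Proof.
intros Hrho Hu; assert (HPI := PI_RGT_0).
assert (Hq : 0 <= Cmod u / rho < 1).
  split; [apply Rmult_le_pos; [apply Cmod_ge_0|apply Rinv_ge0, Hrho]|].
  apply (Rmult_lt_reg_r rho); auto; replace (Cmod u / rho * rho) with (Cmod u) by (field; lra).
  lra.
assert (Hc1 : forall th, ccont (fun _ => RtoC 1) th) by (intros; apply ccont_const).
assert (Hc2 : forall th : R, Cmod ((fun _ => RtoC 1) th) <= 1) by (intros; rewrite Cmod_1; lra).
match goal with |- ?X = _ => set (I := X) end.
assert (E : Cmod (I - RtoC (2 * PI) * Ci) = 0).
  apply Rle_antisym; [|apply Cmod_ge_0].
  apply le_epsilon; intros eps Heps; rewrite Rplus_0_l.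
  destruct (pow_small (Cmod u / rho) (4 * PI * 1 * (rho / (rho - Cmod u))) Hq) with (eps := eps)
    as [n0 Hn0]; auto.
    apply Rmult_le_pos; [lra|]; apply Rmult_le_pos; [lra|apply Rinv_ge0; lra].
  (* [S n0] terms rather than [n0], so that the partial sum certainly contains the term of index
     [0], which is its whole value. *)
  apply Rlt_le, Rle_lt_trans with (2 := Hn0 (S n0) ltac:(lia)).
  eapply Rle_trans; [|apply (rest_small u rho Hrho Hu (fun _ => 1) 1 Hc1 Hc2 (S n0))].
  right; f_equal.
  assert (K := kernel_expansion u rho Hrho Hu (fun _ => 1) Hc1 (S n0)).
  rewrite (CI_ext _ (fun th => Ci * (RtoC rho * cis th) / (RtoC rho * cis th - u))%C) in K;
    [|lra|intros; apply Cmult_1_l].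
  fold I in K; rewrite K.
  match goal with |- (Ci * ?s + ?r - ?x = _)%C => enough (E : s = RtoC (2 * PI)) end.
    rewrite E; ring.
  clear K Hn0; induction n0 as [|n IH].
    unfold csum; simpl.
    rewrite (CI_ext _ (fun _ => RtoC 1)); [|lra|].
      rewrite CI_const, Rminus_0_r; ring.
    intros x _; rewrite Ropp_0, Rmult_0_l, cis_0, Rinv_1; ring.
  rewrite csum_seq_S, IH.
  rewrite (CI_ext _ (fun th => RtoC (/ rho ^ S n) * cis (- INR (S n) * th))%C); [|lra|].
    rewrite CI_scal, CI_cis_period; [ring|lia|lra|intros x _; apply ccont_cis].
  intros; ring.
apply Cmod_eq_0 in E; replace I with (I - RtoC (2 * PI) * Ci + RtoC (2 * PI) * Ci)%C by ring.
rewrite E; ring.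
Qed.

(** The [c n] are the Fourier coefficients of [f] on the circle of radius [rho], divided by
    [rho ^ n]. The kernel expansion turns Cauchy's formula into a partial sum plus a remainder
    decaying like [(Cmod u / rho) ^ n]. *)
Theorem power_series_expansion (f : C -> C) (z0 : C) (R0 rho M : R) :
  0 < rho < R0 -> (forall z, Cmod (z - z0) < R0 -> cdiff f z) ->
  (forall z, Cmod (z - z0) < R0 -> Cmod (f z) <= M) ->
  exists c : nat -> C, (forall n, Cmod (c n) <= 2 * M / rho ^ n) /\
    forall u, Cmod u < rho -> sums_to (fun n => c n * u ^ n)%C (f (z0 + u)%C).
Proof.
intros Hrho Hf HM; assert (HPI := PI_RGT_0).
set (g := fun th => f (z0 + RtoC rho * cis th)%C).
assert (Hin : forall th, Cmod (z0 + RtoC rho * cis th - z0) < R0).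
  intros th; replace (z0 + RtoC rho * cis th - z0)%C with (RtoC rho * cis th)%C by ring.
  rewrite Cmod_mult, Cmod_cis, Cmod_R, Rabs_pos_eq; lra.
assert (Hg : forall th, ccont g th).
  intros th; apply (ccont_comp f (fun th => z0 + RtoC rho * cis th)%C); [|apply Hf, Hin].
  apply ccont_plus; [apply ccont_const|apply ccont_mult; [apply ccont_const|apply ccont_cis1]].
assert (HgM : forall th, Cmod (g th) <= M) by (intros; apply HM, Hin).
assert (HM0 : 0 <= M) by (eapply Rle_trans; [apply Cmod_ge_0|apply (HgM 0)]).
set (I := fun n => CI (fun th => g th * (RtoC (/ rho ^ n) * cis (- INR n * th)))%C 0 (2 * PI)).
assert (H2PI : RtoC (2 * PI) <> 0) by (apply RtoC_neq0; lra).
exists (fun n => RtoC (/ (2 * PI)) * I n)%C.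
assert (Hc : forall n, Cmod (RtoC (/ (2 * PI)) * I n) <= 2 * M / rho ^ n).
  intros n; assert (P : 0 < rho ^ n) by (apply pow_lt; lra).
  rewrite Cmod_mult, Cmod_R, Rabs_pos_eq by (apply Rinv_ge0; lra).
  apply Rle_trans with (/ (2 * PI) * (2 * (M * / rho ^ n) * (2 * PI - 0))).
    apply Rmult_le_compat_l; [apply Rinv_ge0; lra|].
    apply CI_bound; [lra|intros th _; apply ccont_mult; [auto|apply k_cont]|].
    intros th _; rewrite Cmod_mult, (Cmod_k rho) by lra.
    apply Rmult_le_compat_r; auto; apply Rinv_ge0, P.
  right; field; lra.
split; auto; intros u Hu.
assert (Hq : 0 <= Cmod u / rho < 1).
  split; [apply Rmult_le_pos; [apply Cmod_ge_0|apply Rinv_ge0; lra]|].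
  apply (Rmult_lt_reg_r rho); [lra|]; replace (Cmod u / rho * rho) with (Cmod u) by (field; lra).
  lra.
apply sums_to_nat with (fun n => 2 * M * (Cmod u / rho) ^ n) (2 * M * / (1 - Cmod u / rho)).
- intros n; rewrite Cmod_mult, Cmod_pow.
  unfold Rdiv; rewrite Rpow_mult_distr, pow_inv.
  replace (2 * M * (Cmod u ^ n * / rho ^ n)) with (2 * M / rho ^ n * Cmod u ^ n) by
    (unfold Rdiv; ring).
  apply Rmult_le_compat_r; [apply pow_le, Cmod_ge_0|apply Hc].
- apply bounded_sums_scal; [lra|]; apply bounded_sums_geom, Hq.
intros eps Heps.
destruct (pow_small (Cmod u / rho) (4 * PI * M * (rho / (rho - Cmod u))) Hq) with (eps := eps)
  as [n0 Hn0]; auto.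
  apply Rmult_le_pos; [apply Rmult_le_pos; lra|].
  apply Rmult_le_pos; [lra|apply Rinv_ge0; lra].
exists n0; intros n Hn.
assert (Hrho0 : 0 < rho) by lra.
assert (E1 := cauchy_v f z0 u R0 rho Hrho Hu Hf); cbv beta in E1.
set (v := fun th => (Ci * (RtoC rho * cis th) / (RtoC rho * cis th - u))%C).
assert (Cv : forall th, ccont v th) by exact (v_cont u R0 rho Hrho Hu).
rewrite (CI_ext _ (fun th => g th * v th - f (z0 + u)%C * v th)%C) in E1;
  [|lra|intros; unfold g, v; ring].
rewrite CI_minus, CI_scal in E1; auto; try lra;
  try (intros th _; apply ccont_mult; auto; apply ccont_const); try (intros th _; apply Cv).
unfold v in E1 at 2; rewrite kernel_total in E1; auto.
unfold v in E1; rewrite (kernel_expansion u rho Hrho0 Hu g Hg n) in E1.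
assert (E2 := rest_small u rho Hrho0 Hu g M Hg HgM n).
match type of E1 with (_ + ?r - _ = _)%C => set (r0 := r) in * end.
assert (E3 : (csum (fun n => RtoC (/ (2 * PI)) * I n * u ^ n) (seq 0 n) =
  RtoC (/ (2 * PI)) * csum (fun n => I n * u ^ n) (seq 0 n))%C).
  rewrite <- csum_scal; apply csum_ext; intros; ring.
rewrite E3; fold (I) in E1.
change (Ci * csum (fun n => I n * u ^ n) (seq 0 n) + r0 - f (z0 + u)%C * (RtoC (2 * PI) * Ci) = 0)%C
  in E1.
set (Sg := csum (fun n => I n * u ^ n)%C (seq 0 n)) in *.
assert (E4 : (RtoC (/ (2 * PI)) * Sg - f (z0 + u)%C = RtoC (/ (2 * PI)) * (Ci * r0))%C).
  assert (HCi : (Ci * Ci = RtoC (-1))%C) by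
    (unfold Ci, Cmult, RtoC; simpl; f_equal; ring).
  set (F := f (z0 + u)%C) in *.
  assert (E5 : (Sg - F * RtoC (2 * PI) = Ci * r0)%C).
    transitivity (- (Ci * Ci) * (Sg - F * RtoC (2 * PI)))%C; [rewrite HCi; ring|].
    transitivity (- Ci * (Ci * Sg + r0 - F * (RtoC (2 * PI) * Ci)) + Ci * r0)%C; [ring|].
    rewrite E1; ring.
  rewrite <- E5, RtoC_inv by lra; field; auto.
rewrite E4, !Cmod_mult, Cmod_Ci, Cmod_R, Rabs_pos_eq by (apply Rinv_ge0; lra).
apply Rle_lt_trans with (2 := Hn0 n Hn).
eapply Rle_trans; [|exact E2].
rewrite Rmult_1_l; rewrite <- (Rmult_1_l (Cmod r0)) at 2.
apply Rmult_le_compat; try apply Cmod_ge_0; [apply Rinv_ge0; lra| |lra].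
rewrite <- Rinv_1; apply Rinv_le_contravar; [lra|]; generalize PI2_1; lra.
Qed.

(** * Bohr's coefficient bound and the exponential series *)

Section Bohr.
Context {T X : Type}.
Variables (add : X -> X -> X) (x0 : X) (chi : T -> X -> C).
Hypothesis chi_add : forall t x y, chi t (add x y) = (chi t x * chi t y)%C.
Hypothesis chi_unit : forall t x, Cmod (chi t x) = 1.

Lemma chi_neq0 t x : chi t x <> 0.
Proof. apply Cmod_gt_0; rewrite chi_unit; lra. Qed.

(* Averaging [S x] with [S (add x y) / chi t0 y] kills the coefficient of every [chi t] such that
   [chi t y = - chi t0 y] and keeps that of [chi t0]. *)
Lemma kill_coefficients (B : T -> C) (N : T -> R) (Mb M : R) (t0 : T) :
  (forall t, Cmod (B t) <= N t) -> bounded_sums N Mb ->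
  (forall t, t <> t0 -> B t <> 0 -> exists y, chi t y = (- chi t0 y)%C) ->
  (forall x S, sums_to (fun t => B t * chi t x)%C S -> Cmod S <= M) ->
  forall F : list T, exists B' : T -> C,
    (forall t, Cmod (B' t) <= N t) /\ (forall t, B t = 0 -> B' t = 0) /\ B' t0 = B t0 /\
    (forall t, In t F -> t <> t0 -> B' t = 0) /\
    (forall x S, sums_to (fun t => B' t * chi t x)%C S -> Cmod S <= M).
Proof.
intros HB HN Hsep HM; induction F as [|a F [B' [H1 [H2 [H3 [H4 H5]]]]]].
  exists B; repeat split; auto; simpl; tauto.
destruct (classic (a = t0 \/ B' a = 0)) as [Ha|Ha].
  exists B'; repeat split; auto; intros t [->|Ht]; auto; tauto.
destruct (Hsep a) as [y Hy]; [tauto|intros E; apply Ha; auto|].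
assert (N0 := chi_neq0 t0 y).
assert (N2 : RtoC 2 <> 0) by (apply RtoC_neq0; lra).
assert (Hinv : Cmod (/ chi t0 y) = 1) by (rewrite Cmod_inv, chi_unit, Rinv_1; auto).
exists (fun t => B' t * ((1 + chi t y / chi t0 y) / 2))%C; split; [|split; [|split; [|split]]].
- intros t; rewrite Cmod_mult; rewrite <- (Rmult_1_r (N t)).
  apply Rmult_le_compat; auto using Cmod_ge_0.
  rewrite Cmod_div, Cmod_R, Rabs_pos_eq by (auto || lra).
  assert (Cmod (1 + chi t y / chi t0 y) <= 2); [|lra].
  apply Cmod_plus_le; unfold Cdiv.
  rewrite Cmod_1, Cmod_mult, chi_unit, Hinv; lra.
- intros t Ht; rewrite H2 by auto; ring.
- rewrite H3; field; auto.
- intros t [->|Ht] Htn; [rewrite Hy; field; auto|rewrite H4 by auto; ring].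
- intros x S HS.
  assert (E : forall x, exists S, sums_to (fun t => B' t * chi t x)%C S).
    intros x'; apply (sums_to_exists _ N Mb); auto.
    intros t; rewrite Cmod_mult, chi_unit, Rmult_1_r; auto.
  destruct (E x) as [S1 HS1]; destruct (E (add x y)) as [S2 HS2].
  assert (ES : S = (/ 2 * S1 + / 2 * / chi t0 y * S2)%C).
    apply (sums_to_unique _ _ _ HS).
    apply sums_to_ext with (fun t => / 2 * (B' t * chi t x) +
      / 2 * / chi t0 y * (B' t * chi t (add x y)))%C.
      intros t; rewrite chi_add; field; auto.
    apply sums_to_plus; apply sums_to_scal; auto.
  rewrite ES; apply Cmod_plus_le.
  rewrite !Cmod_mult, Hinv, Cmod_inv, Cmod_R, Rabs_pos_eq by (auto || lra).
  specialize (H5 x S1 HS1) as K1; specialize (H5 (add x y) S2 HS2) as K2; lra.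
Qed.

(** Kill all coefficients, except that of [t0], in a finite list carrying the mass up to [eps]; what
    remains at [x0] is a unimodular multiple of [B t0], up to [eps]. Repeated two-point averages
    stand in for a mean value, so that rotations of a circle and vertical translations in several
    variables are treated alike. *)
Lemma coefficient_bound (B : T -> C) (N : T -> R) (Mb M : R) (t0 : T) :
  (forall t, Cmod (B t) <= N t) -> bounded_sums N Mb ->
  (forall t, t <> t0 -> B t <> 0 -> exists y, chi t y = (- chi t0 y)%C) ->
  (forall x S, sums_to (fun t => B t * chi t x)%C S -> Cmod S <= M) ->
  Cmod (B t0) <= M.
Proof.
intros HB HN Hsep HM; apply le_epsilon; intros eps Heps.
destruct (tail_small N Mb HN eps Heps) as [F [HF K]].
destruct (kill_coefficients B N Mb M t0 HB HN Hsep HM F) as [B' [H1 [H2 [H3 [H4 H5]]]]].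
assert (PN : forall t, 0 <= N t) by (intros; eapply Rle_trans; [apply Cmod_ge_0|apply HB]).
destruct (sums_to_exists (fun t => B' t * chi t x0)%C N Mb) as [S HS]; auto.
  intros t; rewrite Cmod_mult, chi_unit, Rmult_1_r; auto.
set (g := fun t => if pb (t = t0) then (B t0 * chi t0 x0)%C else 0).
assert (Eg0 : g t0 = (B t0 * chi t0 x0)%C) by (unfold g; rewrite pbT; auto).
assert (Hg : sums_to g (B t0 * chi t0 x0)%C).
  replace (B t0 * chi t0 x0)%C with (csum g [t0]) by
    (unfold csum; simpl; rewrite Eg0; apply Cplus_0_r).
  apply sums_to_finite; [apply NoDup_single|].
  intros t Ht; unfold g; rewrite pbF; auto; intros ->; apply Ht; simpl; auto.
assert (Hd : sums_to (fun t => B' t * chi t x0 + (-1) * g t)%C (S + (-1) * (B t0 * chi t0 x0))).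
  apply sums_to_plus; [|apply sums_to_scal]; auto.
assert (E : Cmod (S + (-1) * (B t0 * chi t0 x0)) <= eps).
  apply (sums_to_le _ (fun t => if pb (In t F) then 0 else N t) eps _) with (3 := Hd).
  - intros t; destruct (classic (t = t0)) as [->|Ht].
      rewrite Eg0, H3; replace (_ + _)%C with (RtoC 0) by ring.
      rewrite Cmod_0; destruct (pb _); [lra|auto].
    unfold g; rewrite (pbF (t = t0)) by auto; rewrite Cmult_0_r, Cplus_0_r.
    destruct (classic (In t F)) as [Hi|Hi].
      rewrite H4, Cmult_0_l, Cmod_0, pbT by auto; lra.
    rewrite pbF, Cmod_mult, chi_unit, Rmult_1_r by auto; auto.
  - intros l Hl; apply Rlt_le.
    apply Rle_lt_trans with (rsum N (filter (fun t => negb (pb (In t F))) l)).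
      rewrite (rsum_split _ (fun t => pb (In t F)) l).
      rewrite (rsum_ext _ (fun _ => 0 * 0) (filter (fun t => pb (In t F)) l)).
        rewrite rsum_scal, Rmult_0_l, Rplus_0_l; apply rsum_le; intros t Ht.
        destruct (pb _); auto; lra.
      intros t; rewrite filter_In; intros [_ Ht]; rewrite Ht; ring.
    apply K; [apply NoDup_filter, Hl|].
    intros t; rewrite filter_In; intros [_ Ht] Hi; rewrite pbT in Ht; [discriminate|auto].
specialize (H5 x0 S HS).
replace (Cmod (B t0)) with (Cmod (B t0 * chi t0 x0)) by (rewrite Cmod_mult, chi_unit; ring).
replace (B t0 * chi t0 x0)%C with (S - (S + (-1) * (B t0 * chi t0 x0)))%C by ring.
apply Cmod_minus_le; lra.
Qed.

End Bohr.

Lemma cis_PI : cis PI = (- (1))%C.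
Proof. unfold cis; rewrite cos_PI, sin_PI; unfold Copp; simpl; f_equal; ring. Qed.

(** Bohr's bound with [0] on the right, for the characters of the circle. It serves to identify
    Taylor coefficients. *)
Lemma power_series_zero (c : nat -> C) (N : nat -> R) (M rho : R) :
  0 < rho -> (forall n, Cmod (c n) * rho ^ n <= N n) -> bounded_sums N M ->
  (forall z, Cmod z = rho -> sums_to (fun n => c n * z ^ n)%C 0) -> forall n, c n = 0.
Proof.
intros Hrho HN HM H n.
assert (P : 0 < rho ^ n) by (apply pow_lt, Hrho).
assert (E : Cmod (c n * RtoC (rho ^ n)) <= 0).
  apply (coefficient_bound Rplus 0 (fun n th => cis (INR n * th))) with
    (B := fun n => (c n * RtoC (rho ^ n))%C) (N := N) (Mb := M).
  - intros k x y; rewrite Rmult_plus_distr_l; apply cis_plus.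
  - intros; apply Cmod_cis.
  - intros k; assert (Q : 0 < rho ^ k) by (apply pow_lt, Hrho).
    rewrite Cmod_mult, Cmod_R, Rabs_pos_eq; [auto|lra].
  - auto.
  - intros k Hk _; exists (PI / (INR k - INR n)).
    assert (D : INR k - INR n <> 0) by (intros D; apply Hk, INR_eq; lra).
    replace (INR k * (PI / (INR k - INR n))) with (INR n * (PI / (INR k - INR n)) + PI) by
      (field; auto).
    rewrite cis_plus, cis_PI; ring.
  - intros x S HS; replace S with (RtoC 0); [rewrite Cmod_0; lra|].
    apply (sums_to_unique _ _ _) with (2 := HS).
    apply sums_to_ext with (fun n => c n * (RtoC rho * cis x) ^ n)%C.
      intros k; rewrite Cpow_mult, cis_pow, RtoC_pow; ring.
    apply H; rewrite Cmod_mult, Cmod_cis, Cmod_R, Rabs_pos_eq; lra.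
rewrite Cmod_mult, Cmod_R, Rabs_pos_eq in E by lra.
apply Cmod_eq_0, Rle_antisym; [|apply Cmod_ge_0].
apply (Rmult_le_reg_r (rho ^ n)); lra.
Qed.

(** * The complex exponential and its series *)

Definition cexp (z : C) : C := (exp (fst z) * cos (snd z), exp (fst z) * sin (snd z)).

Lemma cexp_cis z : cexp z = (RtoC (exp (fst z)) * cis (snd z))%C.
Proof. unfold cexp, cis, Cmult; simpl; f_equal; ring. Qed.

Lemma cexp_plus x y : cexp (x + y) = (cexp x * cexp y)%C.
Proof.
rewrite !cexp_cis; unfold Cplus; simpl; rewrite exp_plus, cis_plus, RtoC_mult; ring.
Qed.

Lemma Cmod_cexp z : Cmod (cexp z) = exp (fst z).
Proof.
rewrite cexp_cis, Cmod_mult, Cmod_cis, Cmod_R, Rabs_pos_eq; [ring|].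
apply exp_ge0.
Qed.

Lemma cexp_0 : cexp 0 = 1.
Proof. unfold cexp; simpl; rewrite exp_0, cos_0, sin_0; unfold RtoC; f_equal; ring. Qed.

Lemma CI_bound_pow f t K n : 0 <= t -> ccont_on f 0 t ->
  (forall x, 0 <= x <= t -> Cmod (f x) <= K * x ^ n) ->
  Cmod (CI f 0 t) <= 2 * K * t ^ S n / INR (S n).
Proof.
intros Ht Hf HK; destruct (ccont_on_int f 0 t Ht Hf) as [A B].
assert (HI : is_RInt (fun x => K * x ^ n) 0 t (K * t ^ S n / INR (S n))).
  replace (K * t ^ S n / INR (S n)) with
    (minus (K * t ^ S n / INR (S n)) (K * 0 ^ S n / INR (S n))) by
    (unfold minus, plus, opp; simpl (0 ^ S n); simpl; field; apply (not_0_INR (S n)); lia).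
  apply (is_RInt_derive (fun x => K * x ^ S n / INR (S n))).
    intros x _; auto_derive; auto; simpl pred.
    field; apply (not_0_INR (S n)); lia.
  intros x _; apply (ex_derive_continuous (V := R_NormedModule)); auto_derive; auto.
assert (G : forall g : R -> R, ex_RInt g 0 t ->
  (forall x, 0 <= x <= t -> Rabs (g x) <= K * x ^ n) ->
  Rabs (RInt g 0 t) <= K * t ^ S n / INR (S n)).
  intros g Hg Hgb.
  apply (norm_RInt_le g (fun x => K * x ^ n) 0 t); auto.
  apply (RInt_correct (V := R_CompleteNormedModule)), Hg.
eapply Rle_trans; [apply Cmod_le_sum|]; unfold CI; simpl fst; simpl snd.
replace (2 * K * t ^ S n / INR (S n)) with (K * t ^ S n / INR (S n) + K * t ^ S n / INR (S n)) by
  (field; apply (not_0_INR (S n)); lia).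
apply Rplus_le_compat; apply G; auto; intros x Hx; specialize (HK x Hx).
- eapply Rle_trans; [apply fst_le_Cmod|auto].
- eapply Rle_trans; [apply snd_le_Cmod|auto].
Qed.

Definition exp_partial (n : nat) (z : C) : C :=
  csum (fun j => RtoC (/ INR (fact j)) * z ^ j)%C (seq 0 n).

Definition cderiv (f df : R -> C) : Prop :=
  (forall x, is_derive (fun x => fst (f x)) x (fst (df x))) /\
  (forall x, is_derive (fun x => snd (f x)) x (snd (df x))).

Lemma cderiv_plus f g df dg : cderiv f df -> cderiv g dg ->
  cderiv (fun x => f x + g x)%C (fun x => df x + dg x)%C.
Proof.
intros [A B] [A' B']; split; intros x; simpl.
- apply (is_derive_plus (fun x => fst (f x)) (fun x => fst (g x))); auto.
- apply (is_derive_plus (fun x => snd (f x)) (fun x => snd (g x))); auto.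
Qed.

Lemma cderiv_real (g dg : R -> R) (c : C) : (forall x, is_derive g x (dg x)) ->
  cderiv (fun x => RtoC (g x) * c)%C (fun x => RtoC (dg x) * c)%C.
Proof.
intros H; split; intros x; simpl.
- apply (is_derive_ext (fun x => g x * fst c)); [intros; simpl; ring|].
  replace (dg x * fst c - 0 * snd c) with (dg x * fst c) by ring.
  apply (is_derive_scal_l g x (dg x) (fst c)), H.
- apply (is_derive_ext (fun x => g x * snd c)); [intros; simpl; ring|].
  replace (dg x * snd c + 0 * fst c) with (dg x * snd c) by ring.
  apply (is_derive_scal_l g x (dg x) (snd c)), H.
Qed.

Lemma cderiv_cexp (h : C) :
  cderiv (fun t => cexp (RtoC t * h)) (fun t => h * cexp (RtoC t * h))%C.
Proof.
destruct h as [p q]; split; intros x; unfold cexp; simpl; auto_derive; auto; unfold Rminus; ring.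
Qed.

Lemma cderiv_exp_partial n (h : C) :
  cderiv (fun t => exp_partial (S n) (RtoC t * h)) (fun t => h * exp_partial n (RtoC t * h))%C.
Proof.
induction n as [|n IH].
  split; intros x; unfold exp_partial, csum; simpl; auto_derive; auto; ring.
assert (D := cderiv_real (fun t => / INR (fact (S n)) * t ^ S n)
  (fun t => / INR (fact n) * t ^ n) (h ^ S n)%C).
assert (Hd : forall x, is_derive (fun t => / INR (fact (S n)) * t ^ S n) x
  (/ INR (fact n) * x ^ n)).
  intros x; assert (Fn : INR (fact n) <> 0) by apply INR_fact_neq_0.
  assert (Sn : INR (S n) <> 0) by (apply not_0_INR; lia).
  assert (Fs : / INR (fact (S n)) * INR (S n) = / INR (fact n)).
    rewrite fact_simpl, mult_INR; field; auto.
  rewrite <- Fs; generalize (/ INR (fact (S n))); intros k.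
  auto_derive; auto; change (k * (1 * (INR (S n) * x ^ n)) = k * INR (S n) * x ^ n); ring.
specialize (D Hd); assert (E := cderiv_plus _ _ _ _ IH D).
unfold exp_partial in *.
replace (fun t : R =>
    csum (fun j => (RtoC (/ INR (fact j)) * (RtoC t * h) ^ j)%C) (seq 0 (S (S n))))
  with (fun x : R => (csum (fun j => RtoC (/ INR (fact j)) * (RtoC x * h) ^ j) (seq 0 (S n)) +
    RtoC (/ INR (fact (S n)) * x ^ S n) * h ^ S n)%C).
  replace (fun t : R => (h * csum (fun j => RtoC (/ INR (fact j)) * (RtoC t * h) ^ j)
    (seq 0 (S n)))%C) with (fun x : R =>
    (h * csum (fun j => RtoC (/ INR (fact j)) * (RtoC x * h) ^ j) (seq 0 n) +
     RtoC (/ INR (fact n) * x ^ n) * h ^ S n)%C); [exact E|].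
  apply functional_extensionality; intros x; rewrite csum_seq_S, Cpow_mult, RtoC_mult, RtoC_pow.
  simpl (h ^ S n)%C; ring.
apply functional_extensionality; intros x.
rewrite (csum_seq_S _ (S n)), Cpow_mult, RtoC_mult, RtoC_pow; ring.
Qed.

Lemma cderiv_minus f g df dg : cderiv f df -> cderiv g dg ->
  cderiv (fun x => f x - g x)%C (fun x => df x - dg x)%C.
Proof.
intros [A B] [A' B']; split; intros x; simpl.
- apply (is_derive_minus (fun x => fst (f x)) (fun x => fst (g x))); auto.
- apply (is_derive_minus (fun x => snd (f x)) (fun x => snd (g x))); auto.
Qed.

Lemma ccont_deriv f df x : cderiv f df -> ccont f x.
Proof.
intros [A B]; split; apply (ex_derive_continuous (V := R_NormedModule)); eexists; eauto.
Qed.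

(** Integration along the segment from [0] to [h]: the derivative of a remainder is [h] times the
    preceding remainder. Each integration costs a factor [2], hence the base [2 * Cmod h]. *)
Lemma exp_remainder_line (h : C) n : forall t, 0 <= t <= 1 ->
  Cmod (cexp (RtoC t * h) - exp_partial n (RtoC t * h)) <=
  (2 * Cmod h) ^ n * exp (Cmod h) / INR (fact n) * t ^ n.
Proof.
assert (H0 := Cmod_ge_0 h).
induction n as [|n IH]; intros t Ht.
  unfold exp_partial, csum; simpl; unfold Cminus; rewrite Copp_0, Cplus_0_r, Cmod_cexp.
  apply Rle_trans with (exp (Cmod h)); [|right; field].
  simpl; replace (t * fst h - 0 * snd h) with (t * fst h) by ring.
  assert (t * fst h <= Cmod h).
    apply Rle_trans with (t * Cmod h).
      apply Rmult_le_compat_l; [lra|].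
      eapply Rle_trans; [apply Rle_abs|apply fst_le_Cmod].
    rewrite <- (Rmult_1_l (Cmod h)) at 2; apply Rmult_le_compat_r; lra.
  destruct H as [H|H]; [apply Rlt_le, exp_increasing, H|rewrite H; lra].
assert (D := cderiv_minus _ _ _ _ (cderiv_cexp h) (cderiv_exp_partial n h)); cbv beta in D.
assert (E := CI_deriv (fun t => cexp (RtoC t * h) - exp_partial (S n) (RtoC t * h))%C
  (fun t => h * cexp (RtoC t * h) - h * exp_partial n (RtoC t * h))%C 0 t).
assert (D' : ccont_on (fun t => h * cexp (RtoC t * h) - h * exp_partial n (RtoC t * h))%C 0 t).
  intros x _; apply ccont_minus; apply ccont_mult; try apply ccont_const.
    apply (ccont_deriv _ _ x (cderiv_cexp h)).
  (* The empty partial sum is constant and lies outside the range of [cderiv_exp_partial]. *)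
  destruct n as [|n]; [apply (ccont_const (RtoC 0))|].
  apply (ccont_deriv _ _ x (cderiv_exp_partial n h)).
specialize (E (proj1 Ht) (proj1 D) (proj2 D) D').
assert (Z : exp_partial (S n) (RtoC 0 * h) = 1).
  rewrite Cmult_0_l; clear; induction n as [|n IH].
    unfold exp_partial, csum; simpl; rewrite Rinv_1; ring.
  unfold exp_partial in *; rewrite csum_seq_S, IH; simpl; ring.
cbv beta in E; rewrite Z, Cmult_0_l, cexp_0 in E.
replace (cexp (RtoC t * h) - exp_partial (S n) (RtoC t * h))%C with
  (cexp (RtoC t * h) - exp_partial (S n) (RtoC t * h) - (1 - 1))%C by ring.
rewrite <- E.
assert (Fn : INR (fact n) <> 0) by apply INR_fact_neq_0.
assert (Sn : INR (S n) <> 0) by (apply not_0_INR; lia).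
eapply Rle_trans; [apply (CI_bound_pow _ t
  (Cmod h * ((2 * Cmod h) ^ n * exp (Cmod h) / INR (fact n))) n (proj1 Ht) D')|].
- intros x Hx.
  replace (h * cexp (RtoC x * h) - h * exp_partial n (RtoC x * h))%C with
    (h * (cexp (RtoC x * h) - exp_partial n (RtoC x * h)))%C by ring.
  rewrite Cmod_mult, Rmult_assoc; apply Rmult_le_compat_l; auto; apply IH; lra.
- right; rewrite fact_simpl, mult_INR; simpl ((2 * Cmod h) ^ S n); field; auto.
Qed.

Lemma exp_remainder (h : C) n :
  Cmod (cexp h - exp_partial n h) <= (2 * Cmod h) ^ n * exp (Cmod h) / INR (fact n).
Proof.
assert (K := exp_remainder_line h n 1 ltac:(lra)).
rewrite Cmult_1_l, pow1, Rmult_1_r in K; exact K.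
Qed.

Lemma exp_partial_cvg (h : C) eps : 0 < eps -> exists n0, forall n, (n0 <= n)%nat ->
  Cmod (exp_partial n h - cexp h) < eps.
Proof.
intros Heps; destruct (cv_speed_pow_fact (2 * Cmod h) (eps / exp (Cmod h))) as [n0 H].
  apply Rdiv_lt_0_compat; [auto|apply exp_pos].
exists n0; intros n Hn; specialize (H n Hn); unfold R_dist in H; rewrite Rminus_0_r in H.
apply (Rle_lt_trans _ _ _ (Rle_abs _)) in H.
rewrite Cmod_minus_sym; eapply Rle_lt_trans; [apply exp_remainder|].
assert (P := exp_pos (Cmod h)).
replace eps with (eps / exp (Cmod h) * exp (Cmod h)) by (field; lra).
replace ((2 * Cmod h) ^ n * exp (Cmod h) / INR (fact n)) with
  ((2 * Cmod h) ^ n / INR (fact n) * exp (Cmod h)) by (field; apply INR_fact_neq_0).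
apply Rmult_lt_compat_r; auto.
Qed.

Lemma cexp_RtoC x : cexp (RtoC x) = RtoC (exp x).
Proof. unfold cexp; simpl; rewrite cos_0, sin_0; unfold RtoC; f_equal; ring. Qed.

Lemma exp_partial_RtoC n x :
  exp_partial n (RtoC x) = RtoC (rsum (fun j => / INR (fact j) * x ^ j) (seq 0 n)).
Proof.
rewrite <- csum_RtoC; apply csum_ext; intros j _; rewrite RtoC_mult, RtoC_pow; reflexivity.
Qed.

Lemma fact_inv_ge0 n : 0 <= / INR (fact n).
Proof. apply Rinv_ge0, INR_fact_lt_0. Qed.

Lemma bounded_sums_exp x : 0 <= x -> bounded_sums (fun j => / INR (fact j) * x ^ j) (exp x).
Proof.
intros Hx; assert (P : forall j, 0 <= / INR (fact j) * x ^ j).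
  intros j; apply Rmult_le_pos; [apply fact_inv_ge0|apply pow_le, Hx].
apply bounded_sums_nat; auto; intros n; apply le_epsilon; intros eps Heps.
destruct (exp_partial_cvg (RtoC x) eps Heps) as [n0 H].
specialize (H (n + n0)%nat ltac:(lia)).
rewrite exp_partial_RtoC, cexp_RtoC, <- RtoC_minus, Cmod_R in H.
apply (Rle_lt_trans _ _ _ (Rle_abs _)) in H.
assert (rsum (fun j => / INR (fact j) * x ^ j) (seq 0 n) <=
  rsum (fun j => / INR (fact j) * x ^ j) (seq 0 (n + n0))); [|lra].
apply rsum_incl; auto; [apply seq_NoDup|].
intros k Hk; apply in_seq in Hk; apply in_seq; lia.
Qed.

(** Turns separate bounds on all Taylor coefficients into the exponential decay of
    [coefficient_decay]. *)
Lemma exp_le_partial x K :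
  (forall n, rsum (fun j => / INR (fact j) * x ^ j) (seq 0 n) <= K) -> exp x <= K.
Proof.
intros H; apply le_epsilon; intros eps Heps.
destruct (exp_partial_cvg (RtoC x) eps Heps) as [n0 Hn].
specialize (Hn n0 (Nat.le_refl _)).
rewrite Cmod_minus_sym, exp_partial_RtoC, cexp_RtoC, <- RtoC_minus, Cmod_R in Hn.
apply (Rle_lt_trans _ _ _ (Rle_abs _)) in Hn; specialize (H n0); lra.
Qed.

Lemma sums_to_exp (z : C) : sums_to (fun j => RtoC (/ INR (fact j)) * z ^ j)%C (cexp z).
Proof.
apply (sums_to_nat _ (fun j => / INR (fact j) * Cmod z ^ j) (exp (Cmod z))).
- intros n; rewrite Cmod_mult, Cmod_R, Cmod_pow, Rabs_pos_eq; [lra|].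
  apply fact_inv_ge0.
- apply bounded_sums_exp, Cmod_ge_0.
- intros eps Heps; apply exp_partial_cvg, Heps.
Qed.

(** * Stability of complex differentiability *)

Lemma cdiff_const c z : cdiff (fun _ => c) z.
Proof.
exists 0; intros eps Heps; exists 1; split; [lra|]; intros h _.
replace (c - c - 0 * h)%C with (RtoC 0) by ring; rewrite Cmod_0.
apply Rmult_le_pos; [lra|apply Cmod_ge_0].
Qed.

Lemma cdiff_plus f g z : cdiff f z -> cdiff g z -> cdiff (fun x => f x + g x)%C z.
Proof.
intros [d Hd] [e He]; exists (d + e)%C; intros eps Heps.
destruct (Hd (eps / 2)) as [d1 [P1 K1]]; [lra|].
destruct (He (eps / 2)) as [d2 [P2 K2]]; [lra|].
exists (Rmin d1 d2); split; [apply Rmin_pos; auto|]; intros h Hh.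
specialize (K1 h (Rlt_le_trans _ _ _ Hh (Rmin_l _ _))).
specialize (K2 h (Rlt_le_trans _ _ _ Hh (Rmin_r _ _))).
replace (f (z + h) + g (z + h) - (f z + g z) - (d + e) * h)%C with
  ((f (z + h)%C - f z - d * h) + (g (z + h)%C - g z - e * h))%C by ring.
apply Cmod_plus_le; lra.
Qed.

Lemma cdiff_lip f z : cdiff f z -> exists K delta, 0 < K /\ 0 < delta /\
  forall h, Cmod h < delta -> Cmod (f (z + h)%C - f z) <= K * Cmod h.
Proof.
intros [d H]; destruct (H 1 Rlt_0_1) as [delta [Hd K]].
exists (Cmod d + 1), delta; split; [generalize (Cmod_ge_0 d); lra|]; split; auto.
intros h Hh; specialize (K h Hh).
replace (f (z + h) - f z)%C with ((f (z + h)%C - f z - d * h) + d * h)%C by ring.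
apply Cmod_plus_le; rewrite Cmod_mult; lra.
Qed.

Lemma cdiff_comp f g z : cdiff g z -> cdiff f (g z) -> cdiff (fun x => f (g x)) z.
Proof.
intros Hg [d Hf].
destruct (cdiff_lip g z Hg) as [K [dl [HK [Hdl L]]]].
destruct Hg as [e He]; exists (d * e)%C; intros eps Heps.
assert (Hd0 := Cmod_ge_0 d).
destruct (Hf (eps / (2 * K))) as [d1 [P1 K1]]; [apply Rdiv_lt_0_compat; lra|].
destruct (He (eps / (2 * (Cmod d + 1)))) as [d2 [P2 K2]]; [apply Rdiv_lt_0_compat; lra|].
exists (Rmin (Rmin dl d2) (d1 / K)); split.
  repeat apply Rmin_pos; auto; apply Rdiv_lt_0_compat; auto.
intros h Hh.
assert (Hh1 := Rlt_le_trans _ _ _ Hh (Rmin_l _ _)).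
assert (Hh2 := Rlt_le_trans _ _ _ Hh (Rmin_r _ _)).
assert (Hh3 := Rlt_le_trans _ _ _ Hh1 (Rmin_l _ _)).
assert (Hh4 := Rlt_le_trans _ _ _ Hh1 (Rmin_r _ _)).
specialize (L h Hh3); specialize (K2 h Hh4).
set (k := (g (z + h) - g z)%C) in *.
assert (Hk : Cmod k < d1).
  eapply Rle_lt_trans; [exact L|].
  replace d1 with (K * (d1 / K)) by (field; lra); apply Rmult_lt_compat_l; auto.
specialize (K1 k Hk); replace (g z + k)%C with (g (z + h)%C) in K1 by (unfold k; ring).
replace (f (g (z + h)%C) - f (g z) - d * e * h)%C with
  ((f (g (z + h)%C) - f (g z) - d * k) + d * (k - e * h))%C by ring.
apply Cmod_plus_le; rewrite Cmod_mult.
assert (A : eps / (2 * K) * Cmod k <= eps / 2 * Cmod h).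
  apply Rle_trans with (eps / (2 * K) * (K * Cmod h)).
    apply Rmult_le_compat_l; auto; apply Rlt_le, Rdiv_lt_0_compat; lra.
  right; field; lra.
assert (B : Cmod d * Cmod (k - e * h) <= eps / 2 * Cmod h).
  apply Rle_trans with ((Cmod d + 1) * (eps / (2 * (Cmod d + 1)) * Cmod h)).
    apply Rmult_le_compat; auto using Cmod_ge_0; lra.
  right; field; lra.
lra.
Qed.

Lemma cdiff_linear (a b z : C) : cdiff (fun x => a + b * x)%C z.
Proof.
exists b; intros eps Heps; exists 1; split; [lra|]; intros h _.
replace (a + b * (z + h) - (a + b * z) - b * h)%C with (RtoC 0) by ring; rewrite Cmod_0.
apply Rmult_le_pos; [lra|apply Cmod_ge_0].
Qed.

Lemma cdiff_scal c f z : cdiff f z -> cdiff (fun x => c * f x)%C z.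
Proof.
intros H; replace (fun x => c * f x)%C with (fun x => (fun y => 0 + c * y)%C (f x)).
  apply (cdiff_comp (fun y => 0 + c * y)%C f); [exact H|apply cdiff_linear].
apply functional_extensionality; intros x; ring.
Qed.

Lemma cdiff_cexp z : cdiff cexp z.
Proof.
exists (cexp z); intros eps Heps.
assert (P : 0 < 2 * exp 1 * Cmod (cexp z)).
  rewrite Cmod_cexp; assert (H := exp_pos 1); assert (H' := exp_pos (fst z)); nra.
exists (Rmin 1 (eps / (2 * exp 1 * Cmod (cexp z)))); split.
  apply Rmin_pos; [lra|apply Rdiv_lt_0_compat; lra].
intros h Hh.
assert (H1 := Rlt_le_trans _ _ _ Hh (Rmin_l _ _)).
assert (H2 := Rlt_le_trans _ _ _ Hh (Rmin_r _ _)).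
rewrite cexp_plus.
replace (cexp z * cexp h - cexp z - cexp z * h)%C with (cexp z * (cexp h - exp_partial 2 h))%C.
  rewrite Cmod_mult; assert (E := exp_remainder h 2).
  assert (He : exp (Cmod h) <= exp 1) by (apply Rlt_le, exp_increasing, H1).
  assert (Hc := Cmod_ge_0 h); assert (Hz := Cmod_ge_0 (cexp z)).
  apply Rle_trans with (Cmod (cexp z) * (2 * exp 1 * Cmod h * Cmod h)).
    apply Rmult_le_compat_l; auto; eapply Rle_trans; [exact E|].
    simpl fact; simpl (INR 2); simpl pow.
    replace (2 * Cmod h * (2 * Cmod h * 1) * exp (Cmod h) / (1 + 1)) with
      (2 * Cmod h * Cmod h * exp (Cmod h)) by field.
    replace (2 * exp 1 * Cmod h * Cmod h) with (2 * Cmod h * Cmod h * exp 1) by ring.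
    apply Rmult_le_compat_l; auto; apply Rmult_le_pos; auto; lra.
  replace (Cmod (cexp z) * (2 * exp 1 * Cmod h * Cmod h)) with
    ((2 * exp 1 * Cmod (cexp z)) * Cmod h * Cmod h) by ring.
  apply Rmult_le_compat_r; auto.
  set (q := 2 * exp 1 * Cmod (cexp z)) in *.
  replace eps with (q * (eps / q)) by (field; lra).
  apply Rmult_le_compat_l; lra.
unfold exp_partial, csum; simpl; replace (/ (1 + 0)) with 1 by field.
rewrite Rinv_1; ring.
Qed.

Lemma cdiff_csum {T} (f : T -> C -> C) (l : list T) z : (forall t, In t l -> cdiff (f t) z) ->
  cdiff (fun x => csum (fun t => f t x) l) z.
Proof.
induction l as [|t l IH]; intros H; [exact (cdiff_const (RtoC 0) z)|].
apply (cdiff_plus (f t) (fun x => csum (fun t => f t x) l)); [apply H; simpl; auto|].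
apply IH; intros; apply H; simpl; auto.
Qed.

(** * Generalised Dirichlet series in a half-space *)

Section SumLt.
Implicit Types (n : nat) (g h : nat -> R).

Lemma sum_lt_ext n g h : (forall i, (i < n)%nat -> g i = h i) -> sum_lt n g = sum_lt n h.
Proof. induction n as [|n IH]; intros H; simpl; [auto|rewrite IH, H; auto]. Qed.

Lemma sum_lt_plus n g h : sum_lt n (fun i => g i + h i) = sum_lt n g + sum_lt n h.
Proof. induction n as [|n IH]; simpl; [ring|rewrite IH; ring]. Qed.

Lemma sum_lt_scal n c g : sum_lt n (fun i => c * g i) = c * sum_lt n g.
Proof. induction n as [|n IH]; simpl; [ring|rewrite IH; ring]. Qed.

Lemma sum_lt_le n g h : (forall i, (i < n)%nat -> g i <= h i) -> sum_lt n g <= sum_lt n h.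
Proof. induction n as [|n IH]; intros H; simpl; [lra|apply Rplus_le_compat; auto]. Qed.

Lemma sum_lt_0 n : sum_lt n (fun _ => 0) = 0.
Proof. induction n as [|n IH]; simpl; [auto|rewrite IH; ring]. Qed.

Lemma sum_lt_single n g i : (i < n)%nat -> (forall j, j <> i -> g j = 0) -> sum_lt n g = g i.
Proof.
intros Hi H; induction n as [|n IH]; [lia|]; simpl.
destruct (Nat.eq_dec i n) as [->|Hn]; [|rewrite IH, (H n) by lia; ring].
rewrite (sum_lt_ext n g (fun _ => 0)); [rewrite sum_lt_0; ring|].
intros j Hj; apply H; lia.
Qed.

End SumLt.

(** * Exponentials under diagonal shifts and vertical translations *)

Definition shift (s : cvec) (z : C) : cvec := fun i => (s i + z)%C.
Definition half_space (n : nat) (sigma : R) (s : cvec) : Prop :=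
  forall i, (i < n)%nat -> sigma <= fst (s i).
Definition in_orthant (n : nat) (l : vec) : Prop :=
  (forall i, (i < n)%nat -> 0 <= l i) /\ (forall i, (n <= i)%nat -> l i = 0).

Lemma expterm_cexp n l s : expterm n l s = cexp (- vdot n l s).
Proof. reflexivity. Qed.

Lemma expterm_zero n s : expterm n vzero s = RtoC 1.
Proof.
rewrite expterm_cexp; unfold vdot, vzero.
rewrite !sum_lt_scal, !Rmult_0_l.
replace (- (0, 0))%C with (RtoC 0) by (unfold Copp, RtoC; simpl; f_equal; ring).
apply cexp_0.
Qed.

Lemma expterm_vadd n l l' s : expterm n (vadd l l') s = (expterm n l s * expterm n l' s)%C.
Proof.
rewrite !expterm_cexp, <- cexp_plus; f_equal; unfold vdot, vadd, Copp, Cplus; simpl.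
rewrite (sum_lt_ext n (fun i => (l i + l' i) * fst (s i))
  (fun i => l i * fst (s i) + l' i * fst (s i))) by (intros; ring).
rewrite (sum_lt_ext n (fun i => (l i + l' i) * snd (s i))
  (fun i => l i * snd (s i) + l' i * snd (s i))) by (intros; ring).
rewrite !sum_lt_plus; f_equal; ring.
Qed.

(** Along the diagonal only the degree [sum_lt n l] of a frequency matters, which reduces the
    continuation to the left to one complex variable. *)
Lemma expterm_shift n l s z :
  expterm n l (shift s z) = (expterm n l s * cexp (- (RtoC (sum_lt n l) * z)))%C.
Proof.
rewrite !expterm_cexp, <- cexp_plus; f_equal; unfold vdot, shift, Copp, Cplus; simpl.
rewrite (sum_lt_ext n (fun i => l i * (fst (s i) + fst z))
  (fun i => l i * fst (s i) + fst z * l i)) by (intros; ring).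
rewrite (sum_lt_ext n (fun i => l i * (snd (s i) + snd z))
  (fun i => l i * snd (s i) + snd z * l i)) by (intros; ring).
rewrite !sum_lt_plus, !sum_lt_scal; f_equal; ring.
Qed.

Lemma Cmod_expterm n l s : Cmod (expterm n l s) = exp (- sum_lt n (fun i => l i * fst (s i))).
Proof. rewrite expterm_cexp, Cmod_cexp; reflexivity. Qed.

Lemma exp_le x y : x <= y -> exp x <= exp y.
Proof. intros [H|H]; [apply Rlt_le, exp_increasing, H|rewrite H; lra]. Qed.

Lemma Cmod_expterm_le n l s sigma : (forall i, (i < n)%nat -> 0 <= l i) -> half_space n sigma s ->
  Cmod (expterm n l s) <= exp (- (sigma * sum_lt n l)).
Proof.
intros Hl Hs; rewrite Cmod_expterm; apply exp_le, Ropp_le_contravar.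
rewrite <- sum_lt_scal; apply sum_lt_le; intros i Hi.
rewrite Rmult_comm; apply Rmult_le_compat_l; auto.
Qed.

Lemma in_orthant_deg n l : in_orthant n l -> 0 <= sum_lt n l.
Proof. intros [H _]; rewrite <- (sum_lt_0 n); apply sum_lt_le; auto. Qed.

Lemma half_space_shift n sigma s z x : half_space n sigma s -> x <= fst z ->
  half_space n (sigma + x) (shift s z).
Proof. intros H Hz i Hi; unfold shift; simpl; specialize (H i Hi); lra. Qed.

Lemma Cmod_fst_ge (z : C) x : Cmod z <= x -> - x <= fst z.
Proof. intros H; generalize (fst_le_Cmod z); intros K; apply Rabs_le_between in K; lra. Qed.

Definition vchar (n : nat) (l t : vec) : C := cis (- sum_lt n (fun i => l i * t i)).

Lemma vchar_vadd n l x y : vchar n l (vadd x y) = (vchar n l x * vchar n l y)%C.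
Proof.
unfold vchar, vadd; rewrite <- cis_plus; f_equal.
rewrite (sum_lt_ext n _ (fun i => l i * x i + l i * y i)) by (intros; ring).
rewrite sum_lt_plus; ring.
Qed.

(** Translate in one coordinate where the frequencies differ, by the length that makes the phases
    differ by [PI]. *)
Lemma vchar_separates n l l' : (forall i, (n <= i)%nat -> l i = 0) ->
  (forall i, (n <= i)%nat -> l' i = 0) -> l <> l' -> exists y, vchar n l y = (- vchar n l' y)%C.
Proof.
intros H H' Hn.
assert (E : exists i, (i < n)%nat /\ l i <> l' i).
  apply NNPP; intros K; apply Hn, functional_extensionality; intros i.
  destruct (Nat.lt_ge_cases i n) as [Hi|Hi]; [|rewrite H, H'; auto].
  apply NNPP; intros E; apply K; exists i; auto.
destruct E as [i [Hi E]].
exists (fun j => if Nat.eq_dec j i then PI / (l' i - l i) else 0); unfold vchar.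
assert (K : forall k : vec, sum_lt n (fun j => k j *
  (if Nat.eq_dec j i then PI / (l' i - l i) else 0)) = k i * (PI / (l' i - l i))).
  intros k; rewrite (sum_lt_single n _ i); auto.
    destruct (Nat.eq_dec i i); [reflexivity|tauto].
  intros j Hj; destruct (Nat.eq_dec j i); [tauto|ring].
rewrite !K.
replace (- (l i * (PI / (l' i - l i)))) with (- (l' i * (PI / (l' i - l i))) + PI) by
  (field; lra).
rewrite cis_plus, cis_PI; ring.
Qed.

Lemma expterm_vertical n l sigma t :
  expterm n l (fun i => (sigma, t i)) = (RtoC (exp (- (sigma * sum_lt n l))) * vchar n l t)%C.
Proof.
rewrite expterm_cexp, cexp_cis; unfold vdot, vchar; simpl.
rewrite (sum_lt_ext n (fun i => l i * sigma) (fun i => sigma * l i)) by (intros; ring).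
rewrite sum_lt_scal; reflexivity.
Qed.

(** * Moving the abscissa of absolute convergence to the left *)

Section Hop.
Variables (n : nat) (U : vec -> Prop) (Psi : cvec -> C) (kappa M : R) (B : vec -> C).
Hypothesis HU : forall l, U l -> in_orthant n l.
Hypothesis Usum : forall y, 0 < y -> exists m,
  bounded_sums (fun l => if pb (U l) then exp (- (y * sum_lt n l)) else 0) m.
Hypothesis Hkappa : 0 < kappa.
Hypothesis HPsi : forall s, half_space n 0 s -> exists d : nat -> C,
  (forall j, Cmod (d j) <= M / kappa ^ j) /\
  forall z, Cmod z < kappa -> sums_to (fun j => d j * z ^ j)%C (Psi (shift s z)).
Hypothesis HB : forall l, ~ U l -> B l = 0.

(** For [l] in [U], [wt sigma l] is the largest modulus of the term of [l] on the half-space of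
    abscissa [sigma]. The quantity [dterm s j l] is the [j]-th Taylor coefficient of that term at
    [s] in the diagonal direction. *)
Let wt (sigma : R) (l : vec) : R := Cmod (B l) * exp (- (sigma * sum_lt n l)).
Let represents (sigma : R) : Prop :=
  (exists m, bounded_sums (wt sigma) m) /\
  forall s, half_space n sigma s -> sums_to (fun l => B l * expterm n l s)%C (Psi s).
Let dterm (s : cvec) (j : nat) (l : vec) : C :=
  (B l * expterm n l s * (RtoC (/ INR (fact j)) * (- RtoC (sum_lt n l)) ^ j))%C.

Lemma wt_ge0 sigma l : 0 <= wt sigma l.
Proof. apply Rmult_le_pos; [apply Cmod_ge_0|apply exp_ge0]. Qed.

Lemma dterm_le s sigma j x l : half_space n sigma s -> 0 <= x ->
  Cmod (dterm s j l) * x ^ j <= wt sigma l * (/ INR (fact j) * (sum_lt n l * x) ^ j).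
Proof.
intros Hs Hx; unfold dterm, wt.
destruct (classic (U l)) as [Hl|Hl].
  assert (Hd := in_orthant_deg n l (HU l Hl)).
  rewrite !Cmod_mult, Cmod_pow, Cmod_opp, !Cmod_R, (Rabs_pos_eq (sum_lt n l)),
    (Rabs_pos_eq (/ INR (fact j))) by (auto; apply fact_inv_ge0).
  rewrite Rpow_mult_distr.
  rewrite !Rmult_assoc; apply Rmult_le_compat_l; [apply Cmod_ge_0|].
  apply Rmult_le_compat_r.
    repeat apply Rmult_le_pos; try apply pow_le; auto; apply fact_inv_ge0.
  apply Cmod_expterm_le; auto; apply HU, Hl.
rewrite (HB l Hl), !Cmult_0_l, Cmod_0; lra.
Qed.

Lemma wt_exp sigma x l : wt sigma l * exp (sum_lt n l * x) = wt (sigma - x) l.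
Proof. unfold wt; rewrite Rmult_assoc, <- exp_plus; f_equal; f_equal; ring. Qed.

Lemma wt_exp_bounded sigma x l : 0 <= x ->
  bounded_sums (fun j => wt sigma l * (/ INR (fact j) * (sum_lt n l * x) ^ j)) (wt (sigma - x) l).
Proof.
intros Hx; destruct (classic (U l)) as [Hl|Hl].
  assert (Hd := in_orthant_deg n l (HU l Hl)).
  rewrite <- wt_exp; apply bounded_sums_scal; [apply wt_ge0|].
  apply bounded_sums_exp, Rmult_le_pos; auto.
intros L HL; unfold wt; rewrite (HB l Hl), Cmod_0, Rmult_0_l.
rewrite (rsum_scal 0); lra.
Qed.

(** The double series over frequencies and orders converges absolutely: summing the orders of one
    term at radius [x] costs exactly the passage from [sigma] to [sigma - x]. Orders first, it is
    the series at the shifted point; frequencies first, it is a power series in [z]. *)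
Lemma exchange sigma x m s z (D : nat -> C) : 0 <= x -> bounded_sums (wt (sigma - x)) m ->
  half_space n sigma s -> Cmod z <= x -> (forall j, sums_to (dterm s j) (D j)) ->
  exists Z, sums_to (fun l => B l * expterm n l (shift s z))%C Z /\
    sums_to (fun j => D j * z ^ j)%C Z.
Proof.
intros Hx Hm Hs Hz HD.
pose (f := fun p : vec * nat => (dterm s (snd p) (fst p) * z ^ snd p)%C).
destruct (sums_to_exists f (fun p => wt sigma (fst p) *
  (/ INR (fact (snd p)) * (sum_lt n (fst p) * x) ^ snd p)) m) as [Z HZ].
- intros [l j]; unfold f; simpl; eapply Rle_trans; [|apply (dterm_le s sigma j x l Hs Hx)].
  rewrite Cmod_mult, Cmod_pow; apply Rmult_le_compat_l; [apply Cmod_ge_0|].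
  apply pow_incr; split; [apply Cmod_ge_0|auto].
- apply bounded_sums_iterated with (wt (sigma - x)); [|exact Hm].
  intros l; exact (wt_exp_bounded sigma x l Hx).
- exists Z; split.
    apply (sums_to_iterated f); [exact HZ|]; intros l; unfold f; simpl.
    rewrite expterm_shift, Cmult_assoc.
    apply sums_to_ext with (2 := sums_to_scal (B l * expterm n l s) _ _ (sums_to_exp _)).
    intros j; unfold dterm.
    replace (- (RtoC (sum_lt n l) * z))%C with ((- RtoC (sum_lt n l)) * z)%C by ring.
    rewrite Cpow_mult; ring.
  apply (sums_to_iterated (fun p : nat * vec => f (snd p, fst p))); [apply sums_to_swap, HZ|].
  intros j; unfold f; simpl; rewrite Cmult_comm.
  apply sums_to_ext with (2 := sums_to_scal (z ^ j) _ _ (HD j)); intros l; apply Cmult_comm.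
Qed.

(** Differentiation costs [y] in the abscissa, since [deg ^ j / j!] is at most
    [e^(y deg) / y ^ j]. *)
Lemma dterm_sum sigma y m s : 0 < y -> bounded_sums (wt sigma) m -> half_space n (sigma + y) s ->
  forall j, (forall l, Cmod (dterm s j l) <= / y ^ j * wt sigma l) /\
    exists D, sums_to (dterm s j) D /\ Cmod D <= / y ^ j * m.
Proof.
intros Hy Hm Hs j.
assert (P : 0 < y ^ j) by (apply pow_lt, Hy).
assert (Q : 0 <= / y ^ j) by (apply Rinv_ge0, P).
assert (K : forall l, Cmod (dterm s j l) <= / y ^ j * wt sigma l).
  intros l; apply (Rmult_le_reg_r (y ^ j)); auto.
  eapply Rle_trans; [apply (dterm_le s (sigma + y) j y l Hs); lra|].
  eapply Rle_trans; [apply (bounded_sums_term _ _ j (wt_exp_bounded (sigma + y) y l ltac:(lra)))|].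
  replace (sigma + y - y) with sigma by ring; right; field; lra.
split; auto.
assert (Hb : bounded_sums (fun l => / y ^ j * wt sigma l) (/ y ^ j * m)) by
  (apply bounded_sums_scal; auto).
destruct (sums_to_exists _ _ _ K Hb) as [D HD]; exists D; split; auto.
apply (sums_to_le _ _ _ _ K Hb HD).
Qed.

(** Termwise differentiation, justified by uniqueness: on the circle of radius [y / 2] the power
    series with the termwise coefficients and the one supplied for [Psi] have the same values. *)
Lemma taylor_coefficients sigma y s d : 0 <= sigma -> 0 < y <= kappa -> represents sigma ->
  half_space n (sigma + y) s ->
  (forall j, Cmod (d j) <= M / kappa ^ j) ->
  (forall z, Cmod z < kappa -> sums_to (fun j => d j * z ^ j)%C (Psi (shift s z))) ->
  forall j, sums_to (dterm s j) (d j).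
Proof.
intros Hsig Hy [[m Hm] Hr] Hs Hd1 Hd2.
assert (HM0 : 0 <= M).
  generalize (Hd1 0%nat) (Cmod_ge_0 (d 0%nat)); simpl; lra.
assert (Hm0 := bounded_sums_ge0 _ _ Hm).
assert (HDex : forall j, exists D, sums_to (dterm s j) D /\ Cmod D <= / y ^ j * m).
  intros j; apply (dterm_sum sigma y m s); auto; lra.
destruct (function_choice _ HDex) as [D HD].
assert (Z : forall j, (D j - d j)%C = 0).
  (* Both sequences are at most a constant over [y ^ j], as [y <= kappa]; radius [y / 2] then leaves
     the ratio [1 / 2]. *)
  apply (power_series_zero _ (fun j => (m + M) * (/ 2) ^ j) ((m + M) * / (1 - / 2)) (y / 2)).
  - lra.
  - intros j.
    assert (P : 0 < y ^ j) by (apply pow_lt; lra).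
    assert (P' : 0 < kappa ^ j) by (apply pow_lt; lra).
    unfold Rdiv; rewrite Rpow_mult_distr, <- Rmult_assoc.
    apply Rmult_le_compat_r; [apply pow_le; lra|].
    apply Rle_trans with ((/ y ^ j * m + M / kappa ^ j) * y ^ j).
      apply Rmult_le_compat_r; [lra|].
      apply Cmod_minus_le.
      apply Rplus_le_compat; [apply HD|apply Hd1].
    rewrite Rmult_plus_distr_r; apply Rplus_le_compat; [right; field; lra|].
    rewrite <- (Rmult_1_r M) at 2; unfold Rdiv; rewrite Rmult_assoc; apply Rmult_le_compat_l; auto.
    apply (Rmult_le_reg_l (kappa ^ j)); auto.
    rewrite <- Rmult_assoc, Rinv_r, Rmult_1_l, Rmult_1_r by lra.
    apply pow_incr; lra.
  - apply bounded_sums_scal; [lra|]; apply bounded_sums_geom; lra.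
  - intros z Hz.
    destruct (exchange (sigma + y) y m s z D) as [Z [Z1 Z2]]; auto; try lra.
      replace (sigma + y - y) with sigma by ring; auto.
      intros j; apply HD.
    assert (Hsz : half_space n sigma (shift s z)).
      replace sigma with (sigma + y + - y) by ring; apply half_space_shift; auto.
      apply Cmod_fst_ge; lra.
    assert (EZ := sums_to_unique _ _ _ Z1 (Hr _ Hsz)); subst Z.
    replace (RtoC 0) with (Psi (shift s z) + (-1) * Psi (shift s z))%C by ring.
    apply sums_to_ext with (fun j => D j * z ^ j + (-1) * (d j * z ^ j))%C.
      intros j; ring.
    apply sums_to_plus; [exact Z2|]; apply sums_to_scal, Hd2; lra.
intros j; replace (d j) with (D j); [apply HD|].
replace (D j) with (D j - d j + d j)%C by ring; rewrite Z; ring.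
Qed.

(** Bohr's bound for the [j]-th Taylor coefficient gives [wt (sigma + y) l * deg ^ j / j! <= M /
    kappa ^ j]. Multiplied by [(3 * kappa / 4) ^ j] and summed over [j], the left side becomes an
    exponential and the right side [M / (1 - 3 / 4) = 4 * M]. The bound is independent of
    [sigma]. *)
Lemma coefficient_decay sigma y : 0 <= sigma -> 0 < y <= kappa -> represents sigma ->
  forall l, wt (sigma + y - 3 * kappa / 4) l <= 4 * M.
Proof.
intros Hsig Hy Hr l.
assert (HM0 : 0 <= M).
  destruct (HPsi (fun _ => RtoC 0)) as [d [Hd _]]; [intros i _; simpl; lra|].
  generalize (Hd 0%nat) (Cmod_ge_0 (d 0%nat)); simpl; lra.
destruct Hr as [[m Hm] Hr]; assert (Hr' : represents sigma) by (split; [exists m|]; auto).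
destruct (classic (U l)) as [Hl|Hl].
2: { unfold wt; rewrite (HB l Hl), Cmod_0; lra. }
assert (Hdl := in_orthant_deg n l (HU l Hl)).
pose (real_s := fun t : vec => (fun i => (sigma + y, t i)) : cvec).
assert (Hreal : forall t, half_space n (sigma + y) (real_s t)) by (intros t i _; simpl; lra).
assert (K : forall j, wt (sigma + y) l * (/ INR (fact j) * sum_lt n l ^ j) <= M / kappa ^ j).
  intros j; assert (Q : 0 <= / y ^ j) by (apply Rinv_ge0, pow_lt; lra).
  set (B' := fun l => (B l * RtoC (exp (- ((sigma + y) * sum_lt n l))) *
    (RtoC (/ INR (fact j)) * (- RtoC (sum_lt n l)) ^ j))%C).
  assert (E : forall t l, dterm (real_s t) j l = (B' l * vchar n l t)%C).
    intros t l'; unfold dterm, B', real_s; rewrite expterm_vertical; ring.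
  assert (EB : forall l t, Cmod (B' l) = Cmod (dterm (real_s t) j l)).
    intros l' t; rewrite E, Cmod_mult; unfold vchar; rewrite Cmod_cis; ring.
  replace (wt (sigma + y) l * (/ INR (fact j) * sum_lt n l ^ j)) with (Cmod (B' l)).
    apply (coefficient_bound vadd vzero (vchar n)) with
      (B := B') (N := fun l => / y ^ j * wt sigma l) (Mb := / y ^ j * m).
    - apply vchar_vadd.
    - intros; apply Cmod_cis.
    - intros l'; rewrite (EB l' vzero).
      apply (dterm_sum sigma y m); auto; lra.
    - apply bounded_sums_scal; auto.
    - intros l' Hl' HB'; apply vchar_separates; auto; [|apply HU, Hl].
      apply HU, NNPP; intros Hn; apply HB'; unfold B'; rewrite HB by auto; ring.
    - intros t S HS.
      destruct (HPsi (real_s t)) as [d [Hd1 Hd2]].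
        intros i Hi; specialize (Hreal t i Hi); lra.
      assert (T := taylor_coefficients sigma y (real_s t) d Hsig Hy Hr' (Hreal t) Hd1 Hd2 j).
      replace S with (d j); [apply Hd1|].
      apply (sums_to_unique _ _ _ T), sums_to_ext with (2 := HS).
      intros l'; symmetry; apply E.
  unfold B', wt; rewrite !Cmod_mult, Cmod_pow, Cmod_opp, !Cmod_R, !Rabs_pos_eq; auto.
    apply fact_inv_ge0.
  apply exp_ge0.
rewrite <- wt_exp; set (b := wt (sigma + y) l) in *.
destruct (wt_ge0 (sigma + y) l) as [Hb|Hb]; fold b in Hb; [|rewrite <- Hb; lra].
apply (Rmult_le_reg_l (/ b)); [apply Rinv_0_lt_compat, Hb|].
rewrite <- Rmult_assoc, Rinv_l, Rmult_1_l by lra.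
apply exp_le_partial; intros k.
apply (Rmult_le_reg_l b); auto.
rewrite <- Rmult_assoc, Rinv_r, Rmult_1_l, <- rsum_scal by lra.
apply Rle_trans with (rsum (fun j => M * (3 / 4) ^ j) (seq 0 k)).
  apply rsum_le; intros j _.
  assert (P : 0 < kappa ^ j) by (apply pow_lt, Hkappa).
  replace (sum_lt n l * (3 * kappa / 4)) with (sum_lt n l * (kappa * (3 / 4))) by field.
  rewrite !Rpow_mult_distr.
  replace (b * (/ INR (fact j) * (sum_lt n l ^ j * (kappa ^ j * (3 / 4) ^ j)))) with
    (b * (/ INR (fact j) * sum_lt n l ^ j) * kappa ^ j * (3 / 4) ^ j) by ring.
  apply Rmult_le_compat_r; [apply pow_le; lra|].
  apply Rle_trans with (M / kappa ^ j * kappa ^ j); [|right; field; lra].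
  apply Rmult_le_compat_r; [lra|apply K].
replace (4 * M) with (M * / (1 - 3 / 4)) by field.
apply (bounded_sums_scal M (fun j => (3 / 4) ^ j)); auto; [|apply seq_NoDup].
apply bounded_sums_geom; lra.
Qed.

(** Decay of single coefficients becomes summability after giving away [y] to [Usum]. With
    [y = kappa / 8] the new abscissa is [sigma + y - 3 * kappa / 4 + y = sigma - kappa / 2]. The
    value at [s] is read off the Taylor disc about [s + x], whose radius [kappa] exceeds
    [x = 5 * kappa / 8]. *)
Lemma hop sigma : 0 <= sigma -> represents sigma -> represents (sigma - kappa / 2).
Proof.
intros Hsig Hr; assert (Hr' := Hr).
set (y := kappa / 8); assert (Hy : 0 < y <= kappa) by (unfold y; lra).
assert (Hdec := coefficient_decay sigma y Hsig Hy Hr).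
destruct (Usum y) as [u Hu]; [lra|].
assert (Hb : bounded_sums (wt (sigma - kappa / 2)) (4 * M * u)).
  assert (HM0 : 0 <= 4 * M) by (eapply Rle_trans; [apply wt_ge0|apply (Hdec vzero)]).
  apply bounded_sums_le with (fun l => 4 * M * (if pb (U l) then exp (- (y * sum_lt n l)) else 0)).
    intros l; destruct (classic (U l)) as [Hl|Hl].
      rewrite pbT by auto.
      replace (sigma - kappa / 2) with (sigma + y - 3 * kappa / 4 - - y) by (unfold y; field).
      rewrite <- wt_exp.
      replace (sum_lt n l * - y) with (- (y * sum_lt n l)) by ring.
      apply Rmult_le_compat_r; [apply exp_ge0|apply Hdec].
    rewrite pbF by auto; unfold wt; rewrite (HB l Hl), Cmod_0; lra.
  apply bounded_sums_scal; auto.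
split; [exists (4 * M * u); exact Hb|].
intros s Hs.
set (x := kappa / 2 + y); set (s' := shift s (RtoC x)).
assert (Hs' : half_space n (sigma + y) s').
  replace (sigma + y) with (sigma - kappa / 2 + x) by (unfold x; ring).
  apply half_space_shift; auto; simpl; lra.
assert (Hs0 : half_space n 0 s') by (intros i Hi; specialize (Hs' i Hi); lra).
destruct (HPsi s' Hs0) as [d [Hd1 Hd2]].
assert (T := taylor_coefficients sigma y s' d Hsig Hy Hr' Hs' Hd1 Hd2).
assert (Hx : Cmod (RtoC (- x)) = x).
  rewrite Cmod_R, Rabs_left1; unfold x, y; lra.
destruct (exchange (sigma + y) x (4 * M * u) s' (RtoC (- x)) d) as [Z [Z1 Z2]]; auto; try lra.
- unfold x, y; lra.
- replace (sigma + y - x) with (sigma - kappa / 2) by (unfold x; ring); exact Hb.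
- assert (Es : shift s' (RtoC (- x)) = s).
    apply functional_extensionality; intros i; unfold s', shift; rewrite RtoC_opp.
    change (s i + RtoC x + - RtoC x = s i)%C; ring.
  rewrite Es in Z1; replace (Psi s) with Z; auto.
  apply (sums_to_unique _ _ _ Z2).
  replace (Psi s) with (Psi (shift s' (RtoC (- x)))) by (rewrite Es; reflexivity); apply Hd2.
  rewrite Hx; unfold x, y; lra.
Qed.

Lemma represents_le sigma sigma' : sigma <= sigma' -> represents sigma -> represents sigma'.
Proof.
intros Hs [[m Hm] Hr]; split.
  exists m; apply bounded_sums_le with (2 := Hm); intros l; unfold wt.
  destruct (classic (U l)) as [Hl|Hl]; [|rewrite (HB l Hl), Cmod_0; lra].
  apply Rmult_le_compat_l; [apply Cmod_ge_0|].
  apply exp_le, Ropp_le_contravar, Rmult_le_compat_r; auto.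
  apply in_orthant_deg, HU, Hl.
intros s Hs'; apply Hr; intros i Hi; specialize (Hs' i Hi); lra.
Qed.

(** Hops have a fixed length, so finitely many reach [0]. The cap at [0] keeps the start of each hop
    where Taylor expansions of [Psi] are supplied; a last hop from [0] crosses the axis. *)
Lemma represents_left sigma : represents sigma -> represents (- (kappa / 2)).
Proof.
intros Hr.
assert (K : forall k, represents (Rmax 0 (sigma - INR k * (kappa / 2)))).
  induction k as [|k IH].
    apply represents_le with (2 := Hr); simpl; rewrite Rmult_0_l, Rminus_0_r; apply Rmax_r.
  apply (hop _ (Rmax_l _ _)) in IH; apply represents_le with (2 := IH).
  rewrite S_INR; unfold Rmax; destruct (Rle_dec _ _), (Rle_dec _ _); lra.
destruct (INR_unbounded (sigma / (kappa / 2))) as [k Hk].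
specialize (K k); rewrite Rmax_left in K.
  apply (hop 0 (Rle_refl 0)) in K; replace (- (kappa / 2)) with (0 - kappa / 2) by ring; exact K.
apply (Rmult_lt_compat_r (kappa / 2)) in Hk; [|lra].
replace (sigma / (kappa / 2) * (kappa / 2)) with sigma in Hk by (field; lra); lra.
Qed.

End Hop.

(** * Composition with exponential polynomials *)

(** Meant for a parametrisation that is onto but possibly not injective, such as the coordinates of
    an element of [span]: one preimage for each element is enough for an upper bound. *)
Lemma bounded_sums_section {T V : Type} (pi : T -> V) (N' : T -> R) (N : V -> R) M :
  (forall v, N v <= 0 \/ exists t, pi t = v /\ N v <= N' t) ->
  bounded_sums N' M -> bounded_sums N M.
Proof.
intros H HM.
assert (K : forall l, NoDup l -> exists l', NoDup l' /\ (forall t, In t l' -> In (pi t) l) /\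
  rsum N l <= rsum N' l').
  induction l as [|v l IH]; intros Hl.
    exists nil; split; [constructor|]; split; [simpl; tauto|unfold rsum; simpl; lra].
  inversion Hl; subst; destruct (IH H3) as [l' [A [B D]]].
  rewrite rsum_cons; destruct (H v) as [E|[t [Et E]]].
    exists l'; split; auto; split; [intros; right; auto|lra].
  exists (t :: l'); split; [|split].
  - constructor; auto; intros Ht; apply H2; rewrite <- Et; auto.
  - intros t' [->|Ht']; [left; auto|right; auto].
  - rewrite rsum_cons; lra.
intros l Hl; destruct (K l Hl) as [l' [A [_ B]]]; specialize (HM l' A); lra.
Qed.

(** * Semigroups generated by finitely many frequencies *)

Fixpoint span (G : list vec) : vec -> Prop :=
  match G with
  | nil => fun v => v = vzero
  | g :: G' => fun v => exists k u, span G' u /\ v = vadd (vscal (INR k) g) u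
  end.

Lemma vadd_0_l v : vadd vzero v = v.
Proof. apply functional_extensionality; intros i; unfold vadd, vzero; ring. Qed.

Lemma vadd_comm u v : vadd u v = vadd v u.
Proof. apply functional_extensionality; intros i; unfold vadd; ring. Qed.

Lemma vadd_assoc u v w : vadd u (vadd v w) = vadd (vadd u v) w.
Proof. apply functional_extensionality; intros i; unfold vadd; ring. Qed.

Lemma vscal_0 v : vscal (INR 0) v = vzero.
Proof. apply functional_extensionality; intros i; unfold vscal, vzero; simpl; ring. Qed.

Lemma vscal_S k v : vscal (INR (S k)) v = vadd v (vscal (INR k) v).
Proof. apply functional_extensionality; intros i; unfold vscal, vadd; rewrite S_INR; ring. Qed.

Lemma span_zero G : span G vzero.
Proof.
induction G as [|g G IH]; [reflexivity|].
exists 0%nat, vzero; split; auto; rewrite vscal_0, vadd_0_l; auto.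
Qed.

Lemma span_add G g v : In g G -> span G v -> span G (vadd g v).
Proof.
revert v; induction G as [|h G IH]; intros v Hg; [destruct Hg|].
intros [k [u [Hu ->]]]; destruct Hg as [->|Hg].
  exists (S k), u; split; auto; rewrite vscal_S, vadd_assoc; auto.
exists k, (vadd g u); split; auto.
rewrite !vadd_assoc, (vadd_comm g); auto.
Qed.

Lemma deg_vadd n u v : sum_lt n (vadd u v) = sum_lt n u + sum_lt n v.
Proof. apply sum_lt_plus. Qed.

Lemma deg_vscal n c v : sum_lt n (vscal c v) = c * sum_lt n v.
Proof. apply sum_lt_scal. Qed.

Lemma deg_vzero n : sum_lt n vzero = 0.
Proof. apply sum_lt_0. Qed.

Lemma span_in_orthant n G : (forall g, In g G -> in_orthant n g) ->
  forall v, span G v -> in_orthant n v.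
Proof.
induction G as [|g G IH]; intros HG v Hv.
  rewrite Hv; split; intros; unfold vzero; lra.
destruct Hv as [k [u [Hu ->]]].
destruct (IH (fun h Hh => HG h (or_intror Hh)) u Hu) as [A B].
destruct (HG g (or_introl eq_refl)) as [A' B'].
split; intros i Hi; unfold vadd, vscal.
  apply Rplus_le_le_0_compat; auto; apply Rmult_le_pos; auto; apply pos_INR.
rewrite B, B' by auto; ring.
Qed.

Lemma bounded_sums_ext {T} (N N' : T -> R) M :
  (forall t, N t = N' t) -> bounded_sums N M -> bounded_sums N' M.
Proof. intros H; apply bounded_sums_le; intros t; rewrite H; lra. Qed.

Lemma exp_mult_INR k x : exp (INR k * x) = exp x ^ k.
Proof.
induction k as [|k IH]; [simpl; rewrite Rmult_0_l; apply exp_0|].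
rewrite S_INR; replace ((INR k + 1) * x) with (x + INR k * x) by ring.
rewrite exp_plus, IH; reflexivity.
Qed.

(** A product of geometric series, one for each generator [g]; the ratio [e^(- y deg g)] is below
    [1] because the degree is positive. *)
Lemma bounded_sums_span n G y : 0 < y ->
  (forall g, In g G -> 0 < sum_lt n g) ->
  exists m, bounded_sums (fun l => if pb (span G l) then exp (- (y * sum_lt n l)) else 0) m.
Proof.
intros Hy; induction G as [|g G IH]; intros HG.
  eexists; apply (bounded_sums_finite _ [vzero]).
  - apply NoDup_single.
  - intros v; destruct (pb _); [apply exp_ge0|lra].
  - intros v Hv; rewrite pbF; auto; intros E; apply Hv; simpl in *; auto.
destruct IH as [m Hm]; [intros h Hh; apply HG; simpl; auto|].
assert (Hg : 0 < sum_lt n g) by (apply HG; simpl; auto).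
set (q := exp (- (y * sum_lt n g))).
assert (Hq : 0 <= q < 1).
  split; [apply exp_ge0|]; unfold q; rewrite <- exp_0; apply exp_increasing.
  assert (0 < y * sum_lt n g) by (apply Rmult_lt_0_compat; auto); lra.
set (N := fun l => if pb (span G l) then exp (- (y * sum_lt n l)) else 0) in *.
exists (m * / (1 - q)).
apply (bounded_sums_section (fun p : nat * vec => vadd (vscal (INR (fst p)) g) (snd p))
  (fun p => q ^ fst p * N (snd p))).
  intros v; destruct (classic (span (g :: G) v)) as [Hv|Hv]; [right|left; rewrite pbF; auto; lra].
  rewrite pbT by auto; destruct Hv as [k [u [Hu ->]]]; exists (k, u); split; auto.
  simpl; unfold N, q; rewrite pbT by auto.
  rewrite <- exp_mult_INR, <- exp_plus, deg_vadd, deg_vscal; right; f_equal; ring.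
apply bounded_sums_iterated with (fun k => m * q ^ k).
  intros k; simpl; rewrite (Rmult_comm m); apply bounded_sums_scal; auto.
  apply pow_le; lra.
apply bounded_sums_scal; [apply (bounded_sums_ge0 _ _ Hm)|apply bounded_sums_geom, Hq].
Qed.

Definition wsum (l : list vec) : vec := fold_right vadd vzero l.

Lemma cprod_expterm n (al : vec -> C) s l :
  cprod (fun v => al v * expterm n v s)%C l = (cprod al l * expterm n (wsum l) s)%C.
Proof.
induction l as [|v l IH].
  unfold cprod, wsum; simpl; rewrite expterm_zero; ring.
change ((al v * expterm n v s) * cprod (fun v => al v * expterm n v s) l =
  (al v * cprod al l) * expterm n (vadd v (wsum l)) s)%C.
rewrite IH, expterm_vadd; ring.
Qed.

Lemma rprod_exp n (A : vec -> R) y l :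
  rprod (fun v => A v * exp (- (y * sum_lt n v))) l = rprod A l * exp (- (y * sum_lt n (wsum l))).
Proof.
induction l as [|v l IH].
  unfold rprod, wsum; simpl; rewrite deg_vzero, Rmult_0_r, Ropp_0, exp_0; ring.
change ((A v * exp (- (y * sum_lt n v))) * rprod (fun v => A v * exp (- (y * sum_lt n v))) l =
  (A v * rprod A l) * exp (- (y * sum_lt n (vadd v (wsum l))))).
rewrite IH, deg_vadd.
replace (- (y * (sum_lt n v + sum_lt n (wsum l)))) with
  (- (y * sum_lt n v) + - (y * sum_lt n (wsum l))) by ring.
rewrite exp_plus; ring.
Qed.

(** Positive degrees drive every exponential to [0]; an explicit threshold comes from
    [1 + x <= exp x]. *)
Lemma small_exp_sum (n : nat) (G : list vec) (A : vec -> R) :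
  (forall g, In g G -> 0 < sum_lt n g) -> (forall g, 0 <= A g) -> forall eps, 0 < eps ->
  exists y, 0 <= y /\ forall y', y <= y' ->
    rsum (fun g => A g * exp (- (y' * sum_lt n g))) G <= eps.
Proof.
intros HG HA; induction G as [|g G IH]; intros eps Heps.
  exists 0; split; [lra|]; intros y' _; unfold rsum; simpl; lra.
destruct (IH (fun h Hh => HG h (or_intror Hh)) (eps / 2)) as [y1 [H1 K1]]; [lra|].
assert (Hg := HG g (or_introl eq_refl)); specialize (HA g).
set (y2 := A g / (eps / 2) / sum_lt n g).
assert (H2 : 0 <= y2).
  unfold y2, Rdiv; repeat apply Rmult_le_pos; auto; apply Rinv_ge0; lra.
exists (y1 + y2); split; [lra|]; intros y' Hy'; rewrite rsum_cons.
replace eps with (eps / 2 + eps / 2) by lra.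
apply Rplus_le_compat; [|apply K1; lra].
rewrite exp_Ropp; set (x := y' * sum_lt n g).
assert (Hx : A g / (eps / 2) <= x).
  replace (A g / (eps / 2)) with (y2 * sum_lt n g) by (unfold y2; field; lra).
  apply Rmult_le_compat_r; lra.
assert (Hex : A g / (eps / 2) <= exp x).
  destruct (Req_dec x 0) as [E|E]; [rewrite E in *; rewrite exp_0; lra|].
  assert (K := exp_ineq1 x E); lra.
assert (P := exp_pos x).
apply (Rmult_le_reg_r (exp x)); auto.
rewrite Rmult_assoc, Rinv_l, Rmult_1_r by lra.
apply (Rmult_le_compat_l (eps / 2)) in Hex; [|lra].
replace (eps / 2 * (A g / (eps / 2))) with (A g) in Hex by (field; lra); exact Hex.
Qed.

Lemma cprod_eq0 {T} (al : T -> C) l t : In t l -> al t = 0 -> cprod al l = 0.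
Proof.
intros Ht E; induction l as [|v l IH]; [destruct Ht|].
change (al v * cprod al l = 0)%C; destruct Ht as [->|Ht].
  rewrite E; ring.
rewrite IH by auto; ring.
Qed.

Lemma span_wsum G l : (forall v, In v l -> In v G) -> span G (wsum l).
Proof.
induction l as [|v l IH]; intros H; [apply span_zero|].
apply span_add; [apply H; simpl; auto|]; apply IH; intros; apply H; simpl; auto.
Qed.

Section Composition.
Variables (n : nat) (G : list vec) (al : vec -> C) (a0 : C) (f : C -> C) (eta R0 M : R).
Hypothesis HG : NoDup G.
Hypothesis Gorth : forall g, In g G -> in_orthant n g.
Hypothesis Gdeg : forall g, In g G -> 0 < sum_lt n g.
Hypothesis Heta : 0 < eta.
Hypothesis HR0 : 0 < R0.

Definition exp_poly (s : cvec) : C := (a0 + csum (fun g => al g * expterm n g s) G)%C.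

Hypothesis Hf : forall s, half_space n (- eta) s ->
  cdiff f (exp_poly s) /\ Cmod (f (exp_poly s)) <= M.
Hypothesis Hf0 : forall z, Cmod (z - a0) < R0 -> cdiff f z /\ Cmod (f z) <= M.

(** Zero off [G], so that words over the whole type can be used in place of words over [G]. *)
Let al' (g : vec) : C := if pb (In g G) then al g else 0.

(** A diagonal disc of radius [eta] stays in [Re s >= - eta] for every starting point, which is what
    gives the hops a common length. *)
Lemma local_power_series s : half_space n 0 s -> exists d : nat -> C,
  (forall j, Cmod (d j) <= 2 * M / (eta / 2) ^ j) /\
  forall z, Cmod z < eta / 2 -> sums_to (fun j => d j * z ^ j)%C (f (exp_poly (shift s z))).
Proof.
intros Hs.
assert (Hd : forall z, Cmod (z - 0) < eta -> half_space n (- eta) (shift s z)).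
  intros z Hz; replace (z - 0)%C with z in Hz by ring.
  replace (- eta) with (0 + - eta) by ring; apply half_space_shift; auto.
  apply Cmod_fst_ge; lra.
destruct (power_series_expansion (fun z => f (exp_poly (shift s z))) 0 eta (eta / 2) M) as
  [d [Hd1 Hd2]]; try lra.
- intros z Hz; apply (cdiff_comp f (fun z => exp_poly (shift s z))); [|apply Hf, Hd, Hz].
  unfold exp_poly; apply cdiff_plus; [apply cdiff_const|].
  apply (cdiff_csum (fun g z => al g * expterm n g (shift s z))%C); intros g _.
  replace (fun z => al g * expterm n g (shift s z))%C with
    (fun z => (al g * expterm n g s) * cexp (0 + (- RtoC (sum_lt n g)) * z))%C.
    apply cdiff_scal, (cdiff_comp cexp); [apply cdiff_linear|apply cdiff_cexp].
  apply functional_extensionality; intros x; rewrite expterm_shift.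
  replace (0 + - RtoC (sum_lt n g) * x)%C with (- (RtoC (sum_lt n g) * x))%C by ring; ring.
- intros z Hz; apply Hf, Hd, Hz.
- exists d; split; auto; intros z Hz; specialize (Hd2 z Hz); rewrite Cplus_0_l in Hd2; exact Hd2.
Qed.

(** The exponentials are inserted into the power series of [f] at [a0]. Each power is a sum over
    words, and words of equal total frequency [wsum] are then collected. *)
Lemma initial_expansion : exists (B : vec -> C) (sigma m : R),
  (forall l, ~ span G l -> B l = 0) /\
  bounded_sums (fun l => Cmod (B l) * exp (- (sigma * sum_lt n l))) m /\
  forall s, half_space n sigma s -> sums_to (fun l => B l * expterm n l s)%C (f (exp_poly s)).
Proof.
set (rho := R0 / 2).
destruct (power_series_expansion f a0 R0 rho M) as [ga [Hga1 Hga2]].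
  unfold rho; lra. intros z Hz; apply Hf0, Hz. intros z Hz; apply Hf0, Hz.
assert (HM : 0 <= M).
  eapply Rle_trans; [apply Cmod_ge_0|apply (Hf0 a0)].
  replace (a0 - a0)%C with (RtoC 0) by ring; rewrite Cmod_0; auto.
assert (Hrho : 0 < rho) by (unfold rho; lra).
(* At this abscissa the exponentials sum to at most half of [rho], so that words of length [k]
   contribute at most [2 * M / 2 ^ k]. *)
destruct (small_exp_sum n G (fun g => Cmod (al' g)) Gdeg (fun g => Cmod_ge_0 (al' g)) (rho / 2))
  as [sigma [_ Hsigma]]; [lra|].
specialize (Hsigma sigma (Rle_refl _)).
set (A := fun g => Cmod (al' g) * exp (- (sigma * sum_lt n g))) in *.
assert (HA0 : forall g, 0 <= A g).
  intros g; apply Rmult_le_pos; [apply Cmod_ge_0|apply exp_ge0].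
assert (HA : bounded_sums A (rho / 2)).
  apply (bounded_sums_ub _ _ _ Hsigma), bounded_sums_finite; auto.
  intros g Hg; unfold A, al'; rewrite pbF, Cmod_0 by auto; ring.
set (N := fun l : list vec => 2 * M / rho ^ length l * rprod A l).
assert (HN : bounded_sums N (2 * M * / (1 - / 2))).
  apply (bounded_sums_fibers (@length vec) N (fun k => 2 * M * (/ 2) ^ k)).
    intros k L HL Hk.
    assert (P : 0 < rho ^ k) by (apply pow_lt, Hrho).
    rewrite (rsum_ext N (fun l => 2 * M / rho ^ k * (if pb (length l = k) then rprod A l else 0))).
      rewrite rsum_scal.
      apply Rle_trans with (2 * M / rho ^ k * (rho / 2) ^ k).
        apply Rmult_le_compat_l; [|apply (bounded_sums_words A (rho / 2) k HA0 HA L HL)].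
        apply Rmult_le_pos; [lra|apply Rinv_ge0, P].
      right; unfold Rdiv; rewrite Rpow_mult_distr; field; lra.
    intros l Hl; unfold N; rewrite (Hk l Hl), pbT; auto.
  apply bounded_sums_scal; [lra|apply bounded_sums_geom; lra].
set (g := fun l : list vec => (ga (length l) * cprod al' l)%C).
assert (Hg : forall l, Cmod (g l) * exp (- (sigma * sum_lt n (wsum l))) <= N l).
  intros l; unfold g, N; rewrite Cmod_mult, Rmult_assoc; apply Rmult_le_compat.
  - apply Cmod_ge_0.
  - apply Rmult_le_pos; [apply Cmod_ge_0|apply exp_ge0].
  - apply Hga1.
  - unfold A; rewrite (rprod_exp n (fun v => Cmod (al' v))).
    apply Rmult_le_compat_r; [apply exp_ge0|].
    apply cprod_le; intros; lra.
assert (HBex : forall v, exists b, sums_to (on_fiber wsum v g) b).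
  intros v; apply (sums_to_exists _ (fun l => exp (sigma * sum_lt n v) * N l)
    (exp (sigma * sum_lt n v) * (2 * M * / (1 - / 2)))).
    intros l; unfold on_fiber; destruct (classic (wsum l = v)) as [E|E].
      rewrite pbT by auto; specialize (Hg l); rewrite E in Hg.
      apply (Rmult_le_compat_l (exp (sigma * sum_lt n v))) in Hg; [|apply exp_ge0].
      eapply Rle_trans; [|exact Hg].
      replace (exp (sigma * sum_lt n v) * (Cmod (g l) * exp (- (sigma * sum_lt n v)))) with
        (Cmod (g l) * (exp (sigma * sum_lt n v) * exp (- (sigma * sum_lt n v)))) by ring.
      rewrite <- exp_plus, Rplus_opp_r, exp_0; lra.
    rewrite pbF, Cmod_0 by auto; apply Rmult_le_pos; [apply exp_ge0|].
    eapply Rle_trans; [|apply Hg]; apply Rmult_le_pos; [apply Cmod_ge_0|apply exp_ge0].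
  apply bounded_sums_scal; auto; apply exp_ge0.
destruct (function_choice _ HBex) as [B HB].
exists B, sigma, (2 * M * / (1 - / 2)); split; [|split].
- intros v Hv; apply (sums_to_unique _ _ _ (HB v)).
  apply sums_to_ext with (fun _ : list vec => RtoC 0).
    intros l; unfold on_fiber; destruct (classic (wsum l = v)) as [E|E]; [|rewrite pbF; auto].
    rewrite pbT by auto; unfold g.
    destruct (classic (forall u, In u l -> In u G)) as [K|K].
      exfalso; apply Hv; rewrite <- E; apply span_wsum, K.
    apply not_all_ex_not in K; destruct K as [u K]; apply imply_to_and in K; destruct K as [K1 K2].
    rewrite (cprod_eq0 al' l u K1); [ring|unfold al'; rewrite pbF; auto].
  apply sums_to_0.
- apply (bounded_sums_collapse wsum g B (fun v => exp (- (sigma * sum_lt n v))) N); auto.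
  intros v; apply exp_ge0.
- intros s Hs.
  set (x := csum (fun g => al g * expterm n g s)%C G).
  set (Fs := fun l : list vec => (g l * expterm n (wsum l) s)%C).
  assert (Hal : forall v, Cmod (al' v * expterm n v s) <= A v).
    intros v; unfold A; rewrite Cmod_mult; destruct (classic (In v G)) as [Hv|Hv].
      apply Rmult_le_compat_l; [apply Cmod_ge_0|apply Cmod_expterm_le; auto].
      apply Gorth, Hv.
    unfold al'; rewrite pbF, Cmod_0 by auto; lra.
  assert (Hx : sums_to (fun v => al' v * expterm n v s)%C x).
    replace x with (csum (fun v => al' v * expterm n v s)%C G).
      apply sums_to_finite; auto; intros v Hv; unfold al'; rewrite pbF by auto; ring.
    apply csum_ext; intros v Hv; unfold al'; rewrite pbT; auto.
  assert (EF : forall l, Fs l = (ga (length l) * cprod (fun v => al' v * expterm n v s) l)%C).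
    intros l; unfold Fs, g; rewrite cprod_expterm; ring.
  assert (HFs : forall l, Cmod (Fs l) <= N l).
    intros l; rewrite EF, Cmod_mult; apply Rmult_le_compat; auto using Cmod_ge_0.
    apply cprod_le, Hal.
  destruct (sums_to_exists Fs N _ HFs HN) as [S HS].
  assert (ES : S = f (exp_poly s)).
    unfold exp_poly; fold x; apply (sums_to_unique (fun k => ga k * x ^ k)%C).
      apply (sums_to_collapse (@length vec) Fs); auto; intros k.
      apply sums_to_ext with (fun l => ga k *
        (if pb (length l = k) then cprod (fun v => al' v * expterm n v s) l else 0))%C.
        intros l; unfold on_fiber; destruct (classic (length l = k)) as [E|E].
          rewrite !pbT, EF, E; auto.
        rewrite !pbF by auto; ring.
      apply sums_to_scal, (sums_to_words _ A (rho / 2)); auto.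
    apply Hga2; apply Rle_lt_trans with (rho / 2); [|lra].
    apply (sums_to_le _ A _ _ Hal HA Hx).
  rewrite <- ES; apply (sums_to_collapse wsum Fs); auto; intros v.
  rewrite Cmult_comm.
  apply sums_to_ext with (2 := sums_to_scal (expterm n v s) _ _ (HB v)).
  intros l; unfold on_fiber, Fs; destruct (classic (wsum l = v)) as [E|E].
    rewrite !pbT, E by auto; ring.
  rewrite !pbF by auto; ring.
Qed.

(** Absolute convergence at the negative abscissa [- eta / 4] is the exponential decay sought, with
    [tau = eta / 4]. *)
Theorem composition_expansion : exists (B : vec -> C) (tau m : R),
  0 < tau /\ (forall l, ~ span G l -> B l = 0) /\
  bounded_sums (fun l => Cmod (B l) * exp (tau * sum_lt n l)) m /\
  forall s, half_space n 0 s -> sums_to (fun l => B l * expterm n l s)%C (f (exp_poly s)).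
Proof.
destruct initial_expansion as [B [sigma [m [HB [Hm Hs]]]]].
destruct (represents_left n (span G) (fun s => f (exp_poly s)) (eta / 2) (2 * M) B) with
  (sigma := sigma) as [[m' Hm'] Hs'].
- apply span_in_orthant, Gorth.
- intros y Hy; apply bounded_sums_span; auto.
- lra.
- apply local_power_series.
- auto.
- split; [exists m|]; auto.
- exists B, (eta / 2 / 2), m'; split; [lra|split; [auto|split]].
    apply bounded_sums_ext with (2 := Hm'); intros l; f_equal; f_equal; ring.
  intros s H; apply Hs'; intros i Hi; specialize (H i Hi); lra.
Qed.

End Composition.

(** * Weights *)

Lemma has_sum_sums_to {T} (P : T -> Prop) (f : T -> C) (S : C) :
  has_sum P f S <-> sums_to (fun t => if pb (P t) then f t else 0) S.
Proof.
split; intros H eps Heps; destruct (H eps Heps) as [l0 [H0 K]].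
- exists l0; split; [apply H0|]; intros l Hl Hi.
  rewrite csum_filter; apply K.
    split; [apply NoDup_filter, Hl|].
    apply Forall_forall; intros x; rewrite filter_In, pbP; tauto.
  intros x Hx; rewrite filter_In, pbP; split; auto.
  destruct H0 as [_ H0]; rewrite Forall_forall in H0; auto.
- exists (filter (fun x => pb (P x)) l0); split.
    split; [apply NoDup_filter, H0|].
    apply Forall_forall; intros x; rewrite filter_In, pbP; tauto.
  intros l [Hl Hf] Hi; rewrite Forall_forall in Hf.
  specialize (K (dedup (l ++ l0)) (dedup_NoDup _)).
  rewrite csum_filter in K.
  change (Cmod (csum f l - S) < eps).
  rewrite (csum_same f l (filter (fun x => pb (P x)) (dedup (l ++ l0)))); auto.
  + apply K; intros x Hx; apply dedup_In, in_or_app; auto.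
  + apply NoDup_filter, dedup_NoDup.
  + intros x; rewrite filter_In, pbP, dedup_In, in_app_iff; split; [auto|].
    intros [[Hx|Hx] HP]; auto; apply Hi; rewrite filter_In, pbP; auto.
Qed.

(** [tsum] picks some sum by choice; uniqueness of sums pins it down. *)
Lemma transform_eq r L a s (S : C) :
  sums_to (fun l => if pb (L l) then (a l * expterm r l s)%C else 0) S -> transform r L a s = S.
Proof.
intros H; unfold transform, tsum.
change (fun l : vec => Defs.Cmult (a l) (expterm r l s)) with
  (fun l : vec => Cmult (a l) (expterm r l s)).
destruct (excluded_middle_informative _) as [E|E].
  destruct (constructive_indefinite_description _ E) as [S' HS']; simpl.
  apply has_sum_sums_to in HS'; apply (sums_to_unique _ _ _ HS' H).
exfalso; apply E; exists S; apply has_sum_sums_to, H.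
Qed.

Lemma holomorphic_cdiff f G z : holomorphic_on f G -> G z -> cdiff f z.
Proof.
intros H Hz; destruct (H z Hz) as [d Hd]; exists d; intros eps Heps.
destruct (Hd eps Heps) as [delta [H1 H2]]; exists delta; split; auto; intros h Hh.
destruct (classic (h = 0)) as [->|Hn].
  replace (f (z + 0)%C - f z - d * 0)%C with (RtoC 0) by (rewrite Cplus_0_r; ring).
  rewrite Cmod_0; lra.
assert (Hp := proj1 (Cmod_gt_0 h) Hn).
assert (K : Cmod ((f (z + h)%C - f z) / h - d) < eps) by (apply (H2 h); split; assumption).
replace (f (z + h)%C - f z - d * h)%C with (((f (z + h)%C - f z) / h - d) * h)%C by (field; auto).
rewrite Cmod_mult; apply Rmult_le_compat_r; lra.
Qed.

Lemma L_vscal r L : semigroup_in_orthant r L -> forall v, L v -> forall k, L (vscal (INR k) v).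
Proof.
intros [_ [H0 Hadd]] v Hv; induction k as [|k IH]; [rewrite vscal_0; auto|].
rewrite vscal_S; auto.
Qed.

(** Beyond some index the [k]-th root of the weight is below [e^t], which is the claim with constant
    [1]; the finitely many earlier multiples are absorbed into the constant. *)
Lemma weight_multiples r L w : semigroup_in_orthant r L -> admissible_weight L w ->
  forall v t, L v -> 0 < t ->
  exists K, 1 <= K /\ forall k, w (vscal (INR k) v) <= K * exp (INR k * t).
Proof.
intros HL [W0 [Wpos [Wmul [W1 Wlim]]]] v t Hv Ht.
assert (Hk : forall k, L (vscal (INR k) v)) by (apply (L_vscal r L HL); auto).
assert (Et : 1 < exp t) by (rewrite <- exp_0; apply exp_increasing, Ht).
destruct (Wlim v Hv (exp t - 1)) as [n0 Hn0]; [lra|].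
(* Index [0], for which no [k]-th root makes sense, is among the absorbed ones; it also yields
   [1 <= K0]. *)
set (K0 := rsum (fun k => w (vscal (INR k) v)) (seq 0 (S n0))).
assert (HK0 : forall k, (k < S n0)%nat -> w (vscal (INR k) v) <= K0).
  intros k Hkn; replace (w (vscal (INR k) v)) with (rsum (fun k => w (vscal (INR k) v)) [k]) by
    (unfold rsum; simpl; ring).
  unfold K0; assert (P : forall j, 0 <= (fun k => w (vscal (INR k) v)) j) by
    (intros; apply Rlt_le, Wpos; auto).
  apply rsum_incl; auto; [apply NoDup_single|].
  intros j [<-|[]]; apply in_seq; lia.
assert (HK1 : 1 <= K0).
  specialize (HK0 0%nat ltac:(lia)); rewrite vscal_0, W0 in HK0; auto.
exists K0; split; auto; intros k.
assert (E1 : 1 <= exp (INR k * t)).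
  rewrite <- exp_0; apply exp_le, Rmult_le_pos; [apply pos_INR|lra].
destruct (Nat.lt_ge_cases k (S n0)) as [Hlt|Hge].
  specialize (HK0 k Hlt); rewrite <- (Rmult_1_r (w _)).
  apply Rmult_le_compat; auto; try lra; apply Rlt_le, Wpos; auto.
apply Rle_trans with (exp (INR k * t)).
  assert (Hkp : 0 < INR k) by (apply lt_0_INR; lia).
  specialize (Hn0 k ltac:(lia)); unfold R_dist in Hn0.
  apply (Rle_lt_trans _ _ _ (Rle_abs _)) in Hn0.
  assert (Hn1 : exp (/ INR k * ln (w (vscal (INR k) v))) < exp t) by (unfold Rpower in Hn0; lra).
  apply exp_lt_inv in Hn1.
  rewrite <- (exp_ln (w (vscal (INR k) v))) by (apply Wpos; auto).
  apply exp_le; apply (Rmult_lt_compat_l (INR k)) in Hn1; auto.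
  rewrite <- Rmult_assoc, Rinv_r, Rmult_1_l in Hn1 by lra; lra.
rewrite <- (Rmult_1_l (exp _)) at 1; apply Rmult_le_compat_r; lra.
Qed.

(** Submultiplicativity along the generators. Each generator [g] gets the rate [tau * sum_lt r g],
    so that the exponents add up to [tau] times the degree of the whole element. *)
Lemma weight_span r L w : semigroup_in_orthant r L -> admissible_weight L w ->
  forall G, (forall g, In g G -> L g /\ 0 < sum_lt r g) -> forall tau, 0 < tau ->
  exists K, 1 <= K /\ forall v, span G v -> L v /\ w v <= K * exp (tau * sum_lt r v).
Proof.
intros HL Hw; assert (Hw' := Hw); destruct Hw' as [W0 [Wpos [Wmul [W1 _]]]].
induction G as [|g G IH]; intros HG tau Htau.
  exists 1; split; [lra|]; intros v Hv; simpl in Hv; subst v; split; [apply HL|].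
  rewrite W0, deg_vzero, Rmult_0_r, exp_0; lra.
destruct (IH (fun h Hh => HG h (or_intror Hh)) tau Htau) as [K [HK1 HK]].
destruct (HG g (or_introl eq_refl)) as [Lg dg].
destruct (weight_multiples r L w HL Hw g (tau * sum_lt r g) Lg) as [K' [HK1' HK']].
  apply Rmult_lt_0_compat; auto.
exists (K' * K); split; [nra|].
intros v [k [u [Hu ->]]]; destruct (HK u Hu) as [Lu wu].
assert (Lk := L_vscal r L HL g Lg k); split; [apply HL; auto|].
eapply Rle_trans; [apply Wmul; auto|].
rewrite deg_vadd, deg_vscal.
replace (tau * (INR k * sum_lt r g + sum_lt r u)) with
  (INR k * (tau * sum_lt r g) + tau * sum_lt r u) by ring.
rewrite exp_plus.
replace (K' * K * (exp (INR k * (tau * sum_lt r g)) * exp (tau * sum_lt r u))) with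
  ((K' * exp (INR k * (tau * sum_lt r g))) * (K * exp (tau * sum_lt r u))) by ring.
apply Rmult_le_compat; auto; apply Rlt_le, Wpos; auto.
Qed.

(** A Lebesgue number argument on a square containing [S]. At a point of the closure, [delta]
    controls both a disc inside [G] and, through [/ delta], the size of [f] on it. Off the closure
    [delta] keeps clear of [S], so a point of [S] can only be covered from the closure. *)
Lemma uniform_neighbourhood (G S : C -> Prop) (f : C -> C) (b : R) :
  C_open G -> (forall z, C_closure S z -> G z) -> (forall z, S z -> Cmod z <= b) ->
  (forall z, G z -> cdiff f z) ->
  exists d M, 0 < d /\ forall z y, S y -> Cmod (z - y) < d -> G z /\ Cmod (f z) <= M.
Proof.
intros HG HS Hb Hf.
assert (Hd : forall u v, exists delta : posreal,
  (C_closure S (u, v) -> forall z, Cmod (z - (u, v)) < 4 * delta ->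
     G z /\ Cmod (f z) <= / delta) /\
  (~ C_closure S (u, v) -> forall y, S y -> 2 * delta <= Cmod ((u, v) - y))).
  intros u v; destruct (classic (C_closure S (u, v))) as [Hc|Hc].
    destruct (HG _ (HS _ Hc)) as [e1 [He1 K1]].
    destruct (cdiff_cont f (u, v) (Hf _ (HS _ Hc)) 1 Rlt_0_1) as [e2 [He2 K2]].
    set (k := Cmod (f (u, v)) + 1).
    assert (Hk : 0 < k) by (unfold k; generalize (Cmod_ge_0 (f (u, v))); lra).
    assert (Hp : 0 < Rmin (Rmin (e1 / 4) (e2 / 4)) (/ k)).
      repeat apply Rmin_pos; try lra; apply Rinv_0_lt_compat, Hk.
    exists (mkposreal _ Hp); simpl; split; [intros _ z Hz|tauto].
    assert (A1 := Rmin_l (Rmin (e1 / 4) (e2 / 4)) (/ k)).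
    assert (A2 := Rmin_r (Rmin (e1 / 4) (e2 / 4)) (/ k)).
    assert (A3 := Rmin_l (e1 / 4) (e2 / 4)); assert (A4 := Rmin_r (e1 / 4) (e2 / 4)).
    split; [apply K1; change (Cmod (z - (u, v)) < e1); lra|].
    apply Rle_trans with k.
      specialize (K2 z ltac:(lra)); unfold k.
      replace (f z) with ((f z - f (u, v)) + f (u, v))%C by ring.
      apply Cmod_plus_le; lra.
    rewrite <- (Rinv_inv k) at 1; apply Rinv_le_contravar; auto.
  assert (Hc' := Hc); unfold C_closure in Hc'.
  apply not_all_ex_not in Hc'; destruct Hc' as [e He]; apply imply_to_and in He.
  destruct He as [He Hn].
  assert (Hp : 0 < e / 2) by lra.
  exists (mkposreal _ Hp); simpl; split; [tauto|intros _ y Hy].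
  apply Rnot_lt_le; intros K; apply Hn; exists y; split; auto.
  change (Cmod ((u, v) - y) < e); lra.
destruct (function_choice _ (fun u => function_choice _ (Hd u))) as [gauge Hgauge].
destruct (compactness_value_2d (- b) b (- b) b gauge) as [d Hd'].
assert (Hdp := cond_pos d).
exists d, (/ d); split; auto; intros z y Hy Hz.
assert (B1 := fst_le_Cmod y); assert (B2 := snd_le_Cmod y); specialize (Hb y Hy).
(* [compactness_value_2d] yields its cell under a double negation, so the goal is first turned into
   a contradiction. *)
apply NNPP; intros Hn.
apply (Hd' (fst y) (snd y)).
  apply Rabs_le_between; lra.
  apply Rabs_le_between; lra.
intros [u [v [_ [_ [Du [Dv Dd]]]]]]; apply Hn; clear Hn.
destruct (Hgauge u v) as [K1 K2]; set (delta := gauge u v) in *.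
assert (Dy : Cmod (y - (u, v)) < 2 * delta).
  eapply Rle_lt_trans; [apply Cmod_le_sum|].
  change (Rabs (fst y - u) + Rabs (snd y - v) < 2 * delta); lra.
destruct (classic (C_closure S (u, v))) as [Hc|Hc].
  destruct (K1 Hc z) as [Gz Mz].
    replace (z - (u, v))%C with ((z - y) + (y - (u, v)))%C by ring.
    apply Cmod_plus_lt; assert (P := cond_pos delta); lra.
  split; auto; eapply Rle_trans; [exact Mz|]; apply Rinv_le_contravar; auto.
specialize (K2 Hc y Hy); rewrite Cmod_minus_sym in K2; lra.
Qed.

(** In the right half-plane [atan] supplies the argument; modulus at most [1] makes the real part of
    [s] nonnegative. *)
Lemma log_exists (y : C) : 0 < fst y -> Cmod y <= 1 ->
  exists s : C, 0 <= fst s /\ cexp (- s) = y.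
Proof.
intros Hy H1; destruct y as [p q]; simpl in Hy.
assert (Hm : 0 < Cmod (p, q)).
  eapply Rlt_le_trans; [|apply fst_le_Cmod]; simpl; rewrite Rabs_pos_eq; lra.
exists (- ln (Cmod (p, q)), - atan (q / p)); split.
  simpl; assert (ln (Cmod (p, q)) <= 0); [|lra].
  rewrite <- ln_1; destruct H1 as [H1|H1]; [left; apply ln_increasing; auto|rewrite H1; lra].
unfold cexp, Copp; simpl; rewrite !Ropp_involutive, exp_ln, cos_atan, sin_atan by auto.
assert (E : Cmod (p, q) = p * sqrt (1 + (q / p)²)).
  unfold Cmod; simpl.
  replace (p * (p * 1) + q * (q * 1)) with (p² * (1 + (q / p)²)) by (unfold Rsqr; field; lra).
  rewrite sqrt_mult_alt by apply Rle_0_sqr; rewrite sqrt_Rsqr; lra.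
assert (P : 0 < sqrt (1 + (q / p)²)).
  apply sqrt_lt_R0; generalize (Rle_0_sqr (q / p)); lra.
rewrite E; f_equal; field; lra.
Qed.

Lemma Cmod_expterm_le1 r L v s : semigroup_in_orthant r L -> L v -> Hr_closed r s ->
  Cmod (expterm r v s) <= 1.
Proof.
intros HL Hv Hs; rewrite <- exp_0, <- Ropp_0, <- (Rmult_0_l (sum_lt r v)).
apply Cmod_expterm_le; [apply (proj1 HL _ Hv)|exact Hs].
Qed.

Lemma Cmod_cprod {T} (f : T -> C) l : Cmod (cprod f l) = rprod (fun t => Cmod (f t)) l.
Proof.
induction l as [|t l IH]; [apply Cmod_1|].
change (Cmod (f t * cprod f l) = Cmod (f t) * rprod (fun t => Cmod (f t)) l).
rewrite Cmod_mult, IH; reflexivity.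
Qed.

Lemma rprod_mult {T} (f g : T -> R) l : rprod (fun t => f t * g t) l = rprod f l * rprod g l.
Proof.
induction l as [|t l IH]; [unfold rprod; simpl; ring|].
change (f t * g t * rprod (fun t => f t * g t) l = f t * rprod f l * (g t * rprod g l)).
rewrite IH; ring.
Qed.

Lemma weight_wsum r L w : semigroup_in_orthant r L -> admissible_weight L w ->
  forall l, (forall v, In v l -> L v) -> L (wsum l) /\ w (wsum l) <= rprod w l.
Proof.
intros HL [W0 [Wpos [Wmul [W1 _]]]]; induction l as [|v l IH]; intros H.
  split; [apply HL|]; unfold wsum, rprod; simpl; lra.
destruct IH as [Ll wl]; [intros; apply H; simpl; auto|].
assert (Lv : L v) by (apply H; simpl; auto).
split; [apply HL; auto|].
change (w (vadd v (wsum l)) <= w v * rprod w l).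
eapply Rle_trans; [apply Wmul; auto|]; apply Rmult_le_compat_l; auto.
apply Rlt_le, Wpos, Lv.
Qed.

Lemma L_deg_pos r L v : semigroup_in_orthant r L -> L v -> v <> vzero -> 0 < sum_lt r v.
Proof.
intros [H _] Hv Hn; destruct (H v Hv) as [A B].
destruct (in_orthant_deg r v (conj A B)) as [E|E]; auto; exfalso; apply Hn.
apply functional_extensionality; intros i; unfold vzero.
destruct (Nat.lt_ge_cases i r) as [Hi|Hi]; [|auto].
destruct (Rle_lt_or_eq_dec _ _ (A i Hi)) as [P|P]; auto; exfalso.
assert (K : sum_lt r (fun j => if Nat.eq_dec j i then v i else 0) <= sum_lt r v).
  apply sum_lt_le; intros j Hj; destruct (Nat.eq_dec j i) as [->|]; [lra|auto].
rewrite (sum_lt_single r _ i) in K; auto.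
  destruct (Nat.eq_dec i i); [lra|tauto].
intros j Hj; destruct (Nat.eq_dec j i); [tauto|auto].
Qed.

(** * Substitution of a small element *)

(** The new variable occupies coordinate [r], where all elements of [L] vanish, and [unit_vec r] is
    its frequency. *)
Definition unit_vec (r : nat) : vec := fun i => if Nat.eq_dec i r then 1 else 0.
Definition cut (r : nat) (v : vec) : vec := fun i => if Nat.eq_dec i r then 0 else v i.
Definition extend (r : nat) (s : cvec) (z : C) : cvec := fun i => if Nat.eq_dec i r then z else s i.

Lemma cut_id r v : v r = 0 -> cut r v = v.
Proof.
intros H; apply functional_extensionality; intros i; unfold cut.
destruct (Nat.eq_dec i r) as [->|]; auto.
Qed.

Lemma cut_unit r k u : u r = 0 -> cut r (vadd (vscal k (unit_vec r)) u) = u.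
Proof.
intros H; apply functional_extensionality; intros i; unfold cut, vadd, vscal, unit_vec.
destruct (Nat.eq_dec i r) as [->|]; [auto|ring].
Qed.

Lemma sum_lt_cut r v g : sum_lt r (fun i => cut r v i * g i) = sum_lt r (fun i => v i * g i).
Proof.
apply sum_lt_ext; intros i Hi; unfold cut; destruct (Nat.eq_dec i r); [lia|reflexivity].
Qed.

Lemma expterm_extend r v s z :
  expterm (S r) v (extend r s z) = (expterm r (cut r v) s * cexp (- (RtoC (v r) * z)))%C.
Proof.
rewrite !expterm_cexp, <- cexp_plus; f_equal; unfold vdot; rewrite !sum_lt_cut; simpl.
assert (E : extend r s z r = z) by (unfold extend; destruct (Nat.eq_dec r r); tauto).
rewrite !E.
rewrite (sum_lt_ext r (fun i => v i * fst (extend r s z i)) (fun i => v i * fst (s i))).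
  rewrite (sum_lt_ext r (fun i => v i * snd (extend r s z i)) (fun i => v i * snd (s i))).
    unfold Copp, Cplus; simpl; f_equal; ring.
  intros i Hi; unfold extend; destruct (Nat.eq_dec i r); [lia|reflexivity].
intros i Hi; unfold extend; destruct (Nat.eq_dec i r); [lia|reflexivity].
Qed.

Lemma cexp_scal_INR k z : cexp (- (RtoC (INR k) * z)) = (cexp (- z) ^ k)%C.
Proof.
induction k as [|k IH].
  simpl; replace (- (RtoC 0 * z))%C with (RtoC 0) by ring; apply cexp_0.
rewrite S_INR, RtoC_plus.
replace (- ((RtoC (INR k) + 1) * z))%C with (- z + - (RtoC (INR k) * z))%C by ring.
rewrite cexp_plus, IH; reflexivity.
Qed.

Section Substitution.
Variables (r : nat) (L : vec -> Prop) (w : vec -> R) (F : list vec) (q B : vec -> C)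
  (delta tau m : R).
Hypothesis HL : semigroup_in_orthant r L.
Hypothesis Hw : admissible_weight L w.
Hypothesis HF : forall g, In g F -> L g /\ g <> vzero.
Hypothesis HqL : forall v, q v <> 0 -> L v.
Hypothesis Hq : bounded_sums (fun v => Cmod (q v) * w v) delta.
Hypothesis Hdelta : 0 < delta.
Hypothesis Htau : 0 < tau.
Hypothesis HB : forall l, ~ span (unit_vec r :: F) l -> B l = 0.
Hypothesis Bsum : bounded_sums (fun l => Cmod (B l) * exp (tau * sum_lt (S r) l)) m.

(** A frequency [v] with [v r = k] contains the [k]-th power of the new exponential. Replacing that
    power by the [k]-th power of [q~ / delta], expanded over words [l] of length [k], gives the
    frequency [phi (v, l)] with coefficient [coef (v, l)]. *)
Let phi (p : vec * list vec) : vec := vadd (cut r (fst p)) (wsum (snd p)).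
Let coef (p : vec * list vec) : C :=
  if pb (fst p r = INR (length (snd p)))
  then (B (fst p) * (RtoC (/ delta ^ length (snd p)) * cprod q (snd p)))%C else 0.
Let W (v : vec) : R := if pb (L v) then w v else 0.

Lemma span_extended v : span (unit_vec r :: F) v ->
  exists k, v r = INR k /\ span F (cut r v) /\ L (cut r v) /\
    sum_lt r (cut r v) <= sum_lt (S r) v.
Proof.
intros [k [u [Hu ->]]].
destruct (weight_span r L w HL Hw F) with (tau := 1) as [K [_ HK]]; [|lra|].
  intros g Hg; destruct (HF g Hg); split; auto; apply (L_deg_pos r L); auto.
destruct (HK u Hu) as [Lu _]; assert (Hur : u r = 0) by (apply (proj1 HL u Lu); lia).
exists k; rewrite cut_unit by auto; split; [|split; [|split]]; auto.
  unfold vadd, vscal, unit_vec; destruct (Nat.eq_dec r r); [rewrite Hur; ring|tauto].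
assert (P : 0 <= INR k) by apply pos_INR.
simpl; unfold vadd at 2, vscal at 2, unit_vec at 2; destruct (Nat.eq_dec r r); [|tauto].
rewrite Hur, deg_vadd, deg_vscal.
rewrite (sum_lt_ext r (unit_vec r) (fun _ => 0)); [rewrite sum_lt_0; lra|].
intros i Hi; unfold unit_vec; destruct (Nat.eq_dec i r); [lia|auto].
Qed.

Lemma coef_support p : coef p <> 0 ->
  L (cut r (fst p)) /\ forall v, In v (snd p) -> L v.
Proof.
destruct p as [v l]; unfold coef; simpl; destruct (pb _); [|tauto]; intros H; split.
  assert (Hv : span (unit_vec r :: F) v).
    apply NNPP; intros Hn; apply H; rewrite HB by auto; ring.
  destruct (span_extended v Hv) as [k [_ [_ [Lv _]]]]; exact Lv.
intros u Hu; apply HqL; intros E; apply H; rewrite (cprod_eq0 q l u Hu E); ring.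
Qed.

(** For fixed [v] with [v r = k], the weighted words of length [k] sum to at most [delta ^ k], which
    cancels [/ delta ^ k]. The weight of [cut r v] is at most [K * exp (tau * deg)], and the decay
    of [B] pays for it. *)
Lemma coef_bound : exists (N : vec * list vec -> R) (M : R),
  bounded_sums N M /\ (forall p, Cmod (coef p) * W (phi p) <= N p) /\
  (forall p, Cmod (coef p) <= N p) /\ (forall p, coef p <> 0 -> L (phi p)).
Proof.
destruct Hw as [W0 [Wpos [Wmul [W1 _]]]].
destruct (weight_span r L w HL Hw F) with (tau := tau) as [K [HK1 HK]]; auto.
  intros g Hg; destruct (HF g Hg); split; auto; apply (L_deg_pos r L); auto.
set (Q := fun v => Cmod (q v) * w v) in *.
assert (HQ : forall v, 0 <= Q v).
  intros v; unfold Q; destruct (classic (q v = 0)) as [E|E].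
    rewrite E, Cmod_0, Rmult_0_l; lra.
  apply Rmult_le_pos; [apply Cmod_ge_0|apply Rlt_le, Wpos, HqL, E].
set (A := fun v => K * (Cmod (B v) * exp (tau * sum_lt (S r) v))).
assert (HA : forall v, 0 <= A v).
  intros v; unfold A; repeat apply Rmult_le_pos; try lra; [apply Cmod_ge_0|apply exp_ge0].
set (N := fun p : vec * list vec => A (fst p) *
  (if pb (fst p r = INR (length (snd p))) then / delta ^ length (snd p) * rprod Q (snd p) else 0)).
assert (HN0 : forall p, 0 <= N p).
  intros p; apply Rmult_le_pos; auto; destruct (pb _); [|lra].
  apply Rmult_le_pos; [apply Rinv_ge0, pow_lt, Hdelta|apply rprod_ge0, HQ].
assert (Hphi : forall p, coef p <> 0 -> L (phi p)).
  intros p Hp; destruct (coef_support p Hp) as [H1 H2].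
  apply HL; auto; apply (weight_wsum r L w HL Hw); auto.
assert (HW : forall p, Cmod (coef p) * W (phi p) <= N p).
  intros [v l]; destruct (classic (coef (v, l) = 0)) as [E|E].
    rewrite E, Cmod_0, Rmult_0_l; auto.
  assert (Lp := Hphi _ E); destruct (coef_support _ E) as [H1 H2]; simpl in H1, H2.
  unfold W; rewrite pbT by auto; unfold phi; simpl.
  destruct (weight_wsum r L w HL Hw l H2) as [H3 H4].
  unfold coef, N in *; simpl in *; destruct (pb (v r = INR (length l))); [|tauto].
  assert (Hv : span (unit_vec r :: F) v).
    apply NNPP; intros Hn; apply E; rewrite HB by auto; ring.
  destruct (span_extended v Hv) as [k [_ [Sv [_ Dv]]]].
  destruct (HK _ Sv) as [_ Wv].
  assert (Wv' : w (cut r v) <= K * exp (tau * sum_lt (S r) v)).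
    eapply Rle_trans; [exact Wv|]; apply Rmult_le_compat_l; [lra|].
    apply exp_le, Rmult_le_compat_l; lra.
  rewrite !Cmod_mult, Cmod_R, Rabs_pos_eq by
    (apply Rinv_ge0, pow_lt, Hdelta).
  unfold Q, A; rewrite rprod_mult, Cmod_cprod.
  set (cq := rprod (fun t => Cmod (q t)) l).
  assert (Hcq : 0 <= cq) by (apply rprod_ge0; intros; apply Cmod_ge_0).
  assert (Hd : 0 < / delta ^ length l) by (apply Rinv_0_lt_compat, pow_lt, Hdelta).
  assert (HBv := Cmod_ge_0 (B v)).
  change (sum_lt r v + v r) with (sum_lt (S r) v).
  apply Rle_trans with (Cmod (B v) * (/ delta ^ length l * cq) *
    ((K * exp (tau * sum_lt (S r) v)) * rprod w l)); [|right; ring].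
  apply Rmult_le_compat_l.
    repeat apply Rmult_le_pos; auto; lra.
  eapply Rle_trans; [apply Wmul; auto|].
  apply Rmult_le_compat; auto; apply Rlt_le, Wpos; auto.
exists N, (K * m); split; [|split; [auto|split; auto]].
- apply bounded_sums_iterated with A.
    intros v; unfold N; simpl; apply bounded_sums_ub with (A v * 1); [lra|].
    apply bounded_sums_scal; auto.
    (* If [v r] is not a natural number, no word matches it and the whole row vanishes. *)
    destruct (classic (exists k, v r = INR k)) as [[k Ek]|Hn].
      apply bounded_sums_ext with
        (fun l => / delta ^ k * (if pb (length l = k) then rprod Q l else 0)).
        intros l; rewrite Ek; destruct (classic (length l = k)) as [E|E].
          rewrite !pbT, E; auto; rewrite E; auto.
        rewrite !pbF; auto; [ring|]; intros E'; apply E, INR_eq; auto.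
      replace 1 with (/ delta ^ k * delta ^ k) by
        (field; apply pow_nonzero; lra).
      apply bounded_sums_scal; [apply Rinv_ge0, pow_lt, Hdelta|].
      apply bounded_sums_words; auto.
    intros l Hl; apply Rle_trans with (rsum (fun _ : list vec => 0 * 0) l).
      apply rsum_le; intros x _; rewrite pbF; [lra|]; intros E; apply Hn; exists (length x); auto.
    rewrite rsum_scal; lra.
  apply bounded_sums_scal; [lra|auto].
- intros p; destruct (classic (coef p = 0)) as [E|E]; [rewrite E, Cmod_0; auto|].
  eapply Rle_trans; [|apply HW]; unfold W; rewrite pbT by auto.
  rewrite <- (Rmult_1_r (Cmod _)) at 1; apply Rmult_le_compat_l; [apply Cmod_ge_0|]; auto.
Qed.

(** The element [c] consists of the fibre sums of [coef] along [phi], fixed before [s] and the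
    logarithm [z] are given. Summed over words first, the family is the expansion at [(s, z)];
    summed along [phi], it is the transform of [c]. *)
Theorem substitution : exists c : vec -> C, in_Aw L w c /\
  forall s qt z S0, Hr_closed r s -> sums_to (fun v => q v * expterm r v s)%C qt ->
    cexp (- z) = (qt / RtoC delta)%C ->
    sums_to (fun v => B v * expterm (S r) v (extend r s z))%C S0 ->
    transform r L c s = S0.
Proof.
destruct coef_bound as [N [M [HN [HW [HC Hphi]]]]].
assert (Hex : forall v, exists c, sums_to (on_fiber phi v coef) c).
  intros v; apply (sums_to_exists _ N M); auto; intros p; unfold on_fiber.
  destruct (pb _); auto; rewrite Cmod_0; eapply Rle_trans; [apply Cmod_ge_0|apply HC].
destruct (function_choice _ Hex) as [c Hc].
exists c; split.
  exists M; intros l [Hl Hf].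
  assert (K := bounded_sums_collapse phi coef c W N M).
  change (rsum (fun v => Cmod (c v) * w v) l <= M).
  rewrite Forall_forall in Hf.
  rewrite (rsum_ext _ (fun v => Cmod (c v) * W v)).
    apply K; auto; intros v; unfold W; destruct (classic (L v)) as [E|E].
      rewrite pbT by auto; apply Rlt_le, Hw, E.
    rewrite pbF by auto; lra.
  intros v Hv; unfold W; rewrite pbT; auto.
intros s qt z S0 Hs Hqt Hz HS0.
set (fs := fun p => (coef p * expterm r (phi p) s)%C).
assert (Hfs : forall p, Cmod (fs p) <= N p).
  intros p; eapply Rle_trans; [|apply HC]; unfold fs; rewrite Cmod_mult.
  destruct (classic (coef p = 0)) as [E|E]; [rewrite E, Cmod_0; lra|].
  rewrite <- (Rmult_1_r (Cmod (coef p))) at 2.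
  apply Rmult_le_compat_l; [apply Cmod_ge_0|].
  apply (Cmod_expterm_le1 r L); auto.
destruct (sums_to_exists fs N M Hfs HN) as [Z HZ].
assert (Hd : RtoC delta <> 0) by (apply RtoC_neq0; lra).
assert (EZ : Z = S0).
  apply (sums_to_unique (fun v => B v * expterm (S r) v (extend r s z))%C); auto.
  apply (sums_to_iterated fs); auto; intros v.
  destruct (classic (B v = 0)) as [E|E].
    rewrite E, Cmult_0_l; apply sums_to_ext with (fun _ : list vec => RtoC 0).
      intros l; unfold fs, coef; simpl; rewrite E; destruct (pb _); ring.
    apply sums_to_0.
  assert (Hv : span (unit_vec r :: F) v) by (apply NNPP; intros Hn; apply E, HB, Hn).
  destruct (span_extended v Hv) as [k [Ek _]].
  rewrite expterm_extend, Ek, cexp_scal_INR, Hz.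
  replace (B v * (expterm r (cut r v) s * (qt / RtoC delta) ^ k))%C with
    ((B v * expterm r (cut r v) s * RtoC (/ delta ^ k)) * qt ^ k)%C.
    apply sums_to_ext with (fun l => (B v * expterm r (cut r v) s * RtoC (/ delta ^ k)) *
      (if pb (length l = k) then cprod (fun u => q u * expterm r u s) l else 0))%C.
      intros l; unfold fs, coef, phi; simpl; rewrite Ek, expterm_vadd.
      destruct (classic (length l = k)) as [El|El].
        rewrite (pbT (length l = k)), (pbT (INR k = _)), cprod_expterm, El by congruence; ring.
      rewrite !pbF; auto; [ring|]; intros E'; apply El, INR_eq; auto.
    apply sums_to_scal.
    apply (sums_to_words _ (fun v => Cmod (q v) * w v) delta); auto.
    intros u; destruct (classic (q u = 0)) as [Eq|Eq].
      rewrite Eq, Cmult_0_l, !Cmod_0; lra.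
    assert (Lu := HqL u Eq); rewrite Cmod_mult; apply Rmult_le_compat_l; [apply Cmod_ge_0|].
    apply Rle_trans with 1; [|apply Hw, Lu].
    apply (Cmod_expterm_le1 r L); auto.
  unfold Cdiv; rewrite Cpow_mult, <- RtoC_inv, <- RtoC_pow, pow_inv by lra; ring.
apply transform_eq; rewrite <- EZ.
apply sums_to_ext with (fun v => c v * expterm r v s)%C.
  intros v; destruct (classic (L v)) as [E|E]; [rewrite pbT; auto|].
  rewrite pbF by auto; replace (c v) with (RtoC 0); [ring|].
  apply (sums_to_unique (on_fiber phi v coef)); auto.
  apply sums_to_ext with (fun _ : vec * list vec => RtoC 0).
    intros p; unfold on_fiber; destruct (classic (phi p = v)) as [Ep|Ep]; [|rewrite pbF; auto].
    rewrite pbT by auto; destruct (classic (coef p = 0)) as [E0|E0]; auto.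
    exfalso; apply E; rewrite <- Ep; apply Hphi, E0.
  apply sums_to_0.
apply (sums_to_collapse phi fs); auto; intros v; rewrite Cmult_comm.
apply sums_to_ext with (2 := sums_to_scal (expterm r v s) _ _ (Hc v)).
intros p; unfold on_fiber, fs; destruct (classic (phi p = v)) as [E|E].
  rewrite !pbT, E by auto; ring.
rewrite !pbF by auto; ring.
Qed.

End Substitution.

(** * Splitting off a small element *)

Lemma in_Aw_bounded L w (a : vec -> C) : in_Aw L w a ->
  exists M, bounded_sums (fun v => if pb (L v) then Cmod (a v) * w v else 0) M.
Proof.
intros [M HM]; exists M; intros l Hl.
rewrite (rsum_split _ (fun v => pb (L v)) l).
rewrite (rsum_ext _ (fun _ => 0 * 0) (filter (fun x => negb _) l)).
  rewrite rsum_scal, Rmult_0_l, Rplus_0_r.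
  rewrite (rsum_ext _ (fun v => Cmod (a v) * w v)).
    apply (HM (filter (fun v => pb (L v)) l)).
    split; [apply NoDup_filter, Hl|].
    apply Forall_forall; intros x; rewrite filter_In, pbP; tauto.
  intros x; rewrite filter_In; intros [_ E]; rewrite E; reflexivity.
intros x; rewrite filter_In; intros [_ E]; destruct (pb (L x)); [discriminate|ring].
Qed.

(** [F] keeps the nonzero frequencies of a finite list outside which [a] has norm below [eps]; [q]
    is the rest plus the constant [2 * eps], of norm at most [3 * eps]. The zero frequency stays
    apart because generators must have positive degree. *)
Lemma decomposition r L w (a : vec -> C) eps : semigroup_in_orthant r L ->
  admissible_weight L w -> in_Aw L w a -> 0 < eps ->
  exists (F : list vec) (q : vec -> C), NoDup F /\ (forall g, In g F -> L g /\ g <> vzero) /\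
    (forall v, q v <> 0 -> L v) /\ bounded_sums (fun v => Cmod (q v) * w v) (3 * eps) /\
    forall s, Hr_closed r s -> exists qt, sums_to (fun v => q v * expterm r v s)%C qt /\
      Cmod (qt - RtoC (2 * eps)) <= eps /\
      transform r L a s =
        (a vzero - RtoC (2 * eps) + csum (fun g => a g * expterm r g s) F + qt)%C.
Proof.
intros HL Hw Ha Heps; destruct (in_Aw_bounded L w a Ha) as [M HM].
set (N := fun v => if pb (L v) then Cmod (a v) * w v else 0) in *.
destruct Hw as [W0 [Wpos [Wmul [W1 _]]]].
assert (HN0 : forall v, 0 <= N v).
  intros v; unfold N; destruct (classic (L v)) as [E|E]; [rewrite pbT|rewrite pbF]; auto; [|lra].
  apply Rmult_le_pos; [apply Cmod_ge_0|apply Rlt_le, Wpos, E].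
destruct (tail_small N M HM eps Heps) as [F0 [HF0 Htail]].
set (F := filter (fun v => pb (L v /\ v <> vzero)) F0).
assert (HF : forall g, In g F <-> In g F0 /\ L g /\ g <> vzero).
  intros g; unfold F; rewrite filter_In, pbP; tauto.
set (rest := fun v => L v /\ v <> vzero /\ ~ In v F).
set (q1 := fun v => if pb (rest v) then a v else 0).
set (q0 := fun v => if pb (v = vzero) then RtoC (2 * eps) else 0).
assert (L0 : L vzero) by apply HL.
(* The two parts of [q] have disjoint supports, so their norms simply add. *)
assert (H01 : q1 vzero = 0) by (unfold q1; rewrite pbF; auto; unfold rest; tauto).
assert (Hq1 : bounded_sums (fun v => Cmod (q1 v) * w v) eps).
  intros l Hl; apply Rlt_le.
  apply Rle_lt_trans with (rsum N (filter (fun v => pb (rest v)) l)).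
    rewrite (rsum_split _ (fun v => pb (rest v)) l).
    rewrite (rsum_ext _ (fun _ => 0 * 0) (filter (fun x => negb _) l)).
      rewrite rsum_scal, Rmult_0_l, Rplus_0_r; apply rsum_le.
      intros x; rewrite filter_In; intros [_ E]; unfold q1, N; rewrite E.
      rewrite pbP in E; rewrite pbT; [lra|apply E].
    intros x; rewrite filter_In; intros [_ E]; unfold q1; destruct (pb (rest x)); [discriminate|].
    rewrite Cmod_0; ring.
  apply Htail; [apply NoDup_filter, Hl|].
  intros x; rewrite filter_In, pbP; intros [_ [E1 [E2 E3]]] E4; apply E3, HF; auto.
assert (Hq0 : bounded_sums (fun v => Cmod (q0 v) * w v) (2 * eps)).
  replace (2 * eps) with (rsum (fun v => Cmod (q0 v) * w v) [vzero]).
    apply bounded_sums_finite; [apply NoDup_single| |].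
      intros v; unfold q0; destruct (classic (v = vzero)) as [->|E].
        rewrite pbT, W0 by auto; generalize (Cmod_ge_0 (RtoC (2 * eps))); lra.
      rewrite pbF, Cmod_0 by auto; lra.
    intros v Hv; unfold q0; rewrite pbF, Cmod_0; [ring|]; intros E; apply Hv; simpl; auto.
  unfold rsum, q0; simpl; rewrite pbT, W0, Cmod_R, Rabs_pos_eq by (auto || lra); ring.
assert (q1L : forall v, q1 v <> 0 -> L v).
  intros v; unfold q1; destruct (pb (rest v)) eqn:E; [|tauto].
  rewrite pbP in E; intros _; apply E.
exists F, (fun v => q0 v + q1 v)%C; split; [apply NoDup_filter, HF0|]; split; [|split; [|split]].
- intros g Hg; apply HF, Hg.
- intros v Hv; destruct (classic (q1 v = 0)) as [E|E]; [|auto].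
  unfold q0 in Hv; destruct (classic (v = vzero)) as [->|E']; auto.
  rewrite pbF in Hv by auto; exfalso; apply Hv; rewrite E; ring.
- replace (3 * eps) with (2 * eps + eps) by ring.
  apply bounded_sums_ext with (2 := bounded_sums_plus _ _ _ _ Hq0 Hq1).
  intros v; destruct (classic (v = vzero)) as [->|E].
    rewrite H01, Cmod_0, Cplus_0_r; ring.
  unfold q0; rewrite pbF, Cmod_0, Cplus_0_l by auto; ring.
intros s Hs.
assert (B1 : forall v, Cmod (q1 v * expterm r v s) <= Cmod (q1 v) * w v).
  intros v; destruct (classic (q1 v = 0)) as [E|E]; [rewrite E, Cmult_0_l, Cmod_0; lra|].
  assert (Lv := q1L v E); rewrite Cmod_mult; apply Rmult_le_compat_l; [apply Cmod_ge_0|].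
  apply Rle_trans with 1; auto; apply (Cmod_expterm_le1 r L); auto.
destruct (sums_to_exists _ _ _ B1 Hq1) as [t1 Ht1].
assert (S0 : forall c : C,
  sums_to (fun v => (if pb (v = vzero) then c else 0) * expterm r v s)%C c).
  intros c; set (g := fun v => ((if pb (v = vzero) then c else 0) * expterm r v s)%C).
  assert (E : csum g [vzero] = c).
    unfold csum, g; simpl; rewrite pbT, expterm_zero by auto; ring.
  rewrite <- E; apply sums_to_finite; [apply NoDup_single|].
  intros v Hv; unfold g; rewrite pbF; [ring|]; intros E'; apply Hv; simpl; auto.
exists (RtoC (2 * eps) + t1)%C; split; [|split].
- apply sums_to_ext with (fun v => q0 v * expterm r v s + q1 v * expterm r v s)%C.
    intros; ring.
  apply sums_to_plus; auto; apply S0.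
- replace (RtoC (2 * eps) + t1 - RtoC (2 * eps))%C with t1 by ring.
  apply (sums_to_le _ _ _ _ B1 Hq1 Ht1).
- apply transform_eq.
  set (p := fun v => if pb (In v F) then a v else 0).
  assert (Sp : sums_to (fun v => p v * expterm r v s)%C (csum (fun g => a g * expterm r g s)%C F)).
    replace (csum (fun g => a g * expterm r g s)%C F) with
      (csum (fun g => p g * expterm r g s)%C F).
      apply sums_to_finite; [apply NoDup_filter, HF0|].
      intros v Hv; unfold p; rewrite pbF; auto; ring.
    apply csum_ext; intros v Hv; unfold p; rewrite pbT; auto.
  replace (a vzero - RtoC (2 * eps) + csum (fun g => a g * expterm r g s) F +
    (RtoC (2 * eps) + t1))%C with
    (a vzero + (csum (fun g => a g * expterm r g s) F + t1))%C by ring.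
  apply sums_to_ext with (2 := sums_to_plus _ _ _ _ (S0 (a vzero)) (sums_to_plus _ _ _ _ Sp Ht1)).
  intros v; destruct (classic (v = vzero)) as [->|E].
    rewrite (pbT (L vzero)), (pbT (vzero = vzero)), H01 by auto.
    unfold p; rewrite pbF; [ring|]; rewrite HF; tauto.
  rewrite (pbF (v = vzero)) by auto; unfold p, q1.
  destruct (classic (L v)) as [E1|E1].
    rewrite (pbT (L v)) by auto; destruct (classic (In v F)) as [E2|E2].
      rewrite (pbT (In v F)), (pbF (rest v)) by (auto || (unfold rest; tauto)); ring.
    rewrite (pbF (In v F)), (pbT (rest v)) by (auto || (unfold rest; tauto)); ring.
  rewrite (pbF (L v)), (pbF (In v F)), (pbF (rest v)) by
    (auto || (unfold rest; tauto) || (rewrite HF; tauto)); ring.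
Qed.

(** The difference is [exp x * (1 - exp (- (2 * x)))], at most [3 * (2 * x)]. *)
Lemma exp_gap x : 0 <= x <= 1 -> exp x - exp (- x) <= 6 * x.
Proof.
intros Hx.
assert (A : exp (- x) = exp x * exp (- (2 * x))) by (rewrite <- exp_plus; f_equal; ring).
assert (B : 1 - 2 * x <= exp (- (2 * x))).
  destruct (Req_dec x 0) as [->|E]; [rewrite Rmult_0_r, Ropp_0, exp_0; lra|].
  generalize (exp_ineq1 (- (2 * x)) ltac:(lra)); lra.
assert (D : exp x <= 3) by (eapply Rle_trans; [apply exp_le, Hx|apply exp_le_3]).
assert (P := exp_pos x); rewrite A; nra.
Qed.

Lemma expterm_shift_close r v s eta : in_orthant r v -> 0 <= eta -> eta * sum_lt r v <= 1 ->
  half_space r (- eta) s ->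
  Cmod (expterm r v s - expterm r v (shift s (RtoC (2 * eta)))) <= 6 * (eta * sum_lt r v).
Proof.
intros Hv Heta H1 Hs; assert (Hd := in_orthant_deg r v Hv).
assert (Hp : 0 <= eta * sum_lt r v) by (apply Rmult_le_pos; auto).
rewrite expterm_shift.
replace (- (RtoC (sum_lt r v) * RtoC (2 * eta)))%C with
  (RtoC (- (2 * (eta * sum_lt r v)))) by
  (rewrite <- RtoC_mult, <- RtoC_opp; f_equal; ring).
rewrite cexp_RtoC; set (x := eta * sum_lt r v) in *.
replace (expterm r v s - expterm r v s * RtoC (exp (- (2 * x))))%C with
  (expterm r v s * RtoC (1 - exp (- (2 * x))))%C by (rewrite RtoC_minus; ring).
assert (E2 : exp (- (2 * x)) <= 1) by (rewrite <- exp_0; apply exp_le; lra).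
rewrite Cmod_mult, Cmod_R, Rabs_pos_eq by lra.
apply Rle_trans with (exp x * (1 - exp (- (2 * x)))).
  apply Rmult_le_compat_r; [lra|].
  eapply Rle_trans; [apply (Cmod_expterm_le r v s (- eta)); [apply Hv|auto]|].
  right; f_equal; unfold x; ring.
eapply Rle_trans; [|apply (exp_gap x); lra]; right.
rewrite Rmult_minus_distr_l, <- exp_plus, Rmult_1_r; f_equal; f_equal; ring.
Qed.

(** The shift by [2 * eta] carries [Re s >= - eta] to [Re s >= eta], inside the open half-space
    where values of the transform are known to have neighbourhoods in the region. *)
Lemma exp_poly_close r F (a : vec -> C) eps : (forall g, In g F -> in_orthant r g) -> 0 < eps ->
  exists eta, 0 < eta <= / 2 /\ forall s, half_space r (- eta) s ->
    Cmod (csum (fun g => a g * expterm r g s)%C F -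
      csum (fun g => a g * expterm r g (shift s (RtoC (2 * eta))))%C F) <= eps.
Proof.
intros HF Heps.
set (D := rsum (sum_lt r) F); set (A := rsum (fun g => Cmod (a g) * sum_lt r g) F).
assert (HD : forall g, In g F -> 0 <= sum_lt r g) by (intros; apply in_orthant_deg; auto).
assert (HD0 : 0 <= D) by (apply rsum_ge0; auto).
assert (HA0 : 0 <= A).
  apply rsum_ge0; intros; apply Rmult_le_pos; [apply Cmod_ge_0|auto].
assert (HgD : forall g, In g F -> sum_lt r g <= D).
  unfold D; clear - HD; induction F as [|h F IH]; intros g Hg; [destruct Hg|].
  rewrite rsum_cons; assert (0 <= rsum (sum_lt r) F) by
    (apply rsum_ge0; intros; apply HD; simpl; auto).
  destruct Hg as [->|Hg]; [lra|].
  assert (K := IH (fun g Hg => HD g (or_intror Hg)) g Hg).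
  generalize (HD h (or_introl eq_refl)); lra.
assert (I1 : 0 < / (D + 2)) by (apply Rinv_0_lt_compat; lra).
assert (I2 : 0 < eps / (6 * (A + 1))) by (apply Rdiv_lt_0_compat; lra).
(* The first bound gives [eta * deg <= 1] for every frequency, as well as [eta <= / 2], which later
   keeps the new exponential at most [2]. The second makes the total change at most [eps]. *)
set (eta := Rmin (/ (D + 2)) (eps / (6 * (A + 1)))).
assert (E0 : 0 < eta) by (apply Rmin_pos; auto).
assert (E1 : eta <= / (D + 2)) by apply Rmin_l.
assert (E2 : eta <= eps / (6 * (A + 1))) by apply Rmin_r.
exists eta; split.
  split; auto; eapply Rle_trans; [exact E1|]; apply Rinv_le_contravar; lra.
intros s Hs.
replace (csum (fun g => a g * expterm r g s)%C F -
  csum (fun g => a g * expterm r g (shift s (RtoC (2 * eta))))%C F)%C with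
  (csum (fun g => a g * (expterm r g s - expterm r g (shift s (RtoC (2 * eta)))))%C F).
  apply Rle_trans with (rsum (fun g => 6 * eta * (Cmod (a g) * sum_lt r g)) F).
    apply csum_le; intros g Hg; rewrite Cmod_mult.
    replace (6 * eta * (Cmod (a g) * sum_lt r g)) with
      (Cmod (a g) * (6 * (eta * sum_lt r g))) by ring.
    apply Rmult_le_compat_l; [apply Cmod_ge_0|].
    apply expterm_shift_close; auto; [lra|].
    apply Rle_trans with (/ (D + 2) * (D + 2)); [|right; field; lra].
    apply Rmult_le_compat; auto; [lra|]; specialize (HgD g Hg); lra.
  rewrite rsum_scal; fold A.
  apply Rle_trans with (6 * (eps / (6 * (A + 1))) * (A + 1)); [|right; field; lra].
  apply Rmult_le_compat; lra.
rewrite (csum_ext _ (fun g => a g * expterm r g s +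
  (-1) * (a g * expterm r g (shift s (RtoC (2 * eta)))))%C) by (intros; ring).
rewrite csum_plus, csum_scal; ring.
Qed.

Lemma transform_bounded r L w a : semigroup_in_orthant r L -> admissible_weight L w ->
  in_Aw L w a -> exists M, forall s, Hr_closed r s -> Cmod (transform r L a s) <= M.
Proof.
intros HL Hw Ha; destruct (in_Aw_bounded L w a Ha) as [M HM]; exists M; intros s Hs.
set (fs := fun v => if pb (L v) then (a v * expterm r v s)%C else 0).
assert (B : forall v, Cmod (fs v) <= (if pb (L v) then Cmod (a v) * w v else 0)).
  intros v; unfold fs; destruct (pb (L v)) eqn:E; [|rewrite Cmod_0; lra].
  rewrite pbP in E; rewrite Cmod_mult; apply Rmult_le_compat_l; [apply Cmod_ge_0|].
  apply Rle_trans with 1; [|apply Hw, E]; apply (Cmod_expterm_le1 r L); auto.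
destruct (sums_to_exists _ _ _ B HM) as [S HS].
rewrite (transform_eq r L a s S HS); apply (sums_to_le _ _ _ _ B HM HS).
Qed.

Theorem theorem5 (r : nat) (L : vec -> Prop) (G : Cplx -> Prop) (f : Cplx -> Cplx)
  (w : vec -> R) (a : vec -> Cplx) :
  semigroup_in_orthant r L ->
  C_region G ->
  holomorphic_on f G ->
  admissible_weight L w ->
  in_Aw L w a ->
  (forall z, C_closure (fun y => exists s, Hr r s /\ y = transform r L a s) z -> G z) ->
  exists c : vec -> Cplx, in_Aw L w c /\
    forall s, Hr_closed r s -> f (transform r L a s) = transform r L c s.
Proof.
intros HL [_ [HGo _]] Hf Hw Ha Hcl.
set (S := fun y : C => exists s, Hr r s /\ y = transform r L a s) in *.
assert (Hrc : forall s, Hr r s -> Hr_closed r s).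
  intros s Hs i Hi; apply Rlt_le, Hs, Hi.
destruct (transform_bounded r L w a HL Hw Ha) as [b Hb].
destruct (uniform_neighbourhood G S f b) as [d [M [Hd HM]]]; auto.
  intros z [s [Hs ->]]; auto.
  intros z Hz; apply (holomorphic_cdiff f G z Hf Hz).
(* Two distances must stay below [d]: [13 * eps] from [P] to a value of the transform, and
   [15 * eps] from a point of the disc about [a0] to such a value. *)
set (eps := d / 20); assert (Heps : 0 < eps) by (unfold eps; lra).
destruct (decomposition r L w a eps HL Hw Ha Heps) as [F [q [HF [HFL [HqL [Hq Hdec]]]]]].
assert (HFo : forall g, In g F -> in_orthant r g).
  intros g Hg; apply (proj1 HL), HFL, Hg.
destruct (exp_poly_close r F a eps HFo Heps) as [eta [Heta Hclose]].
set (e := unit_vec r); set (delta := 4 * eps).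
assert (He : e r = 1) by (unfold e, unit_vec; destruct (Nat.eq_dec r r); tauto).
assert (HFr : forall g, In g F -> g r = 0) by (intros g Hg; apply (HFo g Hg); lia).
(* [e] has entry [1] at [r], where the frequencies in [F] vanish, so [delta] overwrites none of
   their coefficients. *)
set (al := fun g => if pb (g = e) then RtoC delta else a g).
assert (Hale : al e = RtoC delta) by (unfold al; rewrite pbT; auto).
assert (HalF : forall g, In g F -> al g = a g).
  intros g Hg; unfold al; rewrite pbF; auto; intros ->; specialize (HFr e Hg); lra.
set (a0 := (a vzero - RtoC (2 * eps))%C).
set (P := exp_poly (Datatypes.S r) (e :: F) al a0).
assert (HP : forall s, P s = (a0 + csum (fun g => a g * expterm r g s) F +
    RtoC delta * cexp (- s r))%C).
  intros s; unfold P, exp_poly; rewrite csum_cons, Hale.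
  assert (Es : s = extend r s (s r)).
    apply functional_extensionality; intros i; unfold extend.
    destruct (Nat.eq_dec i r) as [->|]; auto.
  rewrite (csum_ext _ (fun g => a g * expterm r g s)%C F).
    rewrite Es at 1; rewrite expterm_extend, He.
    replace (cut r e) with vzero.
      rewrite expterm_zero, !Cmult_1_l; ring.
    apply functional_extensionality; intros i; unfold cut, e, unit_vec, vzero.
    destruct (Nat.eq_dec i r); auto.
  intros g Hg; rewrite (HalF g Hg); rewrite Es at 1; rewrite expterm_extend, HFr, cut_id by auto.
  replace (- (RtoC 0 * s r))%C with (RtoC 0) by ring; rewrite cexp_0; ring.
(* Four differences contribute: [eps] from shifting the finite part, [8 * eps] from the new
   exponential ([delta] times at most [2]), [eps] from the deviation of [qt], and [2 * eps] from its
   constant. *)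
assert (Hnear : forall s, half_space (Datatypes.S r) (- eta) s ->
    exists y, S y /\ Cmod (P s - y) < 13 * eps).
  intros s Hs; set (s' := shift s (RtoC (2 * eta))).
  assert (Hs' : Hr r s').
    intros i Hi; unfold s', shift; simpl; specialize (Hs i ltac:(lia)); lra.
  exists (transform r L a s'); split; [exists s'; auto|].
  destruct (Hdec s' (Hrc _ Hs')) as [qt [_ [Hqt1 Hqt2]]].
  rewrite Hqt2, HP; fold a0.
  assert (K := Hclose s); fold s' in K.
  assert (K1 : half_space r (- eta) s) by (intros i Hi; apply Hs; lia).
  specialize (K K1).
  set (c1 := csum (fun g => a g * expterm r g s)%C F) in *.
  set (c2 := csum (fun g => a g * expterm r g s')%C F) in *.
  replace (a0 + c1 + RtoC delta * cexp (- s r) - (a0 + c2 + qt))%C with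
    ((c1 - c2) + (RtoC delta * cexp (- s r) +
      (- (qt - RtoC (2 * eps)) + - RtoC (2 * eps))))%C by ring.
  assert (K2 : Cmod (RtoC delta * cexp (- s r)) <= 8 * eps).
    rewrite Cmod_mult, Cmod_cexp, Cmod_R, Rabs_pos_eq by (unfold delta; lra).
    specialize (Hs r ltac:(lia)).
    assert (exp (fst (- s r)%C) <= 2); [|unfold delta; nra].
    apply Rle_trans with (exp (/ 2)); [apply exp_le; simpl; lra|].
    assert (X := exp_ineq1 (- / 2) ltac:(lra)).
    rewrite exp_Ropp in X; assert (Y := exp_pos (/ 2)).
    apply (Rmult_lt_compat_r (exp (/ 2))) in X; auto.
    rewrite Rinv_l in X by lra; lra.
  assert (K3 : Cmod (RtoC (2 * eps)) = 2 * eps) by (rewrite Cmod_R, Rabs_pos_eq; lra).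
  apply Cmod_plus_lt.
  eapply Rle_lt_trans; [apply Rplus_le_compat_l, Cmod_triangle|].
  eapply Rle_lt_trans; [apply Rplus_le_compat_l, Rplus_le_compat_l, Cmod_triangle|].
  rewrite !Cmod_opp, K3; lra.
assert (Horth : forall g, In g (e :: F) -> in_orthant (Datatypes.S r) g).
  intros g [<-|Hg].
    split; intros i Hi; unfold e, unit_vec; destruct (Nat.eq_dec i r); lra || lia.
  destruct (HFo g Hg) as [A1 A2]; split; intros i Hi.
    destruct (Nat.eq_dec i r) as [->|]; [rewrite A2; [lra|lia]|apply A1; lia].
  apply A2; lia.
assert (Hdeg : forall g, In g (e :: F) -> 0 < sum_lt (Datatypes.S r) g).
  intros g [<-|Hg]; simpl.
    rewrite He, (sum_lt_ext r e (fun _ => 0)); [rewrite sum_lt_0; lra|].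
    intros i Hi; unfold e, unit_vec; destruct (Nat.eq_dec i r); [lia|auto].
  rewrite (HFr g Hg), Rplus_0_r; destruct (HFL g Hg); apply (L_deg_pos r L); auto.
destruct (composition_expansion (Datatypes.S r) (e :: F) al a0 f eta eps M) as
  [B [tau [m [Htau [HB [HBm HBs]]]]]]; auto; try lra.
- constructor; auto; intros Hi; specialize (HFr e Hi); lra.
- intros s Hs; destruct (Hnear s Hs) as [y [Hy1 Hy2]].
  destruct (HM (P s) y Hy1) as [K1 K2]; [unfold eps in Hy2; lra|].
  split; [apply (holomorphic_cdiff f G _ Hf K1)|exact K2].
(* [a0] need not be a value of [P], but it is the limit far to the right: [P s0] is within [eps] of
   it. *)
- destruct (small_exp_sum (Datatypes.S r) (e :: F) (fun g => Cmod (al g)) Hdeg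
    (fun g => Cmod_ge_0 (al g)) eps Heps) as [sig [Hsig Ksig]].
  set (s0 := (fun _ => RtoC sig) : cvec).
  assert (Hs0 : half_space (Datatypes.S r) sig s0) by (intros i _; simpl; lra).
  assert (Hs1 : half_space (Datatypes.S r) (- eta) s0) by (intros i _; simpl; lra).
  assert (Ha0 : Cmod (P s0 - a0) <= eps).
    eapply Rle_trans; [|apply (Ksig sig); lra].
    unfold P, exp_poly.
    replace (a0 + csum (fun g => al g * expterm (Datatypes.S r) g s0) (e :: F) - a0)%C with
      (csum (fun g => al g * expterm (Datatypes.S r) g s0)%C (e :: F)) by ring.
    apply csum_le; intros g Hg; rewrite Cmod_mult; apply Rmult_le_compat_l; [apply Cmod_ge_0|].
    apply Cmod_expterm_le; auto; apply Horth, Hg.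
  destruct (Hnear s0 Hs1) as [y [Hy1 Hy2]].
  intros z Hz; destruct (HM z y Hy1) as [K1 K2].
    replace (z - y)%C with ((z - a0) + (- (P s0 - a0) + (P s0 - y)))%C by ring.
    apply Cmod_plus_lt.
    eapply Rle_lt_trans; [apply Rplus_le_compat_l, Cmod_triangle|].
    rewrite Cmod_opp; unfold eps in *; lra.
  split; [apply (holomorphic_cdiff f G _ Hf K1)|exact K2].
- assert (Hdelta : 0 < delta) by (unfold delta; lra).
  destruct (substitution r L w F q B delta tau m HL Hw HFL HqL) as [c [Hc1 Hc2]]; auto.
    apply (bounded_sums_ub _ (3 * eps)); [unfold delta; lra|auto].
  exists c; split; auto; intros s Hs.
  destruct (Hdec s Hs) as [qt [Hqt [Hqt1 Hqt2]]].
  assert (Hd0 : RtoC delta <> 0) by (apply RtoC_neq0; lra).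
  assert (Ey : (qt / RtoC delta = RtoC (/ delta) * qt)%C).
    rewrite RtoC_inv by lra; unfold Cdiv; ring.
  (* [qt] has real part at least [eps] and modulus at most [3 * eps], below [delta = 4 * eps]. *)
  destruct (log_exists (qt / RtoC delta)) as [z [Hz1 Hz2]].
  + rewrite Ey; simpl; rewrite Rmult_0_l, Rminus_0_r.
    apply Rmult_lt_0_compat; [apply Rinv_0_lt_compat, Hdelta|].
    apply Cmod_fst_ge in Hqt1; simpl in Hqt1; lra.
  + rewrite Ey, Cmod_mult, Cmod_R, Rabs_pos_eq by (apply Rinv_ge0, Hdelta).
    apply (Rmult_le_reg_l delta); auto.
    rewrite <- Rmult_assoc, Rinv_r, Rmult_1_l, Rmult_1_r by lra.
    replace qt with ((qt - RtoC (2 * eps)) + RtoC (2 * eps))%C by ring.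
    apply Cmod_plus_le.
    rewrite Cmod_R, Rabs_pos_eq; unfold delta; lra.
  (* With [z] a logarithm of [qt / delta], the new exponential restores [qt] exactly, so [P] at
     [(s, z)] equals the transform of [a] at [s]. *)
  + symmetry; apply (Hc2 s qt z _ Hs Hqt Hz2).
    replace (transform r L a s) with (P (extend r s z)).
      apply HBs; intros i Hi; unfold extend; destruct (Nat.eq_dec i r); [auto|apply Hs; lia].
    rewrite HP, Hqt2; fold a0.
    replace (extend r s z r) with z by (unfold extend; destruct (Nat.eq_dec r r); tauto).
    rewrite Hz2.
    rewrite (csum_ext _ (fun g => a g * expterm r g s)%C F); [field; auto|].
    intros g Hg; f_equal; rewrite !expterm_cexp; f_equal; f_equal; unfold vdot.
    f_equal; apply sum_lt_ext; intros i Hi; unfold extend; destruct (Nat.eq_dec i r); lia || auto.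
Qed.
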